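(* Let $\mathbb I:so(n)\to so(n)^*\cong so(n)$ be the inertia tensor of the ball (defining a left-invariant metric on $SO(n)$), $D=m\rho^2$, $\epsilon=\sigma/(\sigma\pm\rho)$, and for $\gamma\in S^{n-1}$ let $\kappa=\mathbb I+D\,\mathrm{pr}_{\mathfrak v_\gamma}$ and $\mu(\gamma)=\sqrt{\det(\kappa)}=\sqrt{\det(\mathbb I+D\,\mathrm{pr}_{\mathfrak v_\gamma})}$. (i) The problem of the rolling (without slipping) of a ball over a sphere, i.e. the system $$\dot{\mathbf k}=[\mathbf k,\omega],\qquad \dot g=g\cdot\omega,\qquad \dot\gamma=-\epsilon\,\omega\gamma,\qquad \mathbf k=\kappa(\omega),$$ on $T^*SO(n)\times S^{n-1}$ in variables $(\mathbf k,g,\gamma)$, has an invariant measure $$\mu^{-1}\,\varOmega^d\wedge\mathrm d\gamma=\frac{1}{\sqrt{\det(\kappa)}}\,\varOmega^d\wedge\mathrm d\gamma=\frac{1}{\sqrt{\det(\mathbb I+D\,\mathrm{pr}_{\mathfrak v_\gamma})}}\,\varOmega^d\wedge\mathrm d\gamma ,$$ while the reduced flow $\dot{\mathbf k}=[\mathbf k,\omega]$, $\dot\gamma=-\epsilon\,\omega\gamma$ on $so(n)^*\times S^{n-1}$ in variables $(\mathbf k,\gamma)$ has an invariant measure $$\mu^{-1}\,\mathrm d\mathbf k\wedge\mathrm d\gamma=\frac{1}{\sqrt{\det(\mathbb I+D\,\mathrm{pr}_{\mathfrak v_\gamma})}}\,\mathrm d\mathbf k\wedge\mathrm d\gamma .$$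 (ii) For the inertia operator $$\mathbb I(E_i\wedge E_j)=\frac{Da_ia_j}{D-a_ia_j}\,E_i\wedge E_j,$$ where $0<a_ia_j<D$ for $i,j=1,\dots,n$, the function $\mu(\gamma)=\sqrt{\det(\mathbb I+D\,\mathrm{pr}_{\mathfrak v_\gamma})}$ is proportional to $$(\gamma,A^{-1}\gamma)^{\frac12(n-2)},\qquad A=\mathrm{diag}(a_1,\dots,a_n).$$
   Context: Vectors of $\mathbb R^n$ are columns, $(x,y)=x^Ty$, $x\otimes y=xy^T$, $x\wedge y=xy^T-yx^T$; $E_1,\dots,E_n$ is the standard basis of $\mathbb R^n$. The identification $so(n)\cong so(n)^*$ is by $\langle X,Y\rangle=-\frac12\mathrm{tr}(XY)$. For $\gamma\in S^{n-1}$, $\mathfrak v_\gamma=\mathbb R^n\wedge\gamma\subset so(n)$ and $\mathrm{pr}_{\mathfrak v_\gamma}\xi=(\xi\gamma)\wedge\gamma=\xi\,\gamma\otimes\gamma+\gamma\otimes\gamma\,\xi$ is the orthogonal projection onto it. $T^*SO(n)\cong so(n)^*\times SO(n)$ by left trivialization, with $\mathbf k$ the $so(n)^*$-component. The constants come from a balanced ball of mass $m$ and radius $\rho$ in $\mathbb R^n$ rolling without slipping over a fixed $(n-1)$-dimensional sphere of radius $\sigma$: sign $+$ for rolling over the outer surface of the fixed sphere, sign $-$ for rolling over its inner surface ($\sigma>\rho$) or for a spherical shell rolling around a fixed sphere in its interior ($\sigma<\rho$). Here $g\in SO(n)$ is the rotation matrix of the ball, $\omega=g^{-1}\dot g$ its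 angular velocity in the body frame, and $\gamma$ the outward unit normal to the fixed sphere at the contact point, expressed in the body frame. $\varOmega$ is the canonical symplectic form on $T^*SO(n)$, $d=\dim SO(n)$; $\mathrm d\mathbf k$ and $\mathrm d\gamma$ are the standard volume forms on $so(n)^*$ and $S^{n-1}$. A system has an invariant measure given by a volume form if its flow preserves that volume form. *)

(* Defs.v *)
From mathcomp Require Export all_boot all_order all_algebra all_fingroup.
From mathcomp Require Export all_classical all_reals all_analysis.

Set Implicit Arguments.
Unset Strict Implicit.
Unset Printing Implicit Defensive.

Export Order.TTheory GRing.Theory Num.Theory numFieldNormedType.Exports.
#[export] Set Implicit Arguments.
#[export] Unset Strict Implicit.
#[export] Unset Printing Implicit Defensive.

Local Open Scope ring_scope.

(** * Differential forms and flows on subsets of a normed space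

    A manifold is represented as a subset [M] of an ambient normed space [V].
    A form is a family of functions of [k] vectors of [V]; only its values at
    points of [M] on vectors tangent to [M] are meaningful. *)

Section Forms.
Variables (R : realType) (V : normedModType R).

Definition dform (k : nat) := V -> ('I_k -> V) -> R.

(* Normalised so that dx_1 /\ ... /\ dx_k is the determinant. *)
Definition wedge (p q : nat) (alpha : dform p) (beta : dform q) :
    dform (p + q) := fun x v =>
  (p`! * q`!)%:R^-1 *
  \sum_(s : 'S_(p + q)) (-1) ^+ s *
    (alpha x (fun i => v (s (lshift q i))) *
     beta x (fun j => v (s (rshift p j)))).

Fixpoint wedge_pow {p : nat} (alpha : dform p) (k : nat) : dform (k * p) :=
  match k with
  | 0 => fun _ _ => 1
  | k'.+1 => wedge alpha (@wedge_pow p alpha k')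
  end.

Definition scale_form (k : nat) (f : V -> R) (alpha : dform k) : dform k :=
  fun x v => f x * alpha x v.

(* Exterior derivative of a 1-form given on all of [V] (constant vector fields
   on [V] commute, so there is no bracket term).  Since d commutes with
   pullback to [M], its restriction to vectors tangent to [M] is the exterior
   derivative of the restriction of [theta] to [M]. *)
Definition ext_deriv1 (theta : V -> V -> R) : dform 2 := fun x v =>
  'D_(v ord0) (theta ^~ (v ord_max)) x - 'D_(v ord_max) (theta ^~ (v ord0)) x.

Definition curve_at (M : set V) (x v : V) (c : R -> V) : Prop :=
  [/\ forall s, M (c s), c 0 = x & is_derive (0 : R) 1 c v].

Definition tangent (M : set V) (x v : V) : Prop := exists c, curve_at M x v c.

Definition is_tangent_map (M : set V) (F : V -> V) (x : V) (dF : V -> V) : Prop :=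
  forall v c, curve_at M x v c -> is_derive (0 : R) 1 (F \o c) (dF v).

(* [F] is differentiable along [M] and F^* alpha = alpha on [M]. *)
Definition preserves_form (M : set V) (k : nat) (alpha : dform k)
    (F : V -> V) : Prop :=
  forall x, M x -> exists2 dF, is_tangent_map M F x dF &
    forall v : 'I_k -> V, (forall i, tangent M x (v i)) ->
      alpha (F x) (dF \o v) = alpha x v.

(* [X x v] means that the vector field takes the value [v] at [x]. *)
Definition is_flow (M : set V) (X : V -> V -> Prop) (phi : R -> V -> V) : Prop :=
  forall x, M x -> phi 0 x = x /\
    forall t, M (phi t x) /\
      exists2 v, X (phi t x) v & is_derive t 1 (phi ^~ x) v.

(* Flows are complete.  For the rolling ball this is no restriction: <k, k> is
   conserved and SO(n) and the sphere are compact. *)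
Definition invariant_volume (M : set V) (X : V -> V -> Prop) (k : nat)
    (alpha : dform k) : Prop :=
  forall phi, is_flow M X phi -> forall t, preserves_form M alpha (phi t).

End Forms.
Arguments wedge_pow {R V p} alpha k.

(* Pullback along a linear map [f], which is its own differential. *)
Definition pull_linear (R : realType) (V W : normedModType R) (f : V -> W)
    (k : nat) (alpha : dform W k) : dform V k :=
  fun x v => alpha (f x) (f \o v).

(** * so(n), SO(n) and the sphere *)

Section Orthogonal.
Variables (R : realType) (n : nat).
Implicit Types (X Y : 'M[R]_n) (x y gam : 'cV[R]_n).

Definition dotv x y : R := (x^T *m y) 0 0.
Definition wedgev x y : 'M[R]_n := x *m y^T - y *m x^T.
Definition stdv (i : 'I_n) : 'cV[R]_n := delta_mx i 0.

Definition so : set 'M[R]_n := [set X | X^T = - X].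
Definition SO : set 'M[R]_n := [set g | g^T *m g = 1%:M /\ \det g = 1].
Definition sphere : set 'cV[R]_n := [set gam | dotv gam gam = 1].

Definition brk X Y : 'M[R]_n := X *m Y - Y *m X.
Definition so_dot X Y : R := - (1 / 2) * \tr (X *m Y).

(* The projection onto R^n /\ gam. *)
Definition pr_v gam X : 'M[R]_n := wedgev (X *m gam) gam.

(* E_i /\ E_j, i < j, is an orthonormal basis of so(n) for [so_dot]. *)
Definition so_index : {set 'I_n * 'I_n} := [set p : 'I_n * 'I_n | (p.1 < p.2)%N]%SET.
Definition dim_so : nat := #|so_index|.
Definition so_basis (a : 'I_dim_so) : 'M[R]_n :=
  wedgev (stdv (enum_val a).1) (stdv (enum_val a).2).

Definition det_so (F : 'M[R]_n -> 'M[R]_n) : R :=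
  \det (\matrix_(a < dim_so, b < dim_so) so_dot (so_basis a) (F (so_basis b))).

(* The standard volume form dk of so(n)^* = so(n). *)
Definition vol_so : dform 'M[R]_n dim_so := fun _ v =>
  \det (\matrix_(a < dim_so, b < dim_so) so_dot (so_basis a) (v b)).

(* The standard volume form of the sphere, det (gam, v_1, ..., v_{n-1}). *)
Definition vol_sphere : dform 'cV[R]_n n.-1 := fun gam v =>
  \det (\matrix_(i < n, j < n) nth 0 (gam :: codom v) j i 0).

(** * The cotangent bundle of SO(n) in the left trivialization *)

(* The canonical 1-form theta_(k, g)(dk, dg) = <k, g^-1 dg>, extended to all
   matrices by writing g^T for g^-1. *)
Definition liouville (q w : 'M[R]_n * 'M[R]_n) : R :=
  so_dot q.1 (q.2^T *m w.2).

Definition Omega : dform ('M[R]_n * 'M[R]_n)%type 2 := ext_deriv1 liouville.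

(** * The rolling ball *)

(* Only the values of [I] on so(n) matter. *)
Record inertia_tensor (I : 'M[R]_n -> 'M[R]_n) : Prop := InertiaTensor {
  inertia_so : forall X, so X -> so (I X);
  inertia_linear : forall (a : R) X Y,
    so X -> so Y -> I (a *: X + Y) = a *: I X + I Y;
  inertia_sym : forall X Y, so X -> so Y -> so_dot (I X) Y = so_dot X (I Y);
  inertia_pos : forall X, so X -> X != 0 -> 0 < so_dot (I X) X
}.

Variables (I : 'M[R]_n -> 'M[R]_n) (D eps : R).

Definition kappa gam X : 'M[R]_n := I X + D *: pr_v gam X.

Definition mu gam : R := Num.sqrt (det_so (kappa gam)).

(* Points are (k, g, gam). *)
Definition phase : set ('M[R]_n * 'M[R]_n * 'cV[R]_n) :=
  [set p | [/\ so p.1.1, SO p.1.2 & sphere p.2]].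

Definition rolling_field (p v : 'M[R]_n * 'M[R]_n * 'cV[R]_n) : Prop :=
  exists omega : 'M[R]_n, [/\ so omega, p.1.1 = kappa p.2 omega &
    v = (brk p.1.1 omega, p.1.2 *m omega, - eps *: (omega *m p.2))].

Definition rolling_volume :
    dform ('M[R]_n * 'M[R]_n * 'cV[R]_n)%type (dim_so * 2 + n.-1) :=
  scale_form (fun p => (mu p.2)^-1)
    (wedge (pull_linear fst (wedge_pow Omega dim_so))
           (pull_linear snd vol_sphere)).

(* Points are (k, gam). *)
Definition reduced_phase : set ('M[R]_n * 'cV[R]_n) :=
  [set p | so p.1 /\ sphere p.2].

Definition reduced_field (p v : 'M[R]_n * 'cV[R]_n) : Prop :=
  exists omega : 'M[R]_n, [/\ so omega, p.1 = kappa p.2 omega &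
    v = (brk p.1 omega, - eps *: (omega *m p.2))].

Definition reduced_volume :
    dform ('M[R]_n * 'cV[R]_n)%type (dim_so + n.-1) :=
  scale_form (fun p => (mu p.2)^-1)
    (wedge (pull_linear fst vol_so) (pull_linear snd vol_sphere)).

End Orthogonal.

(* [Outer], [Inner]: the ball rolls over the outer, resp. inner, surface of the
   fixed sphere; [Shell]: a spherical shell rolls around a fixed sphere lying
   in its interior. *)
Inductive rolling_mode := Outer | Inner | Shell.

Definition admissible (R : realType) (c : rolling_mode) (sigma rho : R) : Prop :=
  match c with
  | Outer => True
  | Inner => rho < sigma
  | Shell => sigma < rho
  end.

Definition epsilon (R : realType) (c : rolling_mode) (sigma rho : R) : R :=
  match c with
  | Outer => sigma / (sigma + rho)
  | Inner | Shell => sigma / (sigma - rho)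
  end.

(* Main.v *)
(**
  The flow is differentiated without any existence theorem for differential
  equations.  Along M the field satisfies X(p) - X(q) = A(p, q)(p - q) with A
  bounded and Lipschitz on the level sets of <k, k>, which the flow preserves.
  Hence the difference quotients of the flow along a curve solve linear
  equations exactly; by Gronwall's inequality they converge to a solution U of
  the variational equation U' = A(x, x) U.

  Both volume forms, evaluated on tangent vectors, are a constant times 1 / mu
  times the determinant of the coordinates of the radial vector (0, gamma) and
  of these vectors: every alternating multilinear top form is a multiple of the
  determinant, and in the left trivialization Omega becomes the canonical form
  of so(n) + so(n) after a unimodular shear, which makes the multiple
  independent of the point.  By Liouville's formula the determinant grows at the
  rate tr A.  Its only contribution comes from the gamma-block, where it equals
  tr (K kappa') / 2 with K the inverse of kappa, the logarithmic derivative of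
  mu; the other blocks are commutators with skew matrices or products of a skew
  and a symmetric matrix.

  For (ii), pr_{v_gamma} = W W^T with W x = x /\ gamma, so Sylvester's identity
  reduces det (I + D W W^T) to the n x n determinant of
  D (q A^-1 - A^-1 gamma gamma^T A^-1) + gamma gamma^T, q = (gamma, A^-1 gamma),
  which is a rank two perturbation of D q A^-1.
*)
From mathcomp Require Import ring lra.
Require Import Defs.
Local Open Scope classical_set_scope.
Local Open Scope ring_scope.

(** * Gronwall's inequality and the variational equation *)

(** A flow is given only as a family of solutions, with no regularity in the initial point, whereas
    one differential valid for all curves in the manifold is required. A secant operator avoids
    Taylor remainders on a non-convex set. It is available in closed form because [k = kappa(omega)]
    is linear in omega, while kappa is quadratic in gamma, so that differences telescope exactly.

    The square root in mu has a simple origin: kappa is I + D W W^T with W linear in gamma, so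
    kappa' has two mirror terms with equal traces against K, and the divergence contains just one of
    them.

    The radial vector completes the tangent vectors of the sphere to a square matrix, but the
    linearized flow does not transport it. The defect is tangent to the sphere, like the other
    columns, and is therefore invisible to the determinant. Velocities of g are read as g^T dg,
    which removes g from all coefficients. *)

Lemma is_derive_cvg (R : realType) (V : normedModType R) (f : R -> V) (t : R) df :
  is_derive t 1 f df <-> h^-1 *: (f (h + t) - f t) @[h --> 0^'] --> df.
Proof.
rewrite /=; split.
  move=> [Hd <-].
  have := Hd; rewrite /derivable /derive /= => /cvgP.
  suff -> : (fun h : R => h^-1 *: ((f \o shift t) h%:A - f t)) =
     (fun h => h^-1 *: (f (h + t) - f t)) by move=> H; exact/H.
  by apply/funext => h /=; rewrite [_%:A]mulr1.
move=> H.
have E : (fun h : R => h^-1 *: ((f \o shift t) h%:A - f t)) =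
     (fun h => h^-1 *: (f (h + t) - f t)).
  by apply/funext => h /=; rewrite [_%:A]mulr1.
split; first by rewrite /derivable /= E; apply/cvg_ex; exists df.
by rewrite /derive /= E; apply/cvg_lim.
Qed.

Lemma is_derive_cont (R : realType) (f : R -> R) (t : R) df :
  is_derive t 1 f df -> {for t, continuous f}.
Proof.
by move=> [H _]; apply/differentiable_continuous/derivable1_diffP.
Qed.

(** The shift by [d / C] absorbs the constant term: [f + d / C] satisfies a homogeneous inequality,
    so its product with [exp (- C t)] cannot increase. *)
Lemma gronwall (R : realType) (f df : R -> R) (C d T : R) :
  0 < C -> 0 <= d -> 0 <= T ->
  (forall t, 0 <= t <= T -> is_derive t 1 f (df t) /\ df t <= C * f t + d) ->
  f T <= expR (C * T) * (f 0 + d / C).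
Proof.
move=> C0 d0 T0 H.
pose g t := (f t + d / C) * expR (- C * t).
have dg t : 0 <= t <= T ->
  is_derive t 1 g ((df t - (C * f t + d)) * expR (- C * t)).
  move=> /H [Hf _].
  have H1 : is_derive t 1 (fun t => f t + d / C) (df t).
    by apply: is_derive_eq; rewrite addr0.
  have H2 : is_derive t 1 (fun t => expR (- C * t)) (expR (- C * t) * (- C)).
    apply: (is_derive1_comp (f := expR) (g := fun t => - C * t)).
    by apply: is_derive_eq; rewrite [_ *: _]mulr1.
  apply: is_derive_eq.
  rewrite -![_ *: _]/(_ * _).
  by field; rewrite gt_eqF.
have : g T <= g 0.
  have cont : {within `[0, T], continuous g}.
    apply/continuous_in_subspaceT => t; rewrite inE /= in_itv /= => Ht.
    exact: is_derive_cont (dg _ Ht).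
  have [Tp|] := ltP 0 T; last by move=> T0'; rewrite (@le_anti _ _ T 0) // T0 T0'.
  have sub t : t \in `]0, T[ -> 0 <= t <= T.
    by rewrite in_itv /= => /andP[a b]; rewrite !ltW.
  have [c ci] := MVT Tp (fun t Ht => dg t (sub t Ht)) cont.
  rewrite -subr_le0 => ->; rewrite pmulr_lle0 ?subr0 //.
  by rewrite pmulr_lle0 ?expR_gt0 // subr_le0; case: (H _ (sub _ ci)).
rewrite /g mulr0 expR0 mulr1 mulNr expRN.
rewrite ler_pdivrMr ?expR_gt0 // => h; rewrite mulrC; apply: le_trans h.
by rewrite lerDl divr_ge0 // ltW.

Qed.

(** * Linear coordinates and quadratic Gronwall estimates *)

Section Coordinates.
Variables (R : realType) (E : normedModType R) (T : finType) (e : T -> E -> R).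

(** An interface shared by matrices and their products, so that the analysis is done once for both
    phase spaces. *)
Record coordinates : Prop := Coordinates {
  coordP : forall i (a : R) u v, e i (a *: u + v) = a * e i u + e i v;
  coord_inj : forall u v, (forall i, e i u = e i v) -> u = v;
  coord_ex : forall c : T -> R, exists u, forall i, e i u = c i;
  coord_derive : forall (f : R -> E) (t : R) df,
    is_derive t 1 f df <->
    forall i, is_derive t 1 (fun s => e i (f s)) (e i df) }.

Hypothesis He : coordinates.

(** A Euclidean square rather than the ambient norm: it is differentiable along curves, as
    Gronwall's inequality requires. *)
Definition sqn u : R := \sum_i e i u ^+ 2.

Lemma coordD i u v : e i (u + v) = e i u + e i v.
Proof. by have := coordP He i 1 u v; rewrite scale1r mul1r. Qed.

Lemma coord0 i : e i 0 = 0.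
Proof. by apply: (addIr (e i 0)); rewrite -coordD !add0r. Qed.

Lemma coordZ i a u : e i (a *: u) = a * e i u.
Proof. by have := coordP He i a u 0; rewrite addr0 coord0 addr0. Qed.

Lemma coordN i u : e i (- u) = - e i u.
Proof. by rewrite -scaleN1r coordZ mulN1r. Qed.

Lemma coordB i u v : e i (u - v) = e i u - e i v.
Proof. by rewrite coordD coordN. Qed.

Lemma sqn_ge0 u : 0 <= sqn u.
Proof. by apply: sumr_ge0 => i _; rewrite sqr_ge0. Qed.

Lemma sqn0 : sqn 0 = 0.
Proof. by rewrite /sqn big1 // => i _; rewrite coord0 expr0n. Qed.

Lemma sqnN u : sqn (- u) = sqn u.
Proof. by apply: eq_bigr => i _; rewrite coordN sqrrN. Qed.

Lemma sqnZ a u : sqn (a *: u) = a ^+ 2 * sqn u.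
Proof. by rewrite /sqn mulr_sumr; apply: eq_bigr => i _; rewrite coordZ exprMn. Qed.

Lemma sqnD u v : sqn (u + v) <= 2 * sqn u + 2 * sqn v.
Proof.
rewrite /sqn !mulr_sumr -big_split /=; apply: ler_sum => i _.
rewrite coordD; have := sqr_ge0 (e i u - e i v); rewrite sqrrB sqrrD.
set x := e i u; set y := e i v; lra.
Qed.

Lemma sqnB u v : sqn (u - v) <= 2 * sqn u + 2 * sqn v.
Proof. by have := sqnD u (- v); rewrite sqnN. Qed.

Lemma sqn_eq0 u : sqn u <= 0 -> u = 0.
Proof.
move=> H; apply: (coord_inj He) => i; rewrite coord0.
have : sqn u == 0 by rewrite eq_le H sqn_ge0.
rewrite /sqn psumr_eq0 => [/allP /(_ i)|j _]; last by rewrite sqr_ge0.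
by rewrite mem_index_enum => /(_ isT); rewrite sqrf_eq0 => /eqP.
Qed.

Lemma coord_le_sqn i u : e i u ^+ 2 <= sqn u.
Proof.
rewrite /sqn (bigD1 i) //= lerDl; apply: sumr_ge0 => j _; exact: sqr_ge0.
Qed.

Lemma is_derive_sqn (u : R -> E) (t : R) du : is_derive t 1 u du ->
  is_derive t 1 (fun s => sqn (u s)) (\sum_i 2 * e i (u t) * e i du).
Proof.
move=> /(coord_derive He) H.
have -> : (fun s => sqn (u s)) = \sum_i (fun s => e i (u s) ^+ 2).
  by apply/funext => s; rewrite fct_sumE.
elim/big_ind2 : _ => [|f df g dg Hf Hg|i _]; first exact: is_derive_cst.
  exact: is_deriveD.
apply: is_derive_eq; rewrite -![_ *: _]/(_ * _); ring.
Qed.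

(** Young's inequality [2 x y <= a x^2 + y^2 / a] bounds the derivative of [sqn u]. The weight [a]
    stays free because the two uses below take different values. *)
Lemma gronwall_sqn1 (u du : R -> E) (a L d r : R) :
  0 < a -> 0 <= L -> 0 <= d -> 0 <= r ->
  (forall t : R, 0 <= t <= r -> is_derive t 1 u (du t) /\
     sqn (du t) <= L * sqn (u t) + d) ->
  sqn (u r) <= expR ((a + L / a) * r) * (sqn (u 0) + d / a / (a + L / a)).
Proof.
move=> a0 L0 d0 r0 H.
have c0 : 0 < a + L / a by rewrite ltr_pwDl // divr_ge0 // ltW.
apply: (@gronwall _ (fun t => sqn (u t))
  (fun t => \sum_i 2 * e i (u t) * e i (du t))) => //.
  by rewrite divr_ge0 // ltW.
move=> t /H [H1 H2]; split; first exact: is_derive_sqn.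
apply: (@le_trans _ _ (a * sqn (u t) + a^-1 * sqn (du t))).
  rewrite /sqn !mulr_sumr -big_split /=; apply: ler_sum => i _.
  rewrite -subr_ge0.
  have -> : a * e i (u t) ^+ 2 + a^-1 * e i (du t) ^+ 2 -
    2 * e i (u t) * e i (du t) = a * (e i (u t) - a^-1 * e i (du t)) ^+ 2.
    by field; rewrite gt_eqF.
  by rewrite mulr_ge0 ?sqr_ge0 // ltW.
rewrite mulrDl -addrA lerD2l mulrC.
by rewrite [L / a * _]mulrAC -mulrDl ler_pM2r ?invr_gt0.
Qed.

Lemma is_derive_reflect (u : R -> E) (t : R) du : is_derive (- t) 1 u du ->
  is_derive t 1 (fun s => u (- s)) (- du).
Proof.
move=> /(coord_derive He) H; apply/(coord_derive He) => i; rewrite coordN.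
have := @is_derive1_comp _ (fun s => e i (u s)) -%R t (e i du) (- 1) (H i).
by rewrite mulrN1; apply; exact: is_deriveNid.
Qed.

(** Negative times follow by reversing time, which only changes the sign of [du]. *)
Lemma gronwall_sqn (u du : R -> E) (a L d r : R) :
  0 < a -> 0 <= L -> 0 <= d ->
  (forall t : R, `|t| <= `|r| -> is_derive t 1 u (du t) /\
     sqn (du t) <= L * sqn (u t) + d) ->
  sqn (u r) <= expR ((a + L / a) * `|r|) * (sqn (u 0) + d / a / (a + L / a)).
Proof.
move=> a0 L0 d0 H; have [r0|r0] := lerP 0 r.
  rewrite (ger0_norm r0); apply: (gronwall_sqn1 a0 L0 d0 r0) => t /andP[t0 tr].
  by apply: H; rewrite !ger0_norm.
have nr0 : 0 <= - r by rewrite oppr_ge0 ltW.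
have := @gronwall_sqn1 (fun s => u (- s)) (fun s => - du (- s)) a L d (- r)
  a0 L0 d0 nr0.
rewrite oppr0 opprK (ltr0_norm r0); apply.
move=> t /andP[t0 tr].
have [|H1 H2] := H (- t); first by rewrite normrN ger0_norm // ltr0_norm.
by split; [exact: is_derive_reflect|rewrite sqnN].
Qed.

Lemma gronwall_stable (u du : R -> E) (L d B r : R) :
  0 <= L -> 0 <= d -> `|r| <= B ->
  (forall t : R, `|t| <= `|r| -> is_derive t 1 u (du t) /\
     sqn (du t) <= L * sqn (u t) + d) ->
  sqn (u r) <= expR ((1 + L) * B) * (sqn (u 0) + d).
Proof.
move=> L0 d0 rB H.
have := gronwall_sqn ltr01 L0 d0 H; rewrite !divr1 => /le_trans; apply.
have L1 : 0 < 1 + L by rewrite ltr_pwDl.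
apply: ler_pM; rewrite ?expR_ge0 ?addr_ge0 ?sqn_ge0 ?divr_ge0 ?(ltW L1) //.
  by rewrite ler_expR ler_pM2l.
by rewrite lerD2l ler_pdivrMr // ler_peMr // lerDl.
Qed.

Lemma mean_value_sqn (u du : R -> E) (d r : R) :
  0 <= d ->
  (forall t : R, `|t| <= `|r| -> is_derive t 1 u (du t) /\ sqn (du t) <= d) ->
  u 0 = 0 -> sqn (u r) <= expR 1 * d * r ^+ 2.
Proof.
move=> d0 H u0; have [->|r0] := eqVneq r 0.
  by rewrite u0 sqn0 expr0n mulr0.
have r1 : 0 < `|r|^-1 by rewrite invr_gt0 normr_gt0.
(* With weight [1 / |r|] the exponent becomes 1 and [d / a / a] becomes [d * r^2]. *)
have := @gronwall_sqn u du _ 0 d r r1 (lexx _) d0.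
rewrite mul0r addr0 mulVf ?normr_eq0 // u0 sqn0 add0r => h.
apply: (le_trans (h _)) => [t /H|]; first by rewrite mul0r add0r.
by rewrite !invrK -mulrA -expr2 mulrA real_normK // num_real.
Qed.

End Coordinates.

Section Variation.
Variables (R : realType) (E : normedModType R) (T : finType) (e : T -> E -> R).
Hypothesis He : coordinates e.
Variables (S : set E) (phi : R -> E -> E) (A : E -> E -> E -> E) (L : R).

Local Notation sqn := (sqn e).

(** [A p q] is an exact secant operator, so [flowB_derive] has no remainder. [S] is a flow-invariant
    set, not an open one: it will be a bounded piece of a manifold. *)
Record linearized_flow : Prop := LinearizedFlow {
  flow_in : forall x t, S x -> S (phi t x);
  flow0 : forall x, S x -> phi 0 x = x;
  flow_derive : forall x (t : R), S x -> exists v, is_derive t 1 (phi ^~ x) v;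
  flowB_derive : forall x y (t : R), S x -> S y ->
    is_derive t 1 (fun s => phi s x - phi s y)
      (A (phi t x) (phi t y) (phi t x - phi t y));
  lin_linear : forall p q a u v, S p -> S q ->
    A p q (a *: u + v) = a *: A p q u + A p q v;
  lin_ge0 : 0 <= L;
  lin_bounded : forall p q u, S p -> S q -> sqn (A p q u) <= L * sqn u;
  lin_lipschitz : forall p q p' q' u, S p -> S q -> S p' -> S q' ->
    sqn (A p q u - A p' q' u) <=
    L * (sqn (p - p') + sqn (q - q')) * sqn u }.

Hypothesis HF : linearized_flow.

Let L0 := lin_ge0 HF.

Lemma lin0 p q : S p -> S q -> A p q 0 = 0.
Proof.
move=> Sp Sq; have := lin_linear HF 1 0 0 Sp Sq.
by rewrite !scale1r !addr0 => h; apply: (addrI (A p q 0)); rewrite -h addr0.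
Qed.

Lemma linZ p q a u : S p -> S q -> A p q (a *: u) = a *: A p q u.
Proof.
by move=> Sp Sq; rewrite -[a *: u]addr0 lin_linear // lin0 // addr0.
Qed.

Lemma linB p q u v : S p -> S q -> A p q (u - v) = A p q u - A p q v.
Proof.
move=> Sp Sq; have := lin_linear HF (-1) v u Sp Sq.
by rewrite !scaleN1r !(addrC (- _)).
Qed.

(** The difference of two solutions solves the same linear equation with zero initial value, and
    Gronwall's inequality keeps it zero. *)
Lemma variation_unique x (U1 U2 : R -> E) : S x -> U1 0 = U2 0 ->
  (forall t : R, is_derive t 1 U1 (A (phi t x) (phi t x) (U1 t))) ->
  (forall t : R, is_derive t 1 U2 (A (phi t x) (phi t x) (U2 t))) ->
  forall t, U1 t = U2 t.
Proof.
move=> Sx U0 H1 H2 t; apply/eqP; rewrite -subr_eq0; apply/eqP.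
apply: (sqn_eq0 He).
have := @gronwall_stable _ _ _ _ He (fun s => U1 s - U2 s)
  (fun s => A (phi s x) (phi s x) (U1 s - U2 s)) L 0 `|t| t L0 (lexx _) (lexx _).
rewrite U0 subrr (sqn0 He) addr0 mulr0; apply => s _; split.
  rewrite linB; try exact: flow_in.
  exact: is_deriveB.
by rewrite addr0 lin_bounded //; exact: flow_in.
Qed.

Variables (c : R -> E) (x v : E).
Hypotheses (Sc : \forall s \near (0 : R), S (c s)) (c0 : c 0 = x)
  (dc : is_derive (0 : R) 1 c v).

Let Sx : S x. Proof. by rewrite -c0; exact: nbhs_singleton Sc. Qed.

(** Difference quotient of the flow in the initial point, along [c]; for [s != 0] it solves an exact
    linear equation in [t]. *)
Let q (s t : R) : E := s^-1 *: (phi t (c s) - phi t x).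

Let good : \forall s \near 0^', s != 0 /\ S (c s).
Proof.
near=> s; split; first by near: s; exact: nbhs_dnbhs_neq.
by near: s; exact: cvg_within.
Unshelve. all: by end_near. Qed.

Lemma cvg_sqnB (F : set_system R) (FF : Filter F) (f : R -> E) l :
  (forall i, e i (f s) @[s --> F] --> e i l) -> sqn (f s - l) @[s --> F] --> 0.
Proof.
move=> H.
have -> : (fun s => sqn (f s - l)) = \sum_i (fun s => (e i (f s) - e i l) ^+ 2).
  apply/funext => s; rewrite fct_sumE; apply: eq_bigr => i _.
  by rewrite (coordB He).
elim/big_ind : _ => [|f1 f2 H1 H2|i _]; first exact: cvg_cst.
  by rewrite -[0]addr0; exact: cvgD.
rewrite -[0](expr0n _ 2) -(subrr (e i l)).
rewrite expr2; under eq_fun do rewrite expr2.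
by apply: cvgM; apply: cvgB => //; exact: cvg_cst.
Qed.

Let q0 : sqn (q s 0 - v) @[s --> 0^'] --> 0.
Proof.
apply: cvg_sqnB => i.
have /(coord_derive He) /(_ i) /is_derive_cvg := dc.
apply: cvg_trans; apply: near_eq_cvg; near=> s.
have [s0 Ss] : s != 0 /\ S (c s) by near: s; exact: good.
by rewrite addr0 /q (coordZ He) (coordB He) !(flow0 HF) // c0.
Unshelve. all: by end_near. Qed.

(** For small [s] the quotient at time 0 is within distance 1 of its limit [v]. *)
Let K := 2 * sqn v + 2.

Let q0K : \forall s \near 0^', sqn (q s 0) <= K.
Proof.
near=> s.
have : sqn (q s 0 - v) <= 1.
  near: s; have /cvgrPdist_le /(_ _ ltr01) := q0.
  apply: filterS => s; rewrite sub0r normrN ger0_norm //; exact: sqn_ge0.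
have := sqnD He (q s 0 - v) v; rewrite subrK /K => h1 h2.
apply: (le_trans h1); lra.
Unshelve. all: by end_near. Qed.

Let q_derive (s t : R) : s != 0 -> S (c s) ->
  is_derive t 1 (q s) (A (phi t (c s)) (phi t x) (q s t)).
Proof.
move=> s0 Ss; rewrite /q linZ; try exact: flow_in.
by apply: is_deriveZ; exact: flowB_derive.
Qed.

(** Bounds [sqn (q s t)] for [|t| <= B], uniformly in small [s]. *)
Let G (B : R) : R := expR ((1 + L) * B) * K.

Let G_ge0 B : 0 <= G B.
Proof. by rewrite mulr_ge0 ?expR_ge0 // /K addr_ge0 // mulr_ge0 // sqn_ge0. Qed.

Let qG (s t B : R) : s != 0 -> S (c s) -> sqn (q s 0) <= K -> `|t| <= B ->
  sqn (q s t) <= G B.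
Proof.
move=> s0 Ss sK tB; apply: (@le_trans _ _ (expR ((1 + L) * B) * (sqn (q s 0) + 0))).
  apply: (gronwall_stable He L0 (lexx 0) tB
   (du := fun t => A (phi t (c s)) (phi t x) (q s t))) => r _.
  split; first exact: q_derive.
  by rewrite addr0 lin_bounded //; exact: flow_in.
by rewrite addr0 /G ler_pM2l ?expR_gt0.
Qed.

Let flowG (s t B : R) : s != 0 -> S (c s) -> sqn (q s 0) <= K -> `|t| <= B ->
  sqn (phi t (c s) - phi t x) <= s ^+ 2 * G B.
Proof.
move=> s0 Ss sK tB.
have -> : phi t (c s) - phi t x = s *: q s t by rewrite scalerA divff // scale1r.
by rewrite (sqnZ He) ler_wpM2l ?sqr_ge0 // qG.
Qed.

(** First term: distance of the initial value from its limit. Second term: the Lipschitz constant,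
    times the spread [s^2 * G B] of the base points, times the bound [G B] of the solution, with
    factors 2 from splitting sums. *)
Let err B s := 2 * sqn (q s 0 - v) + 4 * L * s ^+ 2 * G B ^+ 2.

Let err_ge0 (B s : R) : 0 <= err B s.
Proof.
apply: addr_ge0; first by rewrite mulr_ge0 ?sqn_ge0.
apply: mulr_ge0; last exact: sqr_ge0.
by apply: mulr_ge0; [exact: mulr_ge0|exact: sqr_ge0].
Qed.

(* [q s] and [q r] solve linear equations whose coefficients tend to a common
   limit; Gronwall's inequality makes the difference quotients Cauchy. *)
Let q_close (s r t B : R) : s != 0 -> S (c s) -> sqn (q s 0) <= K ->
  r != 0 -> S (c r) -> sqn (q r 0) <= K -> `|t| <= B ->
  sqn (q s t - q r t) <= expR ((1 + 2 * L) * B) * (err B s + err B r).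
Proof.
move=> s0 Ss sK r0 Sr rK tB.
have LG0 : 0 <= 4 * L * (s ^+ 2 + r ^+ 2) * G B ^+ 2.
  apply: mulr_ge0; last exact: sqr_ge0.
  by apply: mulr_ge0; [exact: mulr_ge0|apply: addr_ge0; exact: sqr_ge0].
have L20 : 0 <= 2 * L by rewrite mulr_ge0.
apply: (le_trans (gronwall_stable He (u := fun t => q s t - q r t)
  (du := fun t => A (phi t (c s)) (phi t x) (q s t) -
                  A (phi t (c r)) (phi t x) (q r t)) L20 LG0 tB _)).
  move=> w wt; have wB := le_trans wt tB; split.
    by apply: is_deriveB; exact: q_derive.
  have -> : A (phi w (c s)) (phi w x) (q s w) - A (phi w (c r)) (phi w x) (q r w)
    = A (phi w (c s)) (phi w x) (q s w - q r w) +
      (A (phi w (c s)) (phi w x) (q r w) - A (phi w (c r)) (phi w x) (q r w)).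
    rewrite linB; try exact: flow_in.
    by rewrite addrA subrK.
  apply: (le_trans (sqnD He _ _)); apply: lerD.
    by rewrite -mulrA ler_pM2l // lin_bounded //; exact: flow_in.
  have h1 : sqn (phi w (c s) - phi w (c r)) <= 2 * (s ^+ 2 + r ^+ 2) * G B.
    have -> : phi w (c s) - phi w (c r) =
       (phi w (c s) - phi w x) - (phi w (c r) - phi w x).
       by rewrite opprB addrA subrK.
    apply: (le_trans (sqnB He _ _)).
    have := flowG s0 Ss sK wB; have := flowG r0 Sr rK wB.
    set a := sqn _; set b := sqn _; set g := G B; move=> h1 h2; lra.
  have h2 : sqn (q r w) <= G B by exact: qG.
  have := lin_lipschitz HF (q r w) (flow_in HF w Ss) (flow_in HF w Sx)
    (flow_in HF w Sr) (flow_in HF w Sx).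
  rewrite subrr (sqn0 He) addr0 => h3.
  have h4 : L * sqn (phi w (c s) - phi w (c r)) * sqn (q r w) <=
    L * (2 * (s ^+ 2 + r ^+ 2) * G B) * G B.
    apply: ler_pM => //; rewrite ?sqn_ge0 ?mulr_ge0 ?sqn_ge0 //.
    exact: ler_wpM2l.
  have := le_trans h3 h4; rewrite expr2; set a := sqn _; set g := G B => h5.
  lra.
rewrite ler_pM2l ?expR_gt0 //.
have -> : q s 0 - q r 0 = (q s 0 - v) - (q r 0 - v) by rewrite opprB addrA subrK.
have := sqnB He (q s 0 - v) (q r 0 - v).
rewrite /err; set a := sqn _; set b := sqn _; set g := G B ^+ 2.
rewrite !mulrDr mulrDl.
set k := 4 * L * _ * _; set k' := 4 * L * _ * _; lra.
Qed.

Let err_cvg B : err B s @[s --> 0^'] --> 0.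
Proof.
have H : s @[s --> (0 : R)^'] --> (0 : R) by exact: cvg_within.
have H1 : 2 * sqn (q s 0 - v) @[s --> 0^'] --> (2 * 0 : R).
  by apply: cvgM; [exact: cvg_cst|exact: q0].
have H2 : 4 * L * s ^+ 2 * G B ^+ 2 @[s --> 0^'] --> (4 * L * (0 * 0) * G B ^+ 2 : R).
  apply: cvgM; last exact: cvg_cst.
  by apply: cvgM; [exact: cvg_cst|exact: (cvgM H H)].
have := cvgD H1 H2; rewrite !(mul0r, mulr0) addr0 => h. exact: h.
Qed.

Let ready : \forall s \near 0^', [/\ s != 0, S (c s) & sqn (q s 0) <= K].
Proof.
near=> s; have [] : s != 0 /\ S (c s) by near: s; exact: good.
by split => //; near: s; exact: q0K.
Unshelve. all: by end_near. Qed.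

(** Completeness of [R] is used coordinate by coordinate. The threshold [r^2 / (4 C)] turns the
    bound of [q_close] into [r^2 / 2 < r^2]. *)
Let q_cvg t i : cvg (e i (q s t) @[s --> 0^']).
Proof.
apply: cauchy_cvg; apply: cauchy_exP => /= r r0.
set C := expR ((1 + 2 * L) * `|t|).
have C0 : 0 < C by exact: expR_gt0.
have d0 : 0 < r ^+ 2 / (4 * C) by rewrite divr_gt0 ?exprn_gt0 // mulr_gt0.
have small : \forall s \near 0^', err `|t| s <= r ^+ 2 / (4 * C).
  have /cvgrPdist_le /(_ _ d0) := err_cvg `|t|.
  by apply: filterS => s; rewrite sub0r normrN ger0_norm.
have [s [[s0 Ss sK] se]] := filter_ex (filterI ready small).
exists (e i (q s t)).
change (\forall w \near (0 : R)^', ball (e i (q s t)) r (e i (q w t))).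
near=> w.
have [w0 Sw wK] : [/\ w != 0, S (c w) & sqn (q w 0) <= K] by near: w; exact: ready.
have we : err `|t| w <= r ^+ 2 / (4 * C) by near: w.
rewrite /ball /= -(coordB He).
have := le_trans (coord_le_sqn e i _) (q_close s0 Ss sK w0 Sw wK (lexx `|t|)).
move=> h; rewrite -ltr_sqr ?nnegrE // ?(ltW r0) // -normrX ger0_norm ?sqr_ge0 //.
apply: (le_lt_trans h); rewrite -/C.
apply: (@le_lt_trans _ _ (C * (r ^+ 2 / (4 * C) + r ^+ 2 / (4 * C)))).
  by rewrite ler_pM2l // lerD.
have -> : C * (r ^+ 2 / (4 * C) + r ^+ 2 / (4 * C)) = r ^+ 2 / 2.
  by field; rewrite gt_eqF.
have : 0 < r ^+ 2 by rewrite exprn_gt0.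
set z := r ^+ 2 => z0; lra.
Unshelve. all: by end_near. Qed.

Let U t : E := sval (cid (coord_ex He (fun i => lim (e i (q s t) @[s --> 0^'])))).

Let UE t i : e i (q s t) @[s --> 0^'] --> e i (U t).
Proof. rewrite /U; case: cid => u /= ->; exact: q_cvg. Qed.

Let U_derive t : is_derive (0 : R) 1 (fun s => phi t (c s)) (U t).
Proof.
apply/(coord_derive He) => i; apply/is_derive_cvg.
have := @UE t i; apply: cvg_trans; apply: near_eq_cvg; near=> s.
by rewrite addr0 c0 /q (coordZ He) (coordB He).
Unshelve. all: by end_near. Qed.

Let U0 : U 0 = v.
Proof.
apply: (coord_inj He) => i.
have /(coord_derive He) /(_ i) [_ <-] := U_derive 0.
have /(coord_derive He) /(_ i) [_ <-] := dc.
apply: near_eq_derive; near=> s; congr e; apply: (flow0 HF).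
by near: s.
Unshelve. all: by end_near. Qed.

Let q_U (t r : R) : 0 < r -> \forall s \near 0^', sqn (q s t - U t) <= r.
Proof.
move=> r0; have H : sqn (q s t - U t) @[s --> 0^'] --> 0.
  by apply: cvg_sqnB => i; exact: UE.
have /cvgrPdist_le /(_ _ r0) := H.
by apply: filterS => s; rewrite sub0r normrN ger0_norm // sqn_ge0.
Qed.

Let flow_cont (t r : R) : 0 < r -> \forall h \near (0 : R),
  sqn (phi (t + h) x - phi t x) <= r.
Proof.
move=> r0.
have H : sqn (phi (t + h) x - phi t x) @[h --> (0 : R)] --> 0.
  apply: cvg_sqnB => i.
  have [w /(coord_derive He) /(_ i) /is_derive_cont H1] := flow_derive HF t Sx.
  have H2 : t + h @[h --> (0 : R)] --> (t + 0 : R).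
    by apply: cvgD; [exact: cvg_cst|exact: cvg_id].
  rewrite addr0 in H2; exact: (cvg_comp _ _ H2 H1).
have /cvgrPdist_le /(_ _ r0) := H.
by apply: filterS => s; rewrite sub0r normrN ger0_norm // sqn_ge0.
Qed.

(** The quotients [q s] satisfy the first-order estimate uniformly in [s]; for fixed [h] it passes
    to [U] by taking [s] small. *)
Let U_variation (t : R) : is_derive t 1 U (A (phi t x) (phi t x) (U t)).
Proof.
set a := A _ _ _.
suff key : forall r, 0 < r -> \forall h \near (0 : R),
    sqn (U (t + h) - U t - h *: a) <= r * h ^+ 2.
  apply/(coord_derive He) => i; apply/is_derive_cvg.
  apply/cvgrPdist_le => r r0; near=> h.
  have h0 : h != 0 by near: h; exact: nbhs_dnbhs_neq.
  have : sqn (U (t + h) - U t - h *: a) <= r ^+ 2 * h ^+ 2.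
    by near: h; apply: cvg_within; apply: key; rewrite exprn_gt0.
  move=> /(le_trans (coord_le_sqn e i _)).
  rewrite !(coordB He) (coordZ He) (addrC h t) => H.
  rewrite -ler_sqr ?nnegrE ?(ltW r0) // -normrX ger0_norm ?sqr_ge0 //.
  rewrite -(@ler_pM2r _ (h ^+ 2)); last by rewrite exprn_even_gt0.
  rewrite -exprMn; apply: le_trans H; rewrite le_eqVlt; apply/orP; left; apply/eqP.
  rewrite -[_ *: _]/(_ * _); field; exact: h0.
move=> r r0; set B := `|t| + 1.
have G1 : 0 < G B + 1 by rewrite ltr_wpDl.
have L1 : 0 < L + 1 by rewrite ltr_wpDl.
(* [eta] bounds the derivative of the error: the doubled mean value bound [2 * e * eta * h^2] is
   half of [r * h^2]. The factors 100 below leave room for the splittings, which sum to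
   [18 * eta / 100]; [L + 1] and [G B + 1] keep the divisors positive. *)
set eta := r / (expR 1 * 4).
have eta0 : 0 < eta by rewrite divr_gt0 // mulr_gt0 // expR_gt0.
pose r1 := eta / (100 * (L + 1) * (G B + 1)).
have r10 : 0 < r1 by rewrite divr_gt0 // !mulr_gt0.
pose r2 := eta / (100 * (L + 1)).
have r20 : 0 < r2 by rewrite divr_gt0 // !mulr_gt0.
pose r3 := eta / (100 * expR 1 * (L + 1) * (L + 1) * (G B + 1)).
have r30 : 0 < r3 by rewrite divr_gt0 // !mulr_gt0 // expR_gt0.
have frac1 (z : R) : 0 <= z -> 0 <= z / (z + 1) <= 1.
  move=> z0; have z1 : 0 < z + 1 by rewrite ltr_wpDl.
  by apply/andP; split; [rewrite divr_ge0 // ltW|rewrite ler_pdivrMr // mul1r lerDl].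
have /andP[l0 l1] := frac1 _ L0; have /andP[f0 f1] := frac1 _ (G_ge0 B).
have Ln : L + 1 != 0 by rewrite gt_eqF.
have Gn : G B + 1 != 0 by rewrite gt_eqF.
have en : expR 1 != 0 :> R by rewrite gt_eqF // expR_gt0.
have sqr_small k : 0 < k -> \forall h \near (0 : R), h ^+ 2 <= k.
  move=> k0; have H : h ^+ 2 @[h --> (0 : R)] --> (0 ^+ 2 : R) by exact: exprn_continuous.
  have /cvgrPdist_le /(_ _ k0) := H; apply: filterS => h.
  by rewrite expr0n sub0r normrN ger0_norm // sqr_ge0.
have [d /= d0 Hd] : \forall h \near (0 : R), [/\ `|h| <= 1,
    sqn (phi (t + h) x - phi t x) <= r1 & h ^+ 2 <= r3].
  near=> h; split; near: h; [|exact: flow_cont|exact: sqr_small].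
  by exists 1 => //= w /=; rewrite sub0r normrN; exact: ltW.
exists d => //= h /=; rewrite sub0r normrN => hd.
(* Here [h] is fixed. The arbitrary slack [r'] lets [s] depend on [h], with [q s] close to [U] at
   both [t] and [t + h]. *)
apply/ler_addgt0Pr => r' r'0.
have r'8 : 0 < r' / 8 by rewrite divr_gt0.
have s_small : \forall s \near (0 : R)^', s ^+ 2 <= r1 / (G B + 1).
  by apply: cvg_within; apply: sqr_small; rewrite divr_gt0.
have [s [[[s0 Ss sK] [s1 s2]] [s3 s4]]] := filter_ex
  (filterI (filterI ready (filterI (q_U t r20) s_small))
   (filterI (q_U (t + h) r'8) (q_U t r'8))).
have s2G : s ^+ 2 * G B <= r1.
  move: s2; rewrite ler_pdivlMr // => s2; apply: le_trans s2.
  by rewrite ler_wpM2l ?sqr_ge0 // lerDl.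
have shift_derive (w : R) :
    is_derive w 1 (fun w => q s (t + w)) (A (phi (t + w) (c s)) (phi (t + w) x) (q s (t + w))).
  apply/(coord_derive He) => i.
  have /(coord_derive He) /(_ i) H := q_derive (t + w) s0 Ss.
  have := @is_derive1_comp _ (fun r => e i (q s r)) (fun w => t + w) w _ 1 H.
  rewrite mulr1; apply; have := is_deriveD (is_derive_cst t w 1) (is_derive_id w 1).
  by rewrite add0r.
have tB : `|t| <= B by rewrite lerDl.
have twB w : `|w| <= `|h| -> `|t + w| <= B.
  move=> wh; apply: (le_trans (ler_normD _ _)); rewrite lerD2l.
  by apply: (le_trans wh); have [] := Hd h; rewrite /= ?sub0r ?normrN.
have qB w : `|w| <= `|h| -> sqn (q s (t + w)) <= G B by move=> /twB; exact: qG.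
(* A crude bound on the motion of [q s], consumed by the finer estimate [fast]. *)
have q_slow w : `|w| <= `|h| -> sqn (q s (t + w) - q s t) <= expR 1 * (L * G B) * w ^+ 2.
  move=> wh; apply: (mean_value_sqn He (u := fun w => q s (t + w) - q s t)
    (du := fun w => A (phi (t + w) (c s)) (phi (t + w) x) (q s (t + w)))).
  - by rewrite mulr_ge0.
  - move=> w' w'w; split.
      rewrite -[X in is_derive _ _ _ X]subr0.
      by apply: is_deriveB; exact: shift_derive.
    apply: (le_trans (lin_bounded HF _ _ _)); try exact: flow_in.
    by apply: ler_wpM2l => //; apply: qB; exact: le_trans w'w wh.
  - by rewrite addr0 subrr.
have fast : sqn (q s (t + h) - q s t - h *: a) <= expR 1 * eta * h ^+ 2.
  apply: (mean_value_sqn He (u := fun w => q s (t + w) - q s t - w *: a)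
    (du := fun w => A (phi (t + w) (c s)) (phi (t + w) x) (q s (t + w)) - a)).
  - exact: ltW.
  - move=> w wh; split.
      apply: is_deriveB; last first.
        apply/(coord_derive He) => i; rewrite /=.
        rewrite (_ : (fun s => _) = (fun s => s * e i a)).
          by apply: is_derive_eq; rewrite -![_ *: _]/(_ * _); ring.
        by apply/funext => w'; rewrite (coordZ He).
      rewrite -[X in is_derive _ _ _ X]subr0.
      by apply: is_deriveB; exact: shift_derive.
    have [_ p1 wr3] : [/\ `|w| <= 1, sqn (phi (t + w) x - phi t x) <= r1 & w ^+ 2 <= r3].
      by apply: Hd; rewrite /= sub0r normrN; exact: le_lt_trans hd.
    have Sp := flow_in HF (t + w) Ss; have Sp' := flow_in HF (t + w) Sx.
    have Sp0 := flow_in HF t Sx.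
    set p := phi (t + w) (c s); set p' := phi (t + w) x; set p0 := phi t x.
    (* Three effects are separated: the base points move, the quotient moves, and the quotient
       differs from its limit. *)
    have -> : A p p' (q s (t + w)) - a =
       (A p p' (q s (t + w)) - A p0 p0 (q s (t + w))) +
       (A p0 p0 (q s (t + w) - q s t) + A p0 p0 (q s t - U t)).
      by rewrite !linB // -/a addrA subrKA addrA subrK.
    (* Passing through [p'], the squared distance from [p] to [p0] is at most [4 * r1]; that from
       [p'] to [p0] adds [r1]. *)
    have g1 : sqn (A p p' (q s (t + w)) - A p0 p0 (q s (t + w))) <=
        L * (5 * r1) * G B.
      apply: (le_trans (lin_lipschitz HF _ _ _ _ _)) => //.
      apply: ler_pM; rewrite ?sqn_ge0 ?mulr_ge0 ?addr_ge0 ?sqn_ge0 //; last exact: qB.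
      apply: ler_wpM2l => //.
      have := flowG s0 Ss sK (twB _ wh).
      have := sqnD He (p - p') (p' - p0); rewrite addrA subrK.
      rewrite -/p -/p'; move: p1; rewrite -/p' -/p0 => p1 k1 k2; lra.
    have g2 : sqn (A p0 p0 (q s (t + w) - q s t)) <= L * (expR 1 * (L * G B) * r3).
      apply: (le_trans (lin_bounded HF _ _ _)) => //; apply: ler_wpM2l => //.
      apply: (le_trans (q_slow _ wh)); apply: ler_wpM2l => //.
      by apply: mulr_ge0; [exact: expR_ge0|exact: mulr_ge0].
    have g3 : sqn (A p0 p0 (q s t - U t)) <= L * r2.
      by apply: (le_trans (lin_bounded HF _ _ _)) => //; exact: ler_wpM2l.
    have k1 : L * (5 * r1) * G B <= 5 * eta / 100.
      have -> : L * (5 * r1) * G B =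
          5 * eta / 100 * ((L / (L + 1)) * (G B / (G B + 1))).
        by rewrite /r1; field; rewrite Ln Gn.
      apply: ler_piMr; last by apply: mulr_ile1.
      by rewrite divr_ge0 // mulr_ge0 // ltW.
    have k2 : L * (expR 1 * (L * G B) * r3) <= eta / 100.
      have -> : L * (expR 1 * (L * G B) * r3) =
          eta / 100 * ((L / (L + 1)) * (L / (L + 1)) * (G B / (G B + 1))).
        by rewrite /r3; field; rewrite Ln Gn en.
      apply: ler_piMr; first by rewrite divr_ge0 // ltW.
      by apply: mulr_ile1 => //; [exact: mulr_ge0|exact: mulr_ile1].
    have k3 : L * r2 <= eta / 100.
      have -> : L * r2 = eta / 100 * (L / (L + 1)) by rewrite /r2; field.
      by apply: ler_piMr => //; rewrite divr_ge0 // ltW.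
    apply: (le_trans (sqnD He _ _)).
    have := sqnD He (A p0 p0 (q s (t + w) - q s t)) (A p0 p0 (q s t - U t)).
    move=> k4; lra.
  - by rewrite addr0 subrr sub0r scale0r oppr0.
have -> : U (t + h) - U t - h *: a = (q s (t + h) - q s t - h *: a) -
    ((q s (t + h) - U (t + h)) - (q s t - U t)).
  set y := h *: a; set y1 := q s (t + h); set y2 := q s t.
  apply: (coord_inj He) => i; rewrite !(coordB He); ring.
apply: (le_trans (sqnB He _ _)).
have k5 := sqnB He (q s (t + h) - U (t + h)) (q s t - U t).
have k6 : 2 * (expR 1 * eta * h ^+ 2) = r * h ^+ 2 / 2.
  rewrite /eta; field; rewrite gt_eqF // expR_gt0.
have k7 : 0 <= r * h ^+ 2 by rewrite mulr_ge0 ?sqr_ge0 // ltW.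
lra.
Unshelve. all: by end_near. Qed.

Lemma variation_exists : exists V : R -> E,
  [/\ V 0 = v, forall t : R, is_derive t 1 V (A (phi t x) (phi t x) (V t)) &
    forall t, is_derive (0 : R) 1 (fun s => phi t (c s)) (V t)].
Proof. by exists U; split => //; exact: U_variation. Qed.

End Variation.

(** * Matrix calculus *)

Section MatrixCalculus.
Variable R : realType.

Lemma is_derive_mx m n (M : R -> 'M[R]_(m, n)) (t : R) dM :
  is_derive t 1 M dM <->
  forall i j, is_derive t 1 (fun s => M s i j) (dM i j).
Proof.
split=> [[H <-] i j|H].
  have /derivable_mxP H' := H; split; first exact: H'.
  by rewrite derive_mx // mxE.
have Hd : derivable M t 1 by apply/derivable_mxP => i j; case: (H i j).
split => //; rewrite derive_mx //; apply/matrixP => i j; rewrite mxE.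
by case: (H i j).
Qed.

Lemma is_derive_pair (V W : normedModType R) (f : R -> V * W) (t : R) df :
  is_derive t 1 f df <->
  is_derive t 1 (fun s => (f s).1) df.1 /\ is_derive t 1 (fun s => (f s).2) df.2.
Proof.
rewrite !is_derive_cvg; split=> [H|[H1 H2]].
  split.
    exact: (cvg_comp _ _ H (@cvg_fst _ _ _ _ _)).
  exact: (cvg_comp _ _ H (@cvg_snd _ _ _ _ _)).
rewrite [df]surjective_pairing.
exact: (cvg_pair H1 H2).
Qed.

Lemma is_derive_sum_fun (V : normedModType R) (I : Type) (r : seq I)
    (f : I -> R -> V) (df : I -> V) (t : R) :
  (forall i, is_derive t 1 (f i) (df i)) ->
  is_derive t 1 (fun s => \sum_(i <- r) f i s) (\sum_(i <- r) df i).
Proof.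
move=> H; have -> : (fun s => \sum_(i <- r) f i s) = \sum_(i <- r) f i.
  by apply/funext => s; rewrite fct_sumE.
by elim/big_ind2 : _ => [|f1 df1 f2 df2 H1 H2|i _] //;
  [exact: is_derive_cst|exact: is_deriveD].
Qed.

Lemma is_derive_mulmx m n p (M : R -> 'M[R]_(m, n)) (N : R -> 'M[R]_(n, p))
    (t : R) dM dN :
  is_derive t 1 M dM -> is_derive t 1 N dN ->
  is_derive t 1 (fun s => M s *m N s) (dM *m N t + M t *m dN).
Proof.
move=> /is_derive_mx HM /is_derive_mx HN; apply/is_derive_mx => i j.
rewrite !mxE -big_split /=.
rewrite (_ : (fun s => _) = fun s => \sum_k M s i k * N s k j); last first.
  by apply/funext => s; rewrite mxE.
apply: is_derive_sum_fun => k; have := HM i k; have := HN k j.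
move=> H1 H2; apply: is_derive_eq.
by rewrite -![_ *: _]/(_ * _); ring.
Qed.

Lemma is_derive_trmx m n (M : R -> 'M[R]_(m, n)) (t : R) dM :
  is_derive t 1 M dM -> is_derive t 1 (fun s => (M s)^T) dM^T.
Proof.
move=> /is_derive_mx H; apply/is_derive_mx => i j; rewrite mxE.
by under eq_fun do rewrite mxE.
Qed.

Lemma is_derive_col_mx m1 m2 n (M : R -> 'M[R]_(m1, n)) (N : R -> 'M[R]_(m2, n))
    (t : R) dM dN :
  is_derive t 1 M dM -> is_derive t 1 N dN ->
  is_derive t 1 (fun s => col_mx (M s) (N s)) (col_mx dM dN).
Proof.
move=> /is_derive_mx HM /is_derive_mx HN; apply/is_derive_mx => i j.
case: (split_ordP i) => k ->.
  by rewrite col_mxEu; under eq_fun do rewrite col_mxEu.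
by rewrite col_mxEd; under eq_fun do rewrite col_mxEd.
Qed.

Lemma is_derive_linear m n p q (L : 'M[R]_(m, n) -> 'M[R]_(p, q))
    (M : R -> 'M[R]_(m, n)) (t : R) dM :
  (forall (a : R) x y, L (a *: x + y) = a *: L x + L y) ->
  is_derive t 1 M dM -> is_derive t 1 (fun s => L (M s)) (L dM).
Proof.
move=> HL /is_derive_mx HM.
have L0 : L 0 = 0.
  by have := HL 1 0 0; rewrite !scale1r addr0 => h; apply: (addrI (L 0)); rewrite -h addr0.
have LD x y : L (x + y) = L x + L y by rewrite -[x]scale1r HL !scale1r.
have LZ a x : L (a *: x) = a *: L x by rewrite -[_ *: _]addr0 HL L0 addr0.
have E x : L x = \sum_i \sum_j x i j *: L (delta_mx i j).
  rewrite {1}[x]matrix_sum_delta (big_morph L LD L0); apply: eq_bigr => i _.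
  by rewrite (big_morph L LD L0); apply: eq_bigr => j _; rewrite LZ.
rewrite E; under eq_fun do rewrite E.
apply: is_derive_sum_fun => i; apply: is_derive_sum_fun => j.
apply/is_derive_mx => k l; rewrite mxE; under eq_fun do rewrite mxE.
have H := HM i j; apply: is_derive_eq.
by rewrite -![_ *: _]/(_ * _) mulr0 add0r mulrC.
Qed.

Lemma is_derive_prod n (f : 'I_n -> R -> R) (df : 'I_n -> R) (t : R) :
  (forall i, is_derive t 1 (f i) (df i)) ->
  is_derive t 1 (fun s => \prod_i f i s)
    (\sum_i \prod_j (if j == i then df j else f j t)).
Proof.
elim: n f df => [|n IH] f df H.
  rewrite big_ord0; under eq_fun do rewrite big_ord0; exact: is_derive_cst.
under eq_fun do rewrite big_ord_recl.
rewrite big_ord_recl big_ord_recl /=.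
have H1 := H ord0; have H2 := IH _ _ (fun i => H (lift ord0 i)).
apply: is_derive_eq; rewrite -![_ *: _]/(_ * _) addrC mulrC.
congr (_ + _); rewrite mulr_sumr; apply: eq_bigr => i _.
by rewrite big_ord_recl.
Qed.

Definition row_set m n (M : 'M[R]_(m, n)) (i0 : 'I_m) (r : 'I_n -> R) : 'M[R]_(m, n) :=
  \matrix_(i, j) if i == i0 then r j else M i j.

Definition col_set m n (M : 'M[R]_(m, n)) (j0 : 'I_n) (c : 'cV[R]_m) : 'M[R]_(m, n) :=
  \matrix_(i, j) if j == j0 then c i 0 else M i j.

Lemma det_row_set n (M : 'M[R]_n) i0 r :
  \det (row_set M i0 r) = \sum_j r j * cofactor M i0 j.
Proof.
rewrite (expand_det_row _ i0); apply: eq_bigr => j _.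
rewrite mxE eqxx; congr (_ * (_ * \det _)); apply/matrixP => k l.
by rewrite !mxE eq_sym (negbTE (neq_lift _ _)).
Qed.

Lemma det_col_set n (M : 'M[R]_n) j0 c :
  \det (col_set M j0 c) = \sum_i c i 0 * cofactor M i j0.
Proof.
rewrite (expand_det_col _ j0); apply: eq_bigr => i _.
rewrite mxE eqxx; congr (_ * (_ * \det _)); apply/matrixP => k l.
by rewrite !mxE eq_sym (negbTE (neq_lift _ _)).
Qed.

(** Jacobi's formula: the Leibniz expansion is differentiated factor by factor and regrouped by
    rows, each of which gives a cofactor expansion. *)
Lemma is_derive_det n (M : R -> 'M[R]_n) (t : R) dM :
  is_derive t 1 M dM ->
  is_derive t 1 (fun s => \det (M s)) (\tr (dM *m \adj (M t))).
Proof.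
move=> /is_derive_mx H.
have -> : \tr (dM *m \adj (M t)) = \sum_i \det (row_set (M t) i (dM i)).
  apply: eq_bigr => i _; rewrite det_row_set mxE.
  by apply: eq_bigr => j _; rewrite [\adj _ _ _]mxE.
rewrite /determinant exchange_big /=.
apply: is_derive_sum_fun => s; rewrite -mulr_sumr.
have H1 := is_derive_prod (fun i => H i (s i)).
have E : \sum_(i < n) \prod_(j < n) (if j == i then dM j (s j) else M t j (s j)) =
    \sum_(i < n) \prod_(j < n) row_set (M t) i (dM i) j (s j).
  apply: eq_bigr => i _; apply: eq_bigr => j _; rewrite mxE.
  by case: eqVneq => // ->.
by rewrite -E; exact: is_deriveZ.
Qed.

(** Liouville's formula with a defect [tau] in column 0, the place of the radial vector. By
    linearity in that column the defect contributes exactly the determinant assumed to vanish. *)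
Lemma is_derive_det_transport n (M : R -> 'M[R]_n.+1) (t : R) (A : 'M[R]_n.+1)
    (tau : 'cV[R]_n.+1) :
  is_derive t 1 M (A *m M t + tau *m delta_mx 0 0) ->
  \det (col_set (M t) 0 tau) = 0 ->
  is_derive t 1 (fun s => \det (M s)) (\tr A * \det (M t)).
Proof.
move=> /is_derive_det HM H0; apply: (is_derive_eq HM).
rewrite mulmxDl raddfD /= -mulmxA mul_mx_adj -scalemx1 -scalemxAr mulmx1.
rewrite mxtraceZ mulrC -[RHS]addr0; congr (_ + _).
rewrite -H0 det_col_set -mulmxA mxtrace_mulC -rowE trace_mx11 mxE.
by apply: eq_bigr => i _; rewrite !mxE mulrC.
Qed.

End MatrixCalculus.

(** * Coordinates on so(n) and the operator kappa *)

Section SoCoordinates.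
Variables (R : realType) (n : nat).
Local Notation d := (dim_so n).
Implicit Types (X Y : 'M[R]_n) (x y gam : 'cV[R]_n).

Lemma so0 : so (0 : 'M[R]_n).
Proof. by rewrite /so /= trmx0 oppr0. Qed.

Lemma soD X Y : so X -> so Y -> so (X + Y).
Proof. by rewrite /so /= => HX HY; rewrite raddfD /= HX HY opprD. Qed.

Lemma soZ (a : R) X : so X -> so (a *: X).
Proof. by rewrite /so /= => HX; rewrite linearZ /= HX scalerN. Qed.

Lemma soN X : so X -> so (- X).
Proof. by rewrite /so /= => HX; rewrite raddfN /= HX. Qed.

Lemma so_wedgev x y : so (wedgev x y).
Proof. by rewrite /so /wedgev /= raddfB /= !trmx_mul !trmxK opprB. Qed.

Lemma so_brk X Y : so X -> so Y -> so (brk X Y).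
Proof.
rewrite /so /brk /= => HX HY; rewrite raddfB /= !trmx_mul HX HY.
by rewrite !mulmxN !mulNmx !opprK opprB.
Qed.

Lemma so_dotDl X X' Y : so_dot (X + X') Y = so_dot X Y + so_dot X' Y.
Proof. by rewrite /so_dot mulmxDl raddfD mulrDr. Qed.

Lemma so_dotZl (a : R) X Y : so_dot (a *: X) Y = a * so_dot X Y.
Proof. by rewrite /so_dot -scalemxAl mxtraceZ mulrCA. Qed.

Lemma so_dotC X Y : so_dot X Y = so_dot Y X.
Proof. by rewrite /so_dot mxtrace_mulC. Qed.

Lemma so_dotDr X Y Y' : so_dot X (Y + Y') = so_dot X Y + so_dot X Y'.
Proof. by rewrite !(so_dotC X) so_dotDl. Qed.

Lemma so_dotZr (a : R) X Y : so_dot X (a *: Y) = a * so_dot X Y.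
Proof. by rewrite !(so_dotC X) so_dotZl. Qed.

Lemma so_dot_wedgev x y Y : so Y -> so_dot (wedgev x y) Y = dotv x (Y *m y).
Proof.
rewrite /so /= => HY; rewrite /so_dot /wedgev mulmxBl raddfB /=.
rewrite -!mulmxA !(mxtrace_mulC _ (_ *m Y)) !trace_mx11 /dotv -!mulmxA.
have E : (y^T *m (Y *m x))^T = - (x^T *m (Y *m y)).
  by rewrite !trmx_mul trmxK HY mulmxN mulNmx mulmxA.
have := congr1 (fun A : 'M[R]_1 => A 0 0) E; rewrite /= mxE [RHS]mxE => ->.
by field.
Qed.

Lemma dotv_std (i j : 'I_n) X : dotv (stdv R i) (X *m stdv R j) = X i j.
Proof. by rewrite /dotv /stdv -colE trmx_delta -rowE !mxE. Qed.

Definition vecso X : 'cV[R]_d := \col_a so_dot (so_basis R a) X.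

Definition matso (c : 'cV[R]_d) : 'M[R]_n := \sum_a c a 0 *: so_basis R a.

Lemma so_so_basis a : so (so_basis R a : 'M[R]_n).
Proof. exact: so_wedgev. Qed.

Lemma vecsoE X a : so X -> vecso X a 0 = X (enum_val a).1 (enum_val a).2.
Proof. by move=> HX; rewrite mxE so_dot_wedgev // dotv_std. Qed.

Lemma so_indexP (a : 'I_d) : ((enum_val a).1 < (enum_val a).2)%N.
Proof. by have := enum_valP a; rewrite inE. Qed.

Lemma so_basisE (a : 'I_d) i j : so_basis R a i j =
  ((i, j) == enum_val a)%:R - ((j, i) == enum_val a)%:R.
Proof.
rewrite /so_basis /wedgev; case: (enum_val a) => k l /=.
rewrite /stdv !trmx_delta !mul_delta_mx !mxE.
by rewrite !xpair_eqE [in X in _ - X]andbC.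
Qed.

Lemma vecsoD X Y : vecso (X + Y) = vecso X + vecso Y.
Proof. by apply/colP => a; rewrite !mxE so_dotDr. Qed.

Lemma vecsoZ c X : vecso (c *: X) = c *: vecso X.
Proof. by apply/colP => a; rewrite !mxE so_dotZr. Qed.

Lemma vecsoN X : vecso (- X) = - vecso X.
Proof. by rewrite -scaleN1r vecsoZ scaleN1r. Qed.

Lemma vecsoB X Y : vecso (X - Y) = vecso X - vecso Y.
Proof. by rewrite vecsoD vecsoN. Qed.

Lemma vecso0 : vecso 0 = 0.
Proof. by rewrite -(scale0r (0 : 'M[R]_n)) vecsoZ scale0r. Qed.

Lemma vecso_sum I (r : seq I) (F : I -> 'M[R]_n) :
  vecso (\sum_(i <- r) F i) = \sum_(i <- r) vecso (F i).
Proof.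
elim: r => [|i r IH]; first by rewrite !big_nil vecso0.
by rewrite !big_cons vecsoD IH.
Qed.

Lemma vecso_basis a : vecso (so_basis R a) = delta_mx a 0.
Proof.
apply/colP => b; rewrite vecsoE; last exact: so_so_basis.
rewrite so_basisE mxE -surjective_pairing (inj_eq enum_val_inj) eqxx andbT.
rewrite (_ : _ == enum_val a = false) ?subr0 //.
apply/negP => /eqP E; have := so_indexP a; have := so_indexP b.
by rewrite -E /=; case: ltngtP.
Qed.

Lemma so_matso c : so (matso c).
Proof.
rewrite /matso; elim/big_ind: _ => [||a _]; [exact: so0|exact: soD|].
by apply: soZ; exact: so_so_basis.
Qed.

Lemma matsoK c : vecso (matso c) = c.
Proof.
rewrite /matso vecso_sum; under eq_bigr do rewrite vecsoZ vecso_basis.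
by rewrite [RHS]matrix_sum_delta; apply: eq_bigr => a _; rewrite big_ord1.
Qed.

Lemma vecso_inj X Y : so X -> so Y -> vecso X = vecso Y -> X = Y.
Proof.
move=> HX HY E; apply/eqP; rewrite -subr_eq0; apply/eqP.
have HZ : so (X - Y) by apply: soD => //; exact: soN.
have E0 : vecso (X - Y) = 0 by rewrite vecsoB E subrr.
have upper (i j : 'I_n) : (i < j)%N -> (X - Y) i j = 0.
  move=> ij; have ijP : (i, j) \in so_index n by rewrite inE.
  have := vecsoE (enum_rank_in ijP (i, j)) HZ.
  by rewrite E0 enum_rankK_in // mxE => <-.
have skew i j : (X - Y) i j = - (X - Y) j i.
  by have /matrixP/(_ j i) := HZ; rewrite mxE => ->; rewrite mxE.
apply/matrixP => i j; rewrite [RHS]mxE; case: (ltngtP i j) => [/upper //|ji|ij].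
  by rewrite skew upper // oppr0.
have {ij} -> : i = j by exact: val_inj.
have := skew j j; set z := (X - Y) j j => h; lra.
Qed.

Lemma vecsoK X : so X -> matso (vecso X) = X.
Proof. by move=> HX; apply: vecso_inj => //; [exact: so_matso|exact: matsoK]. Qed.

Lemma matsoD c c' : matso (c + c') = matso c + matso c'.
Proof.
by apply: vecso_inj; rewrite ?vecsoD ?matsoK //; [|apply: soD]; exact: so_matso.
Qed.

Lemma matsoZ (r : R) c : matso (r *: c) = r *: matso c.
Proof.
by apply: vecso_inj; rewrite ?vecsoZ ?matsoK //; [|apply: soZ]; exact: so_matso.
Qed.

Lemma so_dot_vecso X Y : so X -> so_dot X Y = ((vecso X)^T *m vecso Y) 0 0.
Proof.
move=> /vecsoK {1}<-; rewrite /matso mxE; set c := vecso X.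
transitivity (\sum_a c a 0 * so_dot (so_basis R a) Y).
  elim/big_ind2: _ => [|X1 s1 X2 s2 <- <-|a _].
  - by rewrite -(scale0r (0 : 'M[R]_n)) so_dotZl mul0r.
  - by rewrite so_dotDl.
  - by rewrite so_dotZl.
by apply: eq_bigr => a _; rewrite !mxE.
Qed.

Lemma brk_linear_l om (a : R) (x y : 'M[R]_n) : brk (a *: x + y) om = a *: brk x om + brk y om.
Proof.
by rewrite /brk mulmxDl mulmxDr -scalemxAl -scalemxAr scalerBr opprD addrACA.
Qed.

Lemma brk_linear_r om (a : R) (x y : 'M[R]_n) : brk om (a *: x + y) = a *: brk om x + brk om y.
Proof.
by rewrite /brk mulmxDl mulmxDr -scalemxAl -scalemxAr scalerBr opprD addrACA.
Qed.

(** Invariance of the scalar product under the adjoint action; it yields the conservation of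
    [<k, k>] and the reduction of [Omega] to a constant form. *)
Lemma so_dot_brk (k X Y : 'M[R]_n) : so_dot (brk k X) Y = so_dot k (brk X Y).
Proof.
rewrite /so_dot /brk !mulmxBl !mulmxBr !raddfB /= !mulmxA.
by congr (_ * (_ - _)); rewrite -(mulmxA X) [LHS]mxtrace_mulC.
Qed.

Definition opmx (F : 'M[R]_n -> 'M[R]_n) : 'M[R]_d :=
  \matrix_(a, b) so_dot (so_basis R a) (F (so_basis R b)).

Definition so_linear (F : 'M[R]_n -> 'M[R]_n) : Prop :=
  forall (a : R) X Y, so X -> so Y -> F (a *: X + Y) = a *: F X + F Y.

Lemma opmxE F X : so_linear F -> so X -> vecso (F X) = opmx F *m vecso X.
Proof.
move=> HF HX.
have F0 : F 0 = 0.
  have := HF 1 0 0 so0 so0; rewrite !scale1r addr0 => h.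
  by apply: (addrI (F 0)); rewrite -h addr0.
have H (r : seq 'I_d) (c : 'cV[R]_d) : so (\sum_(a <- r) c a 0 *: so_basis R a) /\
  vecso (F (\sum_(a <- r) c a 0 *: so_basis R a)) =
  \sum_(a <- r) c a 0 *: vecso (F (so_basis R a)).
  elim: r => [|a r [IH1 IH2]]; first by rewrite !big_nil F0 vecso0; split; [exact: so0|].
  rewrite !big_cons; split; first by apply: soD => //; apply: soZ; exact: so_so_basis.
  by rewrite HF //; [rewrite vecsoD vecsoZ IH2|exact: so_so_basis].
rewrite -{1}(vecsoK HX) /matso (H _ _).2; apply/colP => b; rewrite summxE mxE.
by apply: eq_bigr => a _; rewrite !mxE mulrC.
Qed.

(** The matrix of wedging with [gam], whose transpose is evaluation at [gam]. It is linear in [gam],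
    and the projection [pr_v gam] on so(n) is its product with its transpose. *)
Definition wedge_mx gam : 'M[R]_(d, n) :=
  \matrix_(a, k) vecso (wedgev (stdv R k) gam) a 0.

Lemma wedgevDl x x' y : wedgev (x + x') y = wedgev x y + wedgev x' y.
Proof. by rewrite /wedgev raddfD /= mulmxDl mulmxDr opprD addrACA. Qed.

Lemma wedgevZl (a : R) x y : wedgev (a *: x) y = a *: wedgev x y.
Proof. by rewrite /wedgev linearZ /= -scalemxAl -scalemxAr scalerBr. Qed.

Lemma wedgevN x y : wedgev x y = - wedgev y x.
Proof. by rewrite /wedgev opprB. Qed.

Lemma wedgevDr x y y' : wedgev x (y + y') = wedgev x y + wedgev x y'.
Proof. by rewrite !(wedgevN x) wedgevDl opprD. Qed.

Lemma wedgevZr (a : R) x y : wedgev x (a *: y) = a *: wedgev x y.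
Proof. by rewrite !(wedgevN x) wedgevZl scalerN. Qed.

Lemma mul_wedge_mx gam x : wedge_mx gam *m x = vecso (wedgev x gam).
Proof.
have -> : wedgev x gam = \sum_k x k 0 *: wedgev (stdv R k) gam.
  rewrite {1}(_ : x = \sum_k x k 0 *: stdv R k).
    by elim/big_ind2: _ => [|x1 X1 x2 X2 <- <-|k _];
      [rewrite -(scale0r 0) wedgevZl scale0r|rewrite wedgevDl|rewrite wedgevZl].
  by rewrite {1}[x]matrix_sum_delta; apply: eq_bigr => k _; rewrite big_ord1.
rewrite vecso_sum; apply/colP => a; rewrite mxE summxE.
by apply: eq_bigr => k _; rewrite vecsoZ !mxE mulrC.
Qed.

(** Exchanging parameter and argument turns a variation of [gam] inside [wedge_mx] into a vector
    acted on by a matrix; [kappa_slope] rests on this. *)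
Lemma wedge_mxC x y : wedge_mx x *m y = - (wedge_mx y *m x).
Proof. by rewrite !mul_wedge_mx wedgevN vecsoN. Qed.

Lemma dotv_inj x y : (forall z, dotv z x = dotv z y) -> x = y.
Proof.
move=> H; apply/colP => i; have := H (delta_mx i 0).
by rewrite /dotv trmx_delta -!rowE !mxE.
Qed.

Lemma tr_wedge_mx gam Y : so Y -> (wedge_mx gam)^T *m vecso Y = Y *m gam.
Proof.
move=> HY; apply: dotv_inj => x.
rewrite -so_dot_wedgev // so_dot_vecso; last exact: so_wedgev.
by rewrite -mul_wedge_mx trmx_mul -mulmxA.
Qed.

Lemma wedge_mxD x y : wedge_mx (x + y) = wedge_mx x + wedge_mx y.
Proof. by apply/matrixP => a k; rewrite !mxE wedgevDr so_dotDr. Qed.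

Lemma wedge_mxZ (a : R) x : wedge_mx (a *: x) = a *: wedge_mx x.
Proof. by apply/matrixP => b k; rewrite !mxE wedgevZr so_dotZr. Qed.

End SoCoordinates.

(** * Positive definite matrices *)

Section PositiveDefinite.
Variables (R : realType) (d : nat).
Implicit Types P Q : 'M[R]_d.

Definition posdef P := P^T = P /\ forall x : 'cV[R]_d, x != 0 -> 0 < dotv x (P *m x).

Lemma dotvDl (x y z : 'cV[R]_d) : dotv (x + y) z = dotv x z + dotv y z.
Proof. by rewrite /dotv raddfD /= mulmxDl mxE. Qed.

Lemma dotvDr (x y z : 'cV[R]_d) : dotv z (x + y) = dotv z x + dotv z y.
Proof. by rewrite /dotv mulmxDr mxE. Qed.

Lemma dotvZl (a : R) (x y : 'cV[R]_d) : dotv (a *: x) y = a * dotv x y.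
Proof. by rewrite /dotv linearZ /= -scalemxAl mxE. Qed.

Lemma dotvZr (a : R) (x y : 'cV[R]_d) : dotv x (a *: y) = a * dotv x y.
Proof. by rewrite /dotv -scalemxAr mxE. Qed.

Lemma dotvBl (x y z : 'cV[R]_d) : dotv (x - y) z = dotv x z - dotv y z.
Proof. by rewrite dotvDl -scaleN1r dotvZl mulN1r. Qed.

Lemma dotvBr (x y z : 'cV[R]_d) : dotv z (x - y) = dotv z x - dotv z y.
Proof. by rewrite dotvDr -scaleN1r dotvZr mulN1r. Qed.

Lemma dotvC (x y : 'cV[R]_d) : dotv x y = dotv y x.
Proof. by rewrite /dotv !mxE; apply: eq_bigr => i _; rewrite !mxE mulrC. Qed.

Lemma dotvE (x y : 'cV[R]_d) : dotv x y = \sum_i x i 0 * y i 0.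
Proof. by rewrite /dotv mxE; apply: eq_bigr => i _; rewrite mxE. Qed.

Lemma dotv_ge0 (x : 'cV[R]_d) : 0 <= dotv x x.
Proof. by rewrite dotvE; apply: sumr_ge0 => i _; rewrite -expr2 sqr_ge0. Qed.

Lemma dotv_gt0 (x : 'cV[R]_d) : x != 0 -> 0 < dotv x x.
Proof.
move=> x0; rewrite lt_neqAle dotv_ge0 andbT eq_sym; apply: contra_neq x0.
rewrite dotvE => /eqP; rewrite psumr_eq0; last by move=> i _; rewrite -expr2 sqr_ge0.
move=> /allP H; apply/colP => i; rewrite mxE.
by have /eqP := H i (mem_index_enum _); rewrite -expr2 => /eqP; rewrite sqrf_eq0 => /eqP.
Qed.

Lemma dotv_mx m (A : 'M[R]_(d, m)) x y : dotv (A *m x) y = dotv x (A^T *m y).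
Proof. by rewrite /dotv trmx_mul mulmxA. Qed.

Lemma posdef_ge0 P x : posdef P -> 0 <= dotv x (P *m x).
Proof.
by move=> [_ H]; have [->|/H /ltW //] := eqVneq x 0; rewrite mulmx0 /dotv mulmx0 mxE.
Qed.

Lemma posdef_det_neq0 P : posdef P -> \det P != 0.
Proof.
move=> [PT PP]; apply/negP => /det0P [v v0 vP].
have : 0 < dotv v^T (P *m v^T).
  by apply: PP; apply: contraNneq v0 => /(congr1 trmx); rewrite trmxK trmx0 => ->.
by rewrite /dotv trmxK mulmxA vP mul0mx mxE ltxx.
Qed.

(* Deform [P] to the identity through positive definite matrices. *)
Lemma posdef_det_gt0 P : posdef P -> 0 < \det P.
Proof.
move=> HP; pose f (t : R) := \det (1%:M + t *: (P - 1%:M)).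
have fn0 t : 0 <= t <= 1 -> f t != 0.
  move=> /andP[t0 t1]; apply: posdef_det_neq0; case: (HP) => PT PP; split.
    by rewrite raddfD /= linearZ /= raddfB /= PT !trmx1.
  move=> x x0; rewrite mulmxDl mul1mx dotvDr -scalemxAl dotvZr mulmxBl mul1mx.
  rewrite dotvDr -scaleN1r dotvZr mulN1r.
  have := PP _ x0; have := dotv_gt0 x0.
  set a := dotv x x; set b := dotv x _ => a0 b0.
  have -> : a + t * (b - a) = (1 - t) * a + t * b by ring.
  have [->|tp] := eqVneq t 0; first by rewrite subr0 mul0r addr0 mul1r.
  rewrite ltr_wpDl //; first by rewrite mulr_ge0 ?subr_ge0 // ltW.
  by rewrite mulr_gt0 // lt_neqAle eq_sym tp.
have f0 : f 0 = 1 by rewrite /f scale0r addr0 det1.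
have f1 : f 1 = \det P by rewrite /f scale1r addrCA subrr addr0.
have cont : {within `[0, 1], continuous f}.
  apply: continuous_subspaceT => t.
  apply: (@is_derive_cont _ _ _ (\tr ((P - 1%:M) *m \adj (1%:M + t *: (P - 1%:M))))).
  apply: (is_derive_det (M := fun t => 1%:M + t *: (P - 1%:M))).
  apply/is_derive_mx => i j.
  rewrite (_ : (fun s => _) = fun s => (1%:M : 'M[R]_d) i j + s * (P - 1%:M) i j).
    by apply: is_derive_eq; rewrite -![_ *: _]/(_ * _) ; ring.
  by apply/funext => s; rewrite mxE [in X in _ + X]mxE.
rewrite ltNge; apply/negP => dP.
have [|c ci fc] := @IVT R f 0 1 0 ler01 cont.
  by rewrite f0 f1 ge_min le_max dP ler01 orbT.
by have := fn0 c; rewrite fc eqxx => /(_ _) /negP; apply; [rewrite in_itv /= in ci|].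
Qed.

Lemma posdef_unit P : posdef P -> P \in unitmx.
Proof. by move=> HP; rewrite unitmxE unitfE gt_eqF // posdef_det_gt0. Qed.

Lemma posdef_inv P : posdef P -> posdef (invmx P).
Proof.
move=> HP; have uP := posdef_unit HP; case: (HP) => PT PP; split.
  by rewrite trmx_inv PT.
move=> x x0; rewrite -{1}(mulKVmx uP x) dotv_mx PT mulKVmx // dotvC.
have y0 : invmx P *m x != 0.
  by apply: contra_neq x0 => E; rewrite -(mulKVmx uP x) E mulmx0.
by have := PP _ y0; rewrite mulKVmx // dotvC.
Qed.

(** Expand [0 <= (z - y, P (z - y))] where [P z = x = Q y], and replace [(y, P y)] by the larger
    [(y, Q y)]. *)
Lemma posdef_inv_le P Q x : posdef P -> posdef Q ->
  (forall y, dotv y (P *m y) <= dotv y (Q *m y)) ->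
  dotv x (invmx Q *m x) <= dotv x (invmx P *m x).
Proof.
move=> HP HQ PQ; have uP := posdef_unit HP; have uQ := posdef_unit HQ.
set y := invmx Q *m x; set z := invmx P *m x.
have Px : P *m z = x by rewrite mulKVmx.
have Qx : Q *m y = x by rewrite mulKVmx.
have := posdef_ge0 (z - y) HP.
rewrite mulmxBr Px dotvBl !dotvBr.
have -> : dotv z (P *m y) = dotv x y by rewrite -HP.1 -dotv_mx Px.
rewrite (dotvC z) (dotvC y x) => h.
have := PQ y; rewrite Qx (dotvC y x).
set a := dotv y _ in h *; set b := dotv x y in h *; set c := dotv x z in h *; lra.
Qed.

(** Testing on [e_i + e_j] and [e_i - e_j] gives [2 |P_ij| <= P_ii + P_jj]. *)
Lemma posdef_entry_le P (C : R) : posdef P -> (forall i, P i i <= C) ->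
  forall i j, `|P i j| <= C.
Proof.
move=> HP HC i j.
have E (a : R) :
    dotv (delta_mx i 0 + a *: delta_mx j 0) (P *m (delta_mx i 0 + a *: delta_mx j 0))
   = P i i + a * (P i j + P j i) + a ^+ 2 * P j j.
  rewrite mulmxDr -scalemxAr dotvDl !dotvDr !dotvZl !dotvZr.
  rewrite /dotv !trmx_delta -!rowE -!colE !mxE; ring.
have PT : P j i = P i j by rewrite -{1}HP.1 mxE.
have h1 := posdef_ge0 (delta_mx i 0 + 1 *: delta_mx j 0) HP.
have h2 := posdef_ge0 (delta_mx i 0 + -1 *: delta_mx j 0) HP.
rewrite !E PT in h1 h2.
have := HC i; have := HC j; rewrite ler_norml => h3 h4.
by apply/andP; split; lra.
Qed.

Lemma mxtrace_sym_skew (P S : 'M[R]_d) : P^T = P -> S^T = - S -> \tr (S *m P) = 0.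
Proof.
move=> HP HS; have := mxtrace_tr (S *m P).
rewrite trmx_mul HP HS mulmxN raddfN /= mxtrace_mulC.
set z := \tr _ => h; lra.
Qed.

End PositiveDefinite.

(** * The operator kappa, its inverse and the matrix of the linearized field *)

Section Kappa.
Variables (R : realType) (n : nat) (I : 'M[R]_n -> 'M[R]_n) (D : R).
Hypotheses (HI : inertia_tensor I) (D0 : 0 < D).
Local Notation d := (dim_so n).
Local Notation W := wedge_mx.

Definition kappa_mx (gam : 'cV[R]_n) : 'M[R]_d := opmx (kappa I D gam).

Definition kappa_inv (gam : 'cV[R]_n) : 'M[R]_d := invmx (kappa_mx gam).

Local Notation K := kappa_inv.

Lemma so_linear_kappa gam : so_linear (kappa I D gam).
Proof.
move=> a X Y HX HY; rewrite /kappa (inertia_linear HI) // /pr_v mulmxDl -scalemxAl.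
by rewrite wedgevDl wedgevZl !scalerDr !scalerA addrACA (mulrC D).
Qed.

Lemma so_kappa gam X : so X -> so (kappa I D gam X).
Proof.
move=> HX; apply: soD; first exact: (inertia_so HI).
by apply: soZ; exact: so_wedgev.
Qed.

Lemma vecso_kappa gam X : so X -> vecso (kappa I D gam X) = kappa_mx gam *m vecso X.
Proof. by move=> HX; rewrite (opmxE _ HX) //; exact: so_linear_kappa. Qed.

Lemma kappa_mxE gam : kappa_mx gam = opmx I + D *: (W gam *m (W gam)^T).
Proof.
apply/matrixP => a b; set B := so_basis R b.
have HB : so B by exact: so_so_basis.
transitivity (vecso (kappa I D gam B) a 0); first by rewrite !mxE.
rewrite vecsoD vecsoZ -mul_wedge_mx -(tr_wedge_mx gam HB) vecso_basis.
rewrite mulmxA -colE; rewrite !mxE.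
by congr (_ + _); congr (_ * _); apply: eq_bigr => k _; rewrite !mxE.
Qed.

Lemma posdef_inertia : posdef (opmx I).
Proof.
split.
  apply/matrixP => a b; rewrite !mxE so_dotC (inertia_sym HI) //; exact: so_so_basis.
move=> x x0; have Hx := so_matso x.
have -> : dotv x (opmx I *m x) = so_dot (I (matso x)) (matso x).
  rewrite so_dotC so_dot_vecso // (opmxE (inertia_linear HI)) // matsoK //.
apply: (inertia_pos HI) => //; apply: contra_neq x0 => E.
by rewrite -(matsoK x) E vecso0.
Qed.

Lemma kappa_ge_inertia gam y :
  dotv y (opmx I *m y) <= dotv y (kappa_mx gam *m y).
Proof.
rewrite kappa_mxE mulmxDl dotvDr lerDl -scalemxAl dotvZr mulr_ge0 ?(ltW D0) //.
by rewrite -mulmxA dotvC dotv_mx; exact: dotv_ge0.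
Qed.

Lemma posdef_kappa gam : posdef (kappa_mx gam).
Proof.
have [IT IP] := posdef_inertia; split.
  by rewrite kappa_mxE raddfD /= linearZ /= trmx_mul trmxK IT.
by move=> x /IP /lt_le_trans; apply; exact: kappa_ge_inertia.
Qed.

Lemma kappa_unit gam : kappa_mx gam \in unitmx.
Proof. exact: posdef_unit (posdef_kappa gam). Qed.

Lemma kappa_inv_tr gam : (K gam)^T = K gam.
Proof. by have [] := posdef_inv (posdef_kappa gam). Qed.

Lemma mu_gt0 gam : 0 < mu I D gam.
Proof. by rewrite sqrtr_gt0; exact: posdef_det_gt0 (posdef_kappa gam). Qed.

(** As [kappa >= I] for every [gam], its inverse lies below that of [I], and a positive definite
    matrix is controlled by its diagonal. *)
Lemma kappa_inv_bounded : exists C : R, forall gam i j, `|K gam i j| <= C.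
Proof.
exists (\sum_i `|invmx (opmx I) i i|) => gam; apply: posdef_entry_le.
  exact: posdef_inv (posdef_kappa gam).
move=> i; have := posdef_inv_le (delta_mx i 0) posdef_inertia (posdef_kappa gam)
  (kappa_ge_inertia gam).
rewrite /dotv trmx_delta -!colE -!rowE !mxE -/(K gam) => /le_trans; apply.
apply: (le_trans (ler_norm _)); rewrite (bigD1 i) //= lerDl.
by apply: sumr_ge0 => j _; exact: normr_ge0.
Qed.

Lemma kappa_invP gam k om : so om -> k = kappa I D gam om ->
  vecso om = K gam *m vecso k.
Proof.
by move=> Hom ->; rewrite vecso_kappa // mulKmx //; exact: kappa_unit.
Qed.

(** Telescoping: [(om0 gam) /\ gam - (om0 gam0) /\ gam0] equals [(om0 (gam - gam0)) /\ gam + (om0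
    gam0) /\ (gam - gam0)], and both terms are linear in [gam - gam0]. *)
Definition kappa_slope (gam gam0 : 'cV[R]_n) (om0 : 'M[R]_n) : 'M[R]_(d, n) :=
  W gam *m om0 - W (om0 *m gam0).

Lemma kappaB gam gam0 om0 : so om0 ->
  (kappa_mx gam - kappa_mx gam0) *m vecso om0 =
  D *: (kappa_slope gam gam0 om0 *m (gam - gam0)).
Proof.
move=> H0; rewrite !kappa_mxE opprD addrACA subrr add0r -scalerBr -scalemxAl.
congr (_ *: _); rewrite mulmxBl -!mulmxA !tr_wedge_mx // /kappa_slope.
rewrite mulmxBl !mulmxBr -!mulmxA !(wedge_mxC (om0 *m gam0)).
by rewrite !opprK opprD opprK addrA subrK.
Qed.

(** Subtracting the two relations gives [kappa (om - om0) = (k - k0) - (kappa - kappa0) om0]. The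
    identity is exact, which makes the secant operator possible. *)
Lemma omegaB gam gam0 k k0 om om0 : so om -> so om0 ->
  k = kappa I D gam om -> k0 = kappa I D gam0 om0 ->
  vecso (om - om0) =
  K gam *m (vecso (k - k0) - D *: (kappa_slope gam gam0 om0 *m (gam - gam0))).
Proof.
move=> H H0 Hk Hk0; rewrite -kappaB // mulmxBl -(vecso_kappa gam0) // -Hk0.
rewrite [vecso (k - k0)]vecsoB opprB addrA subrK Hk vecso_kappa //.
by rewrite -mulmxBr -vecsoB mulKmx //; exact: kappa_unit.
Qed.

Definition kappa_deriv (gam v : 'cV[R]_n) : 'M[R]_d :=
  D *: (W v *m (W gam)^T + W gam *m (W v)^T).

Lemma is_derive_kappa_mx (gam : R -> 'cV[R]_n) (t : R) v :
  is_derive t 1 gam v ->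
  is_derive t 1 (fun s => kappa_mx (gam s)) (kappa_deriv (gam t) v).
Proof.
move=> Hg; have HW : is_derive t 1 (fun s => W (gam s)) (W v).
  by apply: is_derive_linear => // a x y; rewrite wedge_mxD wedge_mxZ.
rewrite /kappa_deriv; under eq_fun do rewrite kappa_mxE.
rewrite -[X in is_derive _ _ _ X]add0r; apply: is_deriveD.
apply: is_deriveZ; apply: is_derive_mulmx => //; exact: is_derive_trmx.
Qed.

(** Unimodularity of so(n); in this basis each diagonal entry already vanishes, by cyclicity of the
    trace. *)
Lemma mxtrace_brkl (om : 'M[R]_n) : \tr (opmx (fun X => brk X om)) = 0.
Proof.
rewrite /mxtrace big1 // => a _; rewrite mxE /so_dot /brk mulmxBr raddfB /=.
set b := so_basis R a.
have -> : \tr (b *m (b *m om)) = \tr (b *m (om *m b)).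
  by rewrite mulmxA mxtrace_mulC (mulmxA om) mxtrace_mulC.
by rewrite subrr mulr0.
Qed.

(** Infinitesimal invariance of the scalar product. It makes the trace against the symmetric [K]
    vanish. *)
Lemma opmx_brk_skew (k : 'M[R]_n) : (opmx (brk k))^T = - opmx (brk k).
Proof.
apply/matrixP => a b; rewrite !mxE.
set A := so_basis R a; set B := so_basis R b; move: A B => A B.
rewrite /so_dot /brk !mulmxBr !raddfB /=.
have -> : \tr (B *m (k *m A)) = \tr (A *m (B *m k)).
  by rewrite (mulmxA B) mxtrace_mulC.
have -> : \tr (B *m (A *m k)) = \tr (A *m (k *m B)).
  by rewrite mxtrace_mulC -mulmxA.
ring.
Qed.

(** The traces of [om] and of [W^T K W om] vanish, the latter as skew against symmetric. What
    remains is one of the two terms of [kappa_deriv]; these have equal trace against [K], whence the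
    factor 1/2 and the square root in [mu]. *)
Lemma mxtrace_zz eps gam om : so om ->
  \tr (- eps *: (om - D *: ((W gam)^T *m K gam *m kappa_slope gam gam om))) =
  1 / 2 * \tr (kappa_deriv gam (- eps *: (om *m gam)) *m K gam).
Proof.
move=> Hom; rewrite mxtraceZ raddfB /= mxtraceZ /kappa_slope mulmxBr raddfB /=.
have -> : \tr om = 0.
  by have := mxtrace_tr om; rewrite Hom raddfN /=; set z := \tr _ => h; lra.
have -> : \tr ((W gam)^T *m K gam *m (W gam *m om)) = 0.
  rewrite mulmxA mxtrace_mulC; apply: mxtrace_sym_skew => //.
  by rewrite !trmx_mul trmxK kappa_inv_tr mulmxA.
rewrite /kappa_deriv wedge_mxZ -scalemxAl mxtraceZ mulmxDl raddfD /=.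
have -> : \tr (W gam *m (- eps *: W (om *m gam))^T *m K gam) =
   \tr (- eps *: W (om *m gam) *m (W gam)^T *m K gam).
  by rewrite -[LHS]mxtrace_tr !trmx_mul trmxK kappa_inv_tr mxtrace_mulC.
rewrite -!scalemxAl mxtraceZ -(mulmxA (W (om *m gam))).
rewrite [X in _ = 1 / 2 * (D * (- eps * X + - eps * X))]mxtrace_mulC.
by set z := \tr _; field.
Qed.

(** Derivative of the reduced field on [(z, vecso xi)], the variations of [gam] and [k], with the
    variation of [om] eliminated. The [gam] block comes first so that the radial vector is
    [(gam, 0)]. *)
Definition reduced_lin (eps : R) (gam : 'cV[R]_n) (k om : 'M[R]_n) : 'M[R]_(n + d) :=
  block_mx
    (- eps *: (om - D *: ((W gam)^T *m K gam *m kappa_slope gam gam om)))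
    (- eps *: ((W gam)^T *m K gam))
    (- (D *: (opmx (brk k) *m K gam *m kappa_slope gam gam om)))
    (opmx (fun X => brk X om) + opmx (brk k) *m K gam).

(** Adds the variation [eta = g^-1 dg]. It drives neither of the others, so its block column holds
    only a commutator, of trace zero. *)
Definition rolling_lin (eps : R) (gam : 'cV[R]_n) (k om : 'M[R]_n) :
    'M[R]_(n + (d + d)) :=
  let A := reduced_lin eps gam k om in
  block_mx (ulsubmx A) (row_mx (ursubmx A) 0)
    (col_mx (dlsubmx A) (- (D *: (K gam *m kappa_slope gam gam om))))
    (block_mx (drsubmx A) 0 (K gam) (opmx (fun X => brk X om))).

Lemma mxtrace_reduced_lin eps gam (k om : 'M[R]_n) : so om ->
  \tr (reduced_lin eps gam k om) =
  1 / 2 * \tr (kappa_deriv gam (- eps *: (om *m gam)) *m K gam).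
Proof.
move=> Hom; rewrite mxtrace_block mxtrace_zz // raddfD /= mxtrace_brkl.
by rewrite (mxtrace_sym_skew (kappa_inv_tr gam) (opmx_brk_skew k)) !addr0.
Qed.

Lemma mxtrace_rolling_lin eps gam k om : so om ->
  \tr (rolling_lin eps gam k om) =
  1 / 2 * \tr (kappa_deriv gam (- eps *: (om *m gam)) *m K gam).
Proof.
move=> Hom; rewrite !mxtrace_block mxtrace_brkl addr0.
rewrite -(mxtrace_reduced_lin _ _ k Hom) -[in RHS](submxK (reduced_lin _ _ _ _)).
by rewrite mxtrace_block.
Qed.

(** The variation of [om] caused by those of [k] and [gam]. Two base points are kept so that the
    same formula also gives exact differences. *)
Definition lin_omega (gam gam0 : 'cV[R]_n) (om0 xi : 'M[R]_n) (z : 'cV[R]_n) : 'M[R]_n :=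
  matso (K gam *m (vecso xi - D *: (kappa_slope gam gam0 om0 *m z))).

Lemma reduced_linE eps gam k om xi z : so k -> so om -> so xi ->
  let dom := lin_omega gam gam om xi z in
  reduced_lin eps gam k om *m col_mx z (vecso xi) =
  col_mx (- eps *: (om *m z + dom *m gam)) (vecso (brk xi om + brk k dom)).
Proof.
move=> Hk Hom Hxi dom; have Hdom : so dom by exact: so_matso.
have linl : so_linear (fun X => brk X om) by move=> a X Y _ _; exact: brk_linear_l.
have linr : so_linear (brk k) by move=> a X Y _ _; exact: brk_linear_r.
rewrite mul_block_col vecsoD (opmxE linl) // (opmxE linr) // matsoK.
rewrite -(tr_wedge_mx gam Hdom) matsoK.
move: (kappa_slope gam gam om) => S; congr col_mx.
  rewrite -!scalemxAl -scalerDr; congr (_ *: _).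
  rewrite mulmxBl -!scalemxAl !mulmxBr -!scalemxAr -!mulmxA.
  by rewrite -addrA [X in _ + X = _]addrC.
rewrite mulmxDl mulNmx -!scalemxAl !mulmxBr -!scalemxAr -!mulmxA.
by rewrite addrCA [X in _ + X = _]addrC.
Qed.

Lemma rolling_linE eps gam k om xi z eta : so k -> so om -> so xi -> so eta ->
  let dom := lin_omega gam gam om xi z in
  rolling_lin eps gam k om *m col_mx z (col_mx (vecso xi) (vecso eta)) =
  col_mx (- eps *: (om *m z + dom *m gam))
    (col_mx (vecso (brk xi om + brk k dom)) (vecso (brk eta om + dom))).
Proof.
move=> Hk Hom Hxi Heta dom.
have := reduced_linE eps gam z Hk Hom Hxi; rewrite -/dom.
rewrite -{1}[reduced_lin _ _ _ _]submxK mul_block_col => /eq_col_mx [Ez Exi].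
have linl : so_linear (fun X => brk X om) by move=> a X Y _ _; exact: brk_linear_l.
rewrite /rolling_lin /= mul_block_col mul_row_col mul0mx addr0 Ez; congr col_mx.
rewrite mul_col_mx mul_block_col mul0mx addr0 add_col_mx Exi; congr col_mx.
rewrite vecsoD (opmxE linl) // matsoK addrC -addrA addrCA.
move: (kappa_slope gam gam om) => S; congr (_ + _).
by rewrite mulNmx -!scalemxAl mulmxBr -scalemxAr -mulmxA.
Qed.

End Kappa.

(** * Linearization of the rolling flow *)

(* The bounds on the linearized field need no explicit constants: [tame] is
   stable under sums, products and bounded inverses. *)
Section Tame.
Variables (R : realType) (Q U : Type) (S : Q -> Prop) (dist : Q -> Q -> R).
Hypothesis dist_ge0 : forall q q', 0 <= dist q q'.

(** [q] stands for the points at which coefficients are evaluated and [u] for the vector acted on;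
    [w] is 1 for coefficients and the length of [u] for terms linear in [u]. *)
Definition tame (w : U -> R) m n (F : Q -> U -> 'M[R]_(m, n)) : Prop :=
  exists2 C : R, 0 <= C & forall q u i j, S q ->
    `|F q u i j| <= C * w u /\
    forall q', S q' -> `|F q u i j - F q' u i j| <= C * dist q q' * w u.

Definition weight1 (u : U) : R := 1.

Lemma tame_ext w m n (F G : Q -> U -> 'M[R]_(m, n)) :
  (forall q u, S q -> F q u = G q u) -> tame w F -> tame w G.
Proof.
move=> E [C C0 H]; exists C => // q u i j Sq; rewrite -E //.
have [H1 H2] := H q u i j Sq; split => // q' Sq'; rewrite -E //; exact: H2.
Qed.

Lemma tame_cst m n (A : 'M[R]_(m, n)) : tame weight1 (fun _ _ => A).
Proof.
exists (\sum_i \sum_j `|A i j|).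
  by apply: sumr_ge0 => i _; apply: sumr_ge0.
move=> q u i j Sq; rewrite /weight1 mulr1; split.
  rewrite (bigD1 i) //= (bigD1 j) //= -addrA lerDl addr_ge0 //.
    by apply: sumr_ge0.
  by apply: sumr_ge0 => k _; apply: sumr_ge0.
move=> q' Sq'; rewrite subrr normr0 mulr1 mulr_ge0 //.
by apply: sumr_ge0 => k _; apply: sumr_ge0.
Qed.

Lemma tameD w m n (F G : Q -> U -> 'M[R]_(m, n)) :
  tame w F -> tame w G -> tame w (fun q u => F q u + G q u).
Proof.
move=> [C C0 HF] [C' C0' HG]; exists (C + C'); first exact: addr_ge0.
move=> q u i j Sq; have [F1 F2] := HF q u i j Sq; have [G1 G2] := HG q u i j Sq.
rewrite !mxE; split; first by rewrite mulrDl (le_trans (ler_normD _ _)) // lerD.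
move=> q' Sq'; rewrite mxE opprD addrACA 2!mulrDl.
by rewrite (le_trans (ler_normD _ _)) // lerD ?F2 ?G2.
Qed.

Lemma tameM w w' m n p (F : Q -> U -> 'M[R]_(m, n)) (G : Q -> U -> 'M[R]_(n, p)) :
  (forall u, 0 <= w u) -> (forall u, 0 <= w' u) ->
  tame w F -> tame w' G -> tame (fun u => w u * w' u) (fun q u => F q u *m G q u).
Proof.
move=> w0 w0' [C C0 HF] [C' C0' HG]; exists (2 * n%:R * C * C').
  by rewrite !mulr_ge0.
move=> q u i j Sq /=; split.
  rewrite mxE; apply: (le_trans (ler_norm_sum _ _ _)).
  apply: (@le_trans _ _ (\sum_(k < n) (C * w u) * (C' * w' u))).
    apply: ler_sum => k _; rewrite normrM; apply: ler_pM => //.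
      by case: (HF q u i k Sq).
    by case: (HG q u k j Sq).
  rewrite sumr_const card_ord -[X in X <= _]mulr_natl.
  have -> : 2 * n%:R * C * C' * (w u * w' u) =
    n%:R * (C * w u * (C' * w' u)) + n%:R * (C * w u * (C' * w' u)) by ring.
  by rewrite lerDl !mulr_ge0.
move=> q' Sq'; rewrite !mxE -sumrB; apply: (le_trans (ler_norm_sum _ _ _)).
apply: (@le_trans _ _ (\sum_(k < n) (2 * C * C' * dist q q' * (w u * w' u)))).
  apply: ler_sum => k _.
  have [F1 F2] := HF q u i k Sq; have [G1 G2] := HG q' u k j Sq'.
  have [_ G3] := HG q u k j Sq.
  have -> : F q u i k * G q u k j - F q' u i k * G q' u k j =
    (F q u i k - F q' u i k) * G q' u k j + F q u i k * (G q u k j - G q' u k j).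
    by ring.
  have -> : 2 * C * C' * dist q q' * (w u * w' u) =
    (C * dist q q' * w u) * (C' * w' u) + (C * w u) * (C' * dist q q' * w' u) by ring.
  apply: (le_trans (ler_normD _ _)); rewrite !normrM; apply: lerD.
    by apply: ler_pM => //; exact: F2.
  by apply: ler_pM => //; exact: G3.
rewrite sumr_const card_ord -[X in X <= _]mulr_natl le_eqVlt; apply/orP; left; apply/eqP; ring.
Qed.

Lemma tame_mull w m n p (F : Q -> U -> 'M[R]_(m, n)) (G : Q -> U -> 'M[R]_(n, p)) :
  (forall u, 0 <= w u) -> tame weight1 F -> tame w G -> tame w (fun q u => F q u *m G q u).
Proof.
move=> w0 HF HG; have [C C0 H] := tameM (fun=> ler01) w0 HF HG.
by exists C => // q u i j Sq; have := H q u i j Sq; rewrite /weight1 !mul1r.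
Qed.

Lemma tame_mulr w m n p (F : Q -> U -> 'M[R]_(m, n)) (G : Q -> U -> 'M[R]_(n, p)) :
  (forall u, 0 <= w u) -> tame w F -> tame weight1 G -> tame w (fun q u => F q u *m G q u).
Proof.
move=> w0 HF HG; have [C C0 H] := tameM w0 (fun=> ler01) HF HG.
by exists C => // q u i j Sq; have := H q u i j Sq; rewrite /weight1 !mulr1.
Qed.

Lemma tameZ w m n (a : R) (F : Q -> U -> 'M[R]_(m, n)) :
  (forall u, 0 <= w u) -> tame w F -> tame w (fun q u => a *: F q u).
Proof.
move=> w0 HF; apply: tame_ext (tame_mull w0 (tame_cst a%:M) HF) => q u _ /=.
by rewrite mul_scalar_mx.
Qed.

Lemma tameB w m n (F G : Q -> U -> 'M[R]_(m, n)) : (forall u, 0 <= w u) ->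
  tame w F -> tame w G -> tame w (fun q u => F q u - G q u).
Proof.
move=> w0 HF HG; apply: tame_ext (tameD HF (tameZ (-1) w0 HG)) => q u _ /=.
by rewrite scaleN1r.
Qed.

Lemma tame_tr w m n (F : Q -> U -> 'M[R]_(m, n)) :
  tame w F -> tame w (fun q u => (F q u)^T).
Proof.
move=> [C C0 H]; exists C => // q u i j Sq; rewrite mxE; have [H1 H2] := H q u j i Sq.
by split=> // q' Sq'; rewrite mxE; exact: H2.
Qed.

Lemma tame_linear w m n p r (L : 'M[R]_(m, n) -> 'M[R]_(p, r))
    (F : Q -> U -> 'M[R]_(m, n)) :
  (forall (a : R) x y, L (a *: x + y) = a *: L x + L y) ->
  (forall u, 0 <= w u) -> tame w F -> tame w (fun q u => L (F q u)).
Proof.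
move=> HL w0 HF.
have L0 : L 0 = 0.
  by have := HL 1 0 0; rewrite !scale1r addr0 => h; apply: (addrI (L 0)); rewrite -h addr0.
have LD x y : L (x + y) = L x + L y by rewrite -[x]scale1r HL !scale1r.
have LZ a x : L (a *: x) = a *: L x by rewrite -[_ *: _]addr0 HL L0 addr0.
have E x i j : L x i j = \sum_(kl : 'I_m * 'I_n) x kl.1 kl.2 * L (delta_mx kl.1 kl.2) i j.
  rewrite {1}[x]matrix_sum_delta pair_bigA (big_morph L LD L0) summxE.
  by apply: eq_bigr => kl _; rewrite LZ mxE.
have [C C0 H] := HF.
pose B := \sum_i \sum_j \sum_(kl : 'I_m * 'I_n) `|L (delta_mx kl.1 kl.2) i j|.
have B0 : 0 <= B by do 3!apply: sumr_ge0 => ? _.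
have BE i j : \sum_(kl : 'I_m * 'I_n) `|L (delta_mx kl.1 kl.2) i j| <= B.
  rewrite /B (bigD1 i) //= (bigD1 j) //= -addrA lerDl addr_ge0 //.
    by do 2!apply: sumr_ge0 => ? _.
  by do 3!apply: sumr_ge0 => ? _.
exists (C * B); first exact: mulr_ge0.
move=> q u i j Sq; split.
  rewrite E; apply: (le_trans (ler_norm_sum _ _ _)).
  rewrite mulrAC; apply: le_trans (ler_wpM2l _ (BE i j)); last exact: mulr_ge0.
  rewrite mulr_sumr; apply: ler_sum => kl _; rewrite normrM ler_wpM2r //.
  by case: (H q u kl.1 kl.2 Sq).
move=> q' Sq'; rewrite !E -sumrB; apply: (le_trans (ler_norm_sum _ _ _)).
have -> : C * B * dist q q' * w u = C * dist q q' * w u * B by ring.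
apply: le_trans (ler_wpM2l _ (BE i j)); last by rewrite !mulr_ge0.
rewrite mulr_sumr; apply: ler_sum => kl _; rewrite -mulrBl normrM ler_wpM2r //.
by case: (H q u kl.1 kl.2 Sq) => _; apply.
Qed.

(** By the resolvent identity [F^-1 - F'^-1 = F^-1 (F' - F) F'^-1], a uniform bound on the inverses
    carries the Lipschitz bound over. *)
Lemma tame_inv m (F : Q -> U -> 'M[R]_m) (B : R) : 0 <= B ->
  (forall q u, S q -> F q u \in unitmx) ->
  (forall q u i j, S q -> `|invmx (F q u) i j| <= B) ->
  tame weight1 F -> tame weight1 (fun q u => invmx (F q u)).
Proof.
move=> B0 HU HB [C C0 H].
pose bound := m%:R * (m%:R * (B * C)) * B.
have b0 : 0 <= bound by rewrite !mulr_ge0.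
exists (B + bound); first exact: addr_ge0.
move=> q u i j Sq; rewrite /weight1 mulr1; split; first by rewrite ler_wpDr // HB.
move=> q' Sq'; rewrite mulr1.
have -> : invmx (F q u) i j - invmx (F q' u) i j =
    (invmx (F q u) *m (F q' u - F q u) *m invmx (F q' u)) i j.
  by rewrite mulmxBr mulVmx ?HU // mulmxBl mul1mx mulmxK ?HU // !mxE.
apply: (@le_trans _ _ (bound * dist q q')); last first.
  by rewrite ler_wpM2r // lerDr.
rewrite mxE; apply: (le_trans (ler_norm_sum _ _ _)).
have -> : bound * dist q q' = \sum_(k < m) (m%:R * (B * C * dist q q') * B).
  rewrite sumr_const card_ord -[RHS]mulr_natl /bound; ring.
apply: ler_sum => k _; rewrite normrM; apply: ler_pM => //; last exact: HB.
rewrite mxE; apply: (le_trans (ler_norm_sum _ _ _)).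
have -> : m%:R * (B * C * dist q q') = \sum_(l < m) (B * (C * dist q q')).
  rewrite sumr_const card_ord -[RHS]mulr_natl; ring.
apply: ler_sum => l _; rewrite normrM; apply: ler_pM => //; first exact: HB.
have [_ H2] := H q u l k Sq; have := H2 q' Sq'.
by rewrite /weight1 mulr1 !mxE distrC.
Qed.

End Tame.

Section CoordinateSystems.
Variable R : realType.

Definition coord_mx m n (ij : 'I_m * 'I_n) (M : 'M[R]_(m, n)) : R := M ij.1 ij.2.

Lemma coordinates_mx m n : coordinates (@coord_mx m n).
Proof.
split.
- by move=> [i j] a u v; rewrite /coord_mx !mxE.
- by move=> u v H; apply/matrixP => i j; exact: (H (i, j)).
- move=> c; exists (\matrix_(i, j) c (i, j)) => -[i j].
  by rewrite /coord_mx mxE.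
- move=> f t df; split=> [/is_derive_mx H [i j]|H]; first exact: H.
  by apply/is_derive_mx => i j; exact: (H (i, j)).
Qed.

Definition coord_pair (T1 T2 : finType) (V W : Type) (e1 : T1 -> V -> R)
    (e2 : T2 -> W -> R) (i : T1 + T2) (p : V * W) : R :=
  match i with inl i => e1 i p.1 | inr i => e2 i p.2 end.

Lemma coordinates_pair (T1 T2 : finType) (V W : normedModType R)
    (e1 : T1 -> V -> R) (e2 : T2 -> W -> R) :
  coordinates e1 -> coordinates e2 -> coordinates (coord_pair e1 e2).
Proof.
move=> H1 H2; split.
- by case=> i a u v /=; [exact: coordP H1 _ _ _ _|exact: coordP H2 _ _ _ _].
- move=> [u1 u2] [v1 v2] H; congr (_, _).
    by apply: (coord_inj H1) => i; exact: (H (inl i)).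
  by apply: (coord_inj H2) => i; exact: (H (inr i)).
- move=> c; have [u1 E1] := coord_ex H1 (c \o inl).
  have [u2 E2] := coord_ex H2 (c \o inr).
  by exists (u1, u2); case.
- move=> f t df; split.
    move=> /is_derive_pair [/(coord_derive H1) D1 /(coord_derive H2) D2].
    by case.
  move=> H; apply/is_derive_pair; split.
    by apply/(coord_derive H1) => i; exact: (H (inl i)).
  by apply/(coord_derive H2) => i; exact: (H (inr i)).
Qed.

End CoordinateSystems.

Section TameLinearization.
Variables (R : realType) (E : normedModType R) (T : finType) (e : T -> E -> R).
Variables (S : set E) (A : E -> E -> E -> E).

Definition pair_dist (q q' : E * E) : R :=
  Num.sqrt (sqn e (q.1 - q'.1) + sqn e (q.2 - q'.2)).

Definition in_both (q : E * E) : Prop := S q.1 /\ S q.2.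

Definition weight (u : E) : R := Num.sqrt (sqn e u).

Lemma pair_dist_ge0 q q' : 0 <= pair_dist q q'. Proof. exact: sqrtr_ge0. Qed.

Lemma weight_ge0 u : 0 <= weight u. Proof. exact: sqrtr_ge0. Qed.

(** Passage from bounds linear in lengths, one per coordinate, to the squared Euclidean bounds of
    [linearized_flow]: the constants [C i] are squared and summed. *)
Lemma tame_lin_bounds :
  (forall i, tame in_both pair_dist weight
     (fun q u => (e i (A q.1 q.2 u))%:M : 'M[R]_1)) ->
  exists L, [/\ 0 <= L,
    forall p q u, S p -> S q -> sqn e (A p q u) <= L * sqn e u &
    (forall i u v, e i (u - v) = e i u - e i v) ->
    forall p q p' q' u, S p -> S q -> S p' -> S q' ->
    sqn e (A p q u - A p' q' u) <=
    L * (sqn e (p - p') + sqn e (q - q')) * sqn e u].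
Proof.
move=> H; pose C i := s2val (cid2 (H i)).
have C0 i : 0 <= C i by rewrite /C; case: cid2.
have HC i q u : in_both q -> `|e i (A q.1 q.2 u)| <= C i * weight u /\
   forall q', in_both q' -> `|e i (A q.1 q.2 u) - e i (A q'.1 q'.2 u)| <=
    C i * pair_dist q q' * weight u.
  rewrite /C; case: cid2 => c /= c0 h Hq; have [h1 h2] := h q u 0 0 Hq.
  rewrite mxE mulr1n in h1; split => // q' Hq'; have := h2 q' Hq'.
  by rewrite !mxE !mulr1n.
have sqE u : weight u ^+ 2 = sqn e u by rewrite sqr_sqrtr // sqn_ge0.
have dE q q' : pair_dist q q' ^+ 2 = sqn e (q.1 - q'.1) + sqn e (q.2 - q'.2).
  by rewrite sqr_sqrtr // addr_ge0 // sqn_ge0.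
exists (\sum_i C i ^+ 2); split.
- by apply: sumr_ge0 => i _; exact: sqr_ge0.
- move=> p q u Sp Sq; rewrite -(sqE u) mulr_suml /sqn; apply: ler_sum => i _.
  have [h _] := HC i (p, q) u (conj Sp Sq).
  rewrite -[X in X <= _]ger0_norm ?sqr_ge0 // normrX -exprMn ler_sqr ?nnegrE //.
  by rewrite mulr_ge0 ?weight_ge0.
- move=> eB p q p' q' u Sp Sq Sp' Sq'.
  have /= <- := dE (p, q) (p', q').
  rewrite -(sqE u) !mulr_suml /sqn; apply: ler_sum => i _; rewrite eB.
  have [_ h] := HC i (p, q) u (conj Sp Sq).
  rewrite -[X in X <= _]ger0_norm ?sqr_ge0 // normrX -!exprMn ler_sqr ?nnegrE //.
    by apply: (h (p', q')).
  by rewrite !mulr_ge0 ?weight_ge0 ?pair_dist_ge0.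
Qed.

End TameLinearization.

Section TameRolling.
Variables (R : realType) (n : nat) (I : 'M[R]_n -> 'M[R]_n) (D : R).
Hypotheses (HI : inertia_tensor I) (D0 : 0 < D).
Variables (Q U : Type) (S : Q -> Prop) (dist : Q -> Q -> R).
Hypothesis dist_ge0 : forall q q', 0 <= dist q q'.
Variable w : U -> R.
Hypothesis w_ge0 : forall u, 0 <= w u.

Local Notation tame := (tame S dist).
Local Notation weight1 := (@weight1 R U).

Let weight1_ge0 u : 0 <= weight1 u. Proof. exact: ler01. Qed.

Lemma vecso_linear (a : R) (X Y : 'M[R]_n) : vecso (a *: X + Y) = a *: vecso X + vecso Y.
Proof. by rewrite vecsoD vecsoZ. Qed.

Lemma matso_linear (a : R) (x y : 'cV[R]_(dim_so n)) :
  matso (a *: x + y) = a *: matso x + matso y.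
Proof. by rewrite matsoD matsoZ. Qed.

Lemma wedge_mx_linear (a : R) (x y : 'cV[R]_n) :
  wedge_mx (a *: x + y) = a *: wedge_mx x + wedge_mx y.
Proof. by rewrite wedge_mxD wedge_mxZ. Qed.

Lemma tame_kappa_inv (gam : Q -> U -> 'cV[R]_n) :
  tame weight1 gam -> tame weight1 (fun q u => kappa_inv I D (gam q u)).
Proof.
move=> Hg; have HW := tame_linear dist_ge0 wedge_mx_linear weight1_ge0 Hg.
have [C HC] := kappa_inv_bounded HI D0.
apply: (@tame_inv _ _ _ _ _ dist_ge0 _ _ `|C|) => //.
- by move=> q u _; exact: kappa_unit.
- by move=> q u i j _; apply: le_trans (HC _ _ _) (ler_norm _).
apply: tame_ext (_ : tame weight1 (fun q u => opmx I +
   D *: (wedge_mx (gam q u) *m (wedge_mx (gam q u))^T))).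
  by move=> q u _; rewrite kappa_mxE.
apply: tameD; first exact: tame_cst.
by apply: tameZ => //; apply: tame_mull => //; exact: tame_tr.
Qed.

Lemma tame_kappa_slope (gam gam0 : Q -> U -> 'cV[R]_n) (om0 : Q -> U -> 'M[R]_n) :
  tame weight1 gam -> tame weight1 gam0 -> tame weight1 om0 ->
  tame weight1 (fun q u => kappa_slope (gam q u) (gam0 q u) (om0 q u)).
Proof.
move=> Hg Hg0 Hom; apply: tameB => //; first apply: tame_mull => //.
  exact: (tame_linear dist_ge0 wedge_mx_linear).
apply: (tame_linear dist_ge0 wedge_mx_linear) => //; exact: tame_mull.
Qed.

Lemma tame_lin_omega (gam gam0 : Q -> U -> 'cV[R]_n) (om0 xi : Q -> U -> 'M[R]_n)
    (z : Q -> U -> 'cV[R]_n) :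
  tame weight1 gam -> tame weight1 gam0 -> tame weight1 om0 -> tame w xi -> tame w z ->
  tame w (fun q u => lin_omega I D (gam q u) (gam0 q u) (om0 q u) (xi q u) (z q u)).
Proof.
move=> Hg Hg0 Hom Hxi Hz; apply: (tame_linear dist_ge0 matso_linear) => //.
apply: tame_mull => //; first exact: tame_kappa_inv.
apply: tameB => //; first exact: (tame_linear dist_ge0 vecso_linear).
apply: tameZ => //; apply: tame_mull => //; exact: tame_kappa_slope.
Qed.

Lemma tame_brkr (X Y : Q -> U -> 'M[R]_n) :
  tame weight1 X -> tame w Y -> tame w (fun q u => brk (X q u) (Y q u)).
Proof.
by move=> HX HY; apply: tameB => //; [exact: tame_mull|exact: tame_mulr].
Qed.

Lemma tame_brkl (X Y : Q -> U -> 'M[R]_n) :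
  tame w X -> tame weight1 Y -> tame w (fun q u => brk (X q u) (Y q u)).
Proof.
by move=> HX HY; apply: tameB => //; [exact: tame_mulr|exact: tame_mull].
Qed.

(** The inverse Legendre map. *)
Definition omega_of (k : 'M[R]_n) (gam : 'cV[R]_n) : 'M[R]_n :=
  matso (kappa_inv I D gam *m vecso k).

Lemma tame_omega_of (k : Q -> U -> 'M[R]_n) (gam : Q -> U -> 'cV[R]_n) :
  tame weight1 k -> tame weight1 gam -> tame weight1 (fun q u => omega_of (k q u) (gam q u)).
Proof.
move=> Hk Hg; apply: (tame_linear dist_ge0 matso_linear) => //.
apply: tame_mull => //; first exact: tame_kappa_inv.
exact: (tame_linear dist_ge0 vecso_linear).
Qed.

Lemma so_omega_of k gam : so (omega_of k gam).
Proof. exact: so_matso. Qed.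

Lemma omega_ofP k gam om : so om -> k = kappa I D gam om -> om = omega_of k gam.
Proof.
by move=> Hom Hk; rewrite /omega_of -(kappa_invP HI D0 Hom Hk) vecsoK.
Qed.

Lemma kappa_omega_of k gam : so k -> k = kappa I D gam (omega_of k gam).
Proof.
move=> Hk; apply: vecso_inj => //; first by apply: so_kappa => //; exact: so_omega_of.
rewrite vecso_kappa //; last exact: so_omega_of.
by rewrite matsoK mulKVmx //; exact: kappa_unit.
Qed.

Lemma lin_omega_linear gam gam0 om0 (a : R) xi xi' z z' :
  lin_omega I D gam gam0 om0 (a *: xi + xi') (a *: z + z') =
  a *: lin_omega I D gam gam0 om0 xi z + lin_omega I D gam gam0 om0 xi' z'.
Proof.
rewrite /lin_omega -matso_linear; congr matso; rewrite (scalemxAr a) -mulmxDr.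
congr (_ *m _); rewrite vecso_linear mulmxDr -!scalemxAr scalerBr scalerDr.
by rewrite !scalerA (mulrC D) opprD addrACA.
Qed.

Lemma lin_omegaB k k0 gam gam0 : so k -> so k0 ->
  lin_omega I D gam gam0 (omega_of k0 gam0) (k - k0) (gam - gam0) =
  omega_of k gam - omega_of k0 gam0.
Proof.
move=> Hk Hk0; rewrite /lin_omega.
rewrite -(omegaB HI D0 (so_omega_of k gam) (so_omega_of k0 gam0)
   (kappa_omega_of gam Hk) (kappa_omega_of gam0 Hk0)) vecsoK //.
by apply: soD; [exact: so_omega_of|apply: soN; exact: so_omega_of].
Qed.

End TameRolling.

Section TameProjections.
Variables (R : realType) (E : normedModType R) (T : finType) (e : T -> E -> R).
Hypothesis He : coordinates e.
Variable S : set E.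

Local Notation tame := (tame (in_both S) (pair_dist e)).

Lemma coord_weight i u : `|e i u| <= weight e u.
Proof.
rewrite -ler_sqr ?nnegrE ?weight_ge0 // sqr_sqrtr ?sqn_ge0 //.
by rewrite -normrX ger0_norm ?sqr_ge0 // coord_le_sqn.
Qed.

Lemma tame_param m n (F : E -> 'M[R]_(m, n)) (B : R) :
  (forall i j, exists k, forall p, F p i j = e k p) ->
  (forall p i j, S p -> `|F p i j| <= B) ->
  tame (@weight1 R E) (fun q _ => F q.1) /\ tame (@weight1 R E) (fun q _ => F q.2).
Proof.
move=> HF HB.
suff H (pr : E * E -> E) : (forall q, in_both S q -> S (pr q)) ->
    (forall q q', sqn e (pr q - pr q') <= sqn e (q.1 - q'.1) + sqn e (q.2 - q'.2)) ->
    tame (@weight1 R E) (fun q _ => F (pr q)).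
  split; apply: H => [q []//|q q']; first by rewrite lerDl sqn_ge0.
  by rewrite lerDr sqn_ge0.
move=> Hdom Hpr; exists (`|B| + 1); first by rewrite addr_ge0.
move=> q u i j Sq; rewrite /weight1 mulr1; split.
  apply: (le_trans (HB _ _ _ (Hdom _ Sq))).
  by rewrite (le_trans (ler_norm _)) // lerDl.
move=> q' _; rewrite mulr1; have [k Hk] := HF i j; rewrite !Hk -(coordB He).
apply: (le_trans (coord_weight _ _)); apply: (@le_trans _ _ (pair_dist e q q')).
  by rewrite ler_sqrt ?addr_ge0 ?sqn_ge0.
by rewrite ler_peMl ?pair_dist_ge0 // lerDr.
Qed.

Lemma tame_vector m n (F : E -> 'M[R]_(m, n)) :
  (forall i j, exists k, forall p, F p i j = e k p) ->
  tame (weight e) (fun _ u => F u).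
Proof.
move=> HF; exists 1 => // q u i j _; have [k Hk] := HF i j; split.
  by rewrite mul1r Hk coord_weight.
by move=> q' _; rewrite subrr normr0 mul1r mulr_ge0 ?pair_dist_ge0 ?weight_ge0.
Qed.

Lemma tame_entry (w : E -> R) m n (F : E * E -> E -> 'M[R]_(m, n)) i j :
  tame w F -> tame w (fun q u => (F q u i j)%:M : 'M[R]_1).
Proof.
move=> [C C0 H]; exists C => // q u k l Hq; have [H1 H2] := H q u i j Hq.
rewrite !ord1 mxE mulr1n; split => // q' Hq'; rewrite mxE mulr1n; exact: H2.
Qed.

End TameProjections.

Section RollingBounds.
Variables (R : realType) (n : nat).

(** Twice [<k, k>] is the sum of the squared entries; [2 y <= y^2 + 1] then avoids a square root in
    the bound. *)
Lemma so_entry_bound (k : 'M[R]_n) B i j : so k -> so_dot k k <= B -> `|k i j| <= 2 * B + 1.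
Proof.
move=> Hk HB.
have H : k i j ^+ 2 <= 2 * B.
  apply: (@le_trans _ _ (2 * so_dot k k)); last by rewrite ler_pM2l.
  have -> : 2 * so_dot k k = \tr (k^T *m k) by rewrite Hk mulNmx raddfN /so_dot /=; field.
  rewrite /mxtrace (bigD1 j) //= mxE (bigD1 i) //= mxE -expr2 -addrA lerDl.
  rewrite addr_ge0 //; apply: sumr_ge0 => l _; first by rewrite mxE -expr2 sqr_ge0.
  by rewrite mxE; apply: sumr_ge0 => r _; rewrite mxE -expr2 sqr_ge0.
have := sqr_ge0 (`|k i j| - 1); rewrite sqrrB -normrX ger0_norm ?sqr_ge0 // expr1n.
have := sqr_ge0 (k i j); move: H.
set z := k i j ^+ 2; set y := `|k i j|; rewrite mulr1; lra.
Qed.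

Lemma sphere_entry_bound (gam : 'cV[R]_n) i j : sphere gam -> `|gam i j| <= 1.
Proof.
rewrite /sphere /= dotvE ord1 => H.
rewrite -ler_sqr ?nnegrE // expr1n -normrX ger0_norm ?sqr_ge0 // -H.
by rewrite (bigD1 i) //= -expr2 lerDl; apply: sumr_ge0 => k _; rewrite -expr2 sqr_ge0.
Qed.

Lemma SO_entry_bound (g : 'M[R]_n) i j : SO g -> `|g i j| <= 1.
Proof.
move=> [H _]; rewrite -ler_sqr ?nnegrE // expr1n -normrX ger0_norm ?sqr_ge0 //.
have <- : (g^T *m g) j j = 1 by rewrite H mxE eqxx.
rewrite mxE (bigD1 i) //= mxE -expr2 lerDl; apply: sumr_ge0 => k _.
by rewrite mxE -expr2 sqr_ge0.
Qed.

End RollingBounds.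

Section RollingFlow.
Variables (R : realType) (n : nat) (I : 'M[R]_n -> 'M[R]_n) (D eps : R).
Hypotheses (HI : inertia_tensor I) (D0 : 0 < D).

Local Notation V2 := ('M[R]_n * 'cV[R]_n)%type.
Local Notation V3 := ('M[R]_n * 'M[R]_n * 'cV[R]_n)%type.

Definition reduced_coord := coord_pair (@coord_mx R n n) (@coord_mx R n 1).
Definition rolling_coord :=
  coord_pair (coord_pair (@coord_mx R n n) (@coord_mx R n n)) (@coord_mx R n 1).

Lemma reduced_coordinates : coordinates (reduced_coord : _ -> V2 -> R).
Proof. by apply: coordinates_pair; exact: coordinates_mx. Qed.

Lemma rolling_coordinates : coordinates (rolling_coord : _ -> V3 -> R).
Proof. by do 2?apply: coordinates_pair; exact: coordinates_mx. Qed.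

Local Notation om_of := (omega_of I D).

Definition reduced_vec (p : V2) : V2 :=
  let om := om_of p.1 p.2 in (brk p.1 om, - eps *: (om *m p.2)).

Definition rolling_vec (p : V3) : V3 :=
  let om := om_of p.1.1 p.2 in (brk p.1.1 om, p.1.2 *m om, - eps *: (om *m p.2)).

Lemma reduced_fieldE p v : reduced_field I D eps p v -> v = reduced_vec p.
Proof. by move=> [om [Hom Hk ->]]; rewrite /reduced_vec -(omega_ofP HI D0 Hom Hk). Qed.

Lemma rolling_fieldE p v : rolling_field I D eps p v -> v = rolling_vec p.
Proof. by move=> [om [Hom Hk ->]]; rewrite /rolling_vec -(omega_ofP HI D0 Hom Hk). Qed.

(* The field [X] satisfies [X p - X q = secant p q (p - q)], and [secant p p]
   is its derivative at [p]. *)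
Definition reduced_secant (p q u : V2) : V2 :=
  let om := om_of p.1 p.2 in
  let dom := lin_omega I D p.2 q.2 (om_of q.1 q.2) u.1 u.2 in
  (brk u.1 om + brk q.1 dom, - eps *: (om *m u.2 + dom *m q.2)).

Definition rolling_secant (p q u : V3) : V3 :=
  let om := om_of p.1.1 p.2 in
  let dom := lin_omega I D p.2 q.2 (om_of q.1.1 q.2) u.1.1 u.2 in
  (brk u.1.1 om + brk q.1.1 dom, u.1.2 *m om + q.1.2 *m dom,
   - eps *: (om *m u.2 + dom *m q.2)).

Lemma brkB (k k0 om om0 : 'M[R]_n) :
  brk k om - brk k0 om0 = brk (k - k0) om + brk k0 (om - om0).
Proof.
rewrite /brk !mulmxBl !mulmxBr !opprB.
set a := k *m om; set b := om *m k; set c := k0 *m om0; set r := om0 *m k0.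
set s := k0 *m om; set t := om *m k0.
apply/matrixP => i j; rewrite !mxE; ring.
Qed.

Lemma mulmx_subl m p q (a a0 : 'M[R]_(m, p)) (b b0 : 'M[R]_(p, q)) :
  a *m b - a0 *m b0 = (a - a0) *m b + a0 *m (b - b0).
Proof. by rewrite mulmxBl mulmxBr addrA subrK. Qed.

Lemma mulmx_subr m p q (a a0 : 'M[R]_(m, p)) (b b0 : 'M[R]_(p, q)) :
  a *m b - a0 *m b0 = a *m (b - b0) + (a - a0) *m b0.
Proof. by rewrite mulmxBl mulmxBr addrA subrK. Qed.

Lemma reduced_vecB p q : so p.1 -> so q.1 ->
  reduced_vec p - reduced_vec q = reduced_secant p q (p - q).
Proof.
move=> Hp Hq; rewrite /reduced_secant /= lin_omegaB //; congr (_, _); first exact: brkB.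
by rewrite -scalerBr mulmx_subr.
Qed.

Lemma rolling_vecB p q : so p.1.1 -> so q.1.1 ->
  rolling_vec p - rolling_vec q = rolling_secant p q (p - q).
Proof.
move=> Hp Hq; rewrite /rolling_secant /= lin_omegaB //; congr (_, _, _); first exact: brkB.
  exact: mulmx_subl.
by rewrite -scalerBr mulmx_subr.
Qed.

Lemma reduced_secant_linear p q (a : R) u v :
  reduced_secant p q (a *: u + v) = a *: reduced_secant p q u + reduced_secant p q v.
Proof.
rewrite {1}/reduced_secant /= (lin_omega_linear I D p.2 q.2 _ a); congr (_, _).
  rewrite -[RHS]/(a *: (reduced_secant p q u).1 + (reduced_secant p q v).1) /=.
  by rewrite brk_linear_l brk_linear_r addrACA -scalerDr.
rewrite -[RHS]/(a *: (reduced_secant p q u).2 + (reduced_secant p q v).2) /=.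
rewrite scalerA mulrC -scalerA -scalerDr; congr (_ *: _).
rewrite mulmxDr mulmxDl -scalemxAr -scalemxAl scalerDr.
by rewrite addrACA.
Qed.

Lemma rolling_secant_linear p q (a : R) u v :
  rolling_secant p q (a *: u + v) = a *: rolling_secant p q u + rolling_secant p q v.
Proof.
rewrite {1}/rolling_secant /= (lin_omega_linear I D p.2 q.2 _ a); congr (_, _, _).
- rewrite -[RHS]/(a *: (rolling_secant p q u).1.1 + (rolling_secant p q v).1.1) /=.
  by rewrite brk_linear_l brk_linear_r addrACA -scalerDr.
- rewrite -[RHS]/(a *: (rolling_secant p q u).1.2 + (rolling_secant p q v).1.2) /=.
  by rewrite mulmxDr mulmxDl -scalemxAr -scalemxAl scalerDr addrACA.
rewrite -[RHS]/(a *: (rolling_secant p q u).2 + (rolling_secant p q v).2) /=.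
rewrite scalerA mulrC -scalerA -scalerDr; congr (_ *: _).
rewrite mulmxDr mulmxDl -scalemxAr -scalemxAl scalerDr.
by rewrite addrACA.
Qed.

(** Sublevel rather than level sets: a curve through a point may change [<k, k>], yet has to stay
    inside near that point. *)
Definition reduced_level (B : R) : set V2 :=
  [set p | reduced_phase p /\ so_dot p.1 p.1 <= B].

Definition rolling_level (B : R) : set V3 :=
  [set p | phase p /\ so_dot p.1.1 p.1.1 <= B].

Local Notation reduced_tame B :=
  (tame (in_both (reduced_level B)) (pair_dist reduced_coord)).

Lemma reduced_secant_bounds B : exists L, [/\ 0 <= L,
    forall p q u, reduced_level B p -> reduced_level B q ->
      sqn reduced_coord (reduced_secant p q u) <= L * sqn reduced_coord u &
    (forall i u v, reduced_coord i (u - v) = reduced_coord i u - reduced_coord i v) ->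
    forall p q p' q' u, reduced_level B p -> reduced_level B q ->
      reduced_level B p' -> reduced_level B q' ->
    sqn reduced_coord (reduced_secant p q u - reduced_secant p' q' u) <=
    L * (sqn reduced_coord (p - p') + sqn reduced_coord (q - q')) * sqn reduced_coord u].
Proof.
have d0 := pair_dist_ge0 reduced_coord; have w0 := weight_ge0 reduced_coord.
have [k1 k2] : reduced_tame B (@weight1 R V2) (fun q _ => q.1.1)
    /\ reduced_tame B (@weight1 R V2) (fun q _ => q.2.1).
  apply: (tame_param reduced_coordinates (F := fst) (B := 2 * B + 1)).
    by move=> i j; exists (inl (i, j)).
  by move=> p i j [[Hk _] HB]; exact: so_entry_bound.
have [g1 g2] : reduced_tame B (@weight1 R V2) (fun q _ => q.1.2)
    /\ reduced_tame B (@weight1 R V2) (fun q _ => q.2.2).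
  apply: (tame_param reduced_coordinates (F := snd) (B := 1)).
    by move=> i j; exists (inr (i, j)).
  by move=> p i j [[_ Hg] _]; exact: sphere_entry_bound.
have xi : reduced_tame B (weight reduced_coord) (fun _ u => u.1).
  by apply: tame_vector => i j; exists (inl (i, j)).
have z : reduced_tame B (weight reduced_coord) (fun _ u => u.2).
  by apply: tame_vector => i j; exists (inr (i, j)).
have om1 := tame_omega_of HI D0 d0 k1 g1; have om2 := tame_omega_of HI D0 d0 k2 g2.
have dom := tame_lin_omega HI D0 d0 w0 g1 g2 om2 xi z.
apply: tame_lin_bounds; case=> -[i j].
  apply: (@tame_entry _ _ _ reduced_coord _ _ _ _ (fun q u => (reduced_secant q.1 q.2 u).1)).
  by apply: tameD; [exact: tame_brkl|exact: tame_brkr].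
apply: (@tame_entry _ _ _ reduced_coord _ _ _ _ (fun q u => (reduced_secant q.1 q.2 u).2)).
by apply: tameZ => //; apply: tameD; [exact: tame_mull|exact: tame_mulr].
Qed.

Local Notation rolling_tame B :=
  (tame (in_both (rolling_level B)) (pair_dist rolling_coord)).

Lemma rolling_secant_bounds B : exists L, [/\ 0 <= L,
    forall p q u, rolling_level B p -> rolling_level B q ->
      sqn rolling_coord (rolling_secant p q u) <= L * sqn rolling_coord u &
    (forall i u v, rolling_coord i (u - v) = rolling_coord i u - rolling_coord i v) ->
    forall p q p' q' u, rolling_level B p -> rolling_level B q ->
      rolling_level B p' -> rolling_level B q' ->
    sqn rolling_coord (rolling_secant p q u - rolling_secant p' q' u) <=
    L * (sqn rolling_coord (p - p') + sqn rolling_coord (q - q')) * sqn rolling_coord u].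
Proof.
have d0 := pair_dist_ge0 rolling_coord; have w0 := weight_ge0 rolling_coord.
have [k1 k2] : rolling_tame B (@weight1 R V3) (fun q _ => q.1.1.1)
    /\ rolling_tame B (@weight1 R V3) (fun q _ => q.2.1.1).
  apply: (tame_param rolling_coordinates (F := fun p => p.1.1) (B := 2 * B + 1)).
    by move=> i j; exists (inl (inl (i, j))).
  by move=> p i j [[Hk _ _] HB]; exact: so_entry_bound.
have [_ h2] : rolling_tame B (@weight1 R V3) (fun q _ => q.1.1.2)
    /\ rolling_tame B (@weight1 R V3) (fun q _ => q.2.1.2).
  apply: (tame_param rolling_coordinates (F := fun p => p.1.2) (B := 1)).
    by move=> i j; exists (inl (inr (i, j))).
  by move=> p i j [[_ Hg _] HB]; exact: SO_entry_bound.
have [g1 g2] : rolling_tame B (@weight1 R V3) (fun q _ => q.1.2)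
    /\ rolling_tame B (@weight1 R V3) (fun q _ => q.2.2).
  apply: (tame_param rolling_coordinates (F := snd) (B := 1)).
    by move=> i j; exists (inr (i, j)).
  by move=> p i j [[_ _ Hg] _]; exact: sphere_entry_bound.
have xi : rolling_tame B (weight rolling_coord) (fun _ u => u.1.1).
  by apply: tame_vector => i j; exists (inl (inl (i, j))).
have h : rolling_tame B (weight rolling_coord) (fun _ u => u.1.2).
  by apply: tame_vector => i j; exists (inl (inr (i, j))).
have z : rolling_tame B (weight rolling_coord) (fun _ u => u.2).
  by apply: tame_vector => i j; exists (inr (i, j)).
have om1 := tame_omega_of HI D0 d0 k1 g1; have om2 := tame_omega_of HI D0 d0 k2 g2.
have dom := tame_lin_omega HI D0 d0 w0 g1 g2 om2 xi z.
apply: tame_lin_bounds; case=> [[]|] [i j].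
- apply: (@tame_entry _ _ _ rolling_coord _ _ _ _ (fun q u => (rolling_secant q.1 q.2 u).1.1)).
  by apply: tameD; [exact: tame_brkl|exact: tame_brkr].
- apply: (@tame_entry _ _ _ rolling_coord _ _ _ _ (fun q u => (rolling_secant q.1 q.2 u).1.2)).
  by apply: tameD; [exact: tame_mulr|exact: tame_mull].
apply: (@tame_entry _ _ _ rolling_coord _ _ _ _ (fun q u => (rolling_secant q.1 q.2 u).2)).
by apply: tameZ => //; apply: tameD; [exact: tame_mull|exact: tame_mulr].
Qed.

Lemma is_derive_so_dot (k : R -> 'M[R]_n) (t : R) dk : is_derive t 1 k dk ->
  is_derive t 1 (fun s => so_dot (k s) (k s)) (2 * so_dot (k t) dk).
Proof.
move=> Hk.
have lin (a : R) (x y : 'M[R]_n) : (- (1 / 2) * \tr (a *: x + y))%:M =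
    a *: (- (1 / 2) * \tr x)%:M + (- (1 / 2) * \tr y)%:M :> 'M[R]_1.
  by rewrite -[in RHS]scalemx1 scalerA scalemx1 raddfD /= mxtraceZ mulrDr raddfD /= mulrCA.
have /is_derive_mx /(_ 0 0) := is_derive_linear lin (is_derive_mulmx Hk Hk).
rewrite mxE mulr1n; under eq_fun do rewrite mxE mulr1n.
move=> h; apply: (is_derive_eq h).
by rewrite raddfD /= mxtrace_mulC /so_dot; ring.
Qed.

(** The derivative is [2 <k, [k, om]> = 2 <[k, k], om> = 0]. *)
Lemma so_dot_conserved (k : R -> 'M[R]_n) (om : R -> 'M[R]_n) :
  (forall t : R, is_derive t 1 k (brk (k t) (om t))) ->
  forall s t, so_dot (k s) (k s) = so_dot (k t) (k t).
Proof.
move=> H s t; apply: (is_derive_0_is_cst (f := fun t => so_dot (k t) (k t))) => r.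
apply: (is_derive_eq (is_derive_so_dot (H r))).
by rewrite -so_dot_brk /brk subrr /so_dot mul0mx raddf0 !mulr0.
Qed.

End RollingFlow.

(** * From the variational equation to preservation of a form *)

Section FlowPreserves.
Variables (R : realType) (E : normedModType R) (T : finType) (e : T -> E -> R).
Hypothesis He : coordinates e.
Variables (M : set E) (phi : R -> E -> E) (A : E -> E -> E -> E).
Variables (k : nat) (alpha : dform E k).
Hypothesis phiM : forall x t, M x -> M (phi t x).
Hypothesis local_lin : forall x, M x -> exists S L,
  [/\ linearized_flow e S phi A L, S x &
    forall v c, curve_at M x v c -> \forall s \near (0 : R), S (c s)].
Hypothesis const : forall x, M x -> forall U : 'I_k -> R -> E,
  (forall i (t : R), is_derive t 1 (U i) (A (phi t x) (phi t x) (U i t))) ->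
  (forall i t, tangent M (phi t x) (U i t)) ->
  forall t, alpha (phi t x) (U ^~ t) = alpha (phi 0 x) (U ^~ 0).

Lemma flow_preserves_form t : preserves_form M alpha (phi t).
Proof.
move=> x Mx; have [S [L [HF Sx HS]]] := local_lin Mx.
(* The differential sends [v] to the value at time [t] of the solution starting from [v]. Uniqueness
   makes it independent of the curve; [xget] returns 0 when no solution starts from [v]. *)
pose P v w := exists U : R -> E, [/\ U 0 = v,
  forall r : R, is_derive r 1 U (A (phi r x) (phi r x) (U r)) & U t = w].
pose dF v := xget 0 (P v).
have dFE U : (forall r : R, is_derive r 1 U (A (phi r x) (phi r x) (U r))) ->
    dF (U 0) = U t.
  move=> HU; apply: xget_unique; first by exists U.
  by move=> w [U' [U0 HU' <-]]; exact: (variation_unique He HF Sx U0 HU' HU).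
have ex v c : curve_at M x v c -> exists U : R -> E,
    [/\ U 0 = v, forall r : R, is_derive r 1 U (A (phi r x) (phi r x) (U r)) &
     forall r, curve_at M (phi r x) (U r) (fun s => phi r (c s))].
  move=> Hc; have [Mc c0 dc] := Hc.
  have [U [U0 HU HUc]] := variation_exists He HF (HS _ _ Hc) c0 dc.
  exists U; split => // r; split => [s||]; [exact: phiM|by rewrite c0|exact: HUc].
exists dF.
  move=> v c /ex [U [<- HU HUc]]; rewrite dFE //.
  by have [_ _] := HUc t.
move=> v Hv; have /choice [U HU] : forall i, exists U : R -> E, [/\ U 0 = v i,
    forall r : R, is_derive r 1 U (A (phi r x) (phi r x) (U r)) &
    forall r, tangent M (phi r x) (U r)].
  move=> i; have [c /ex [U [U0 U1 U2]]] := Hv i; exists U; split => // r.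
  by exists (fun s => phi r (c s)).
have -> : dF \o v = U ^~ t.
  by apply/funext => i /=; have [<- H _] := HU i; exact: dFE.
have HU1 i (r : R) : is_derive r 1 (U i) (A (phi r x) (phi r x) (U i r)).
  by have [_ H _] := HU i; exact: H.
have HU2 i r : tangent M (phi r x) (U i r) by have [_ _ H] := HU i; exact: H.
rewrite (const Mx HU1 HU2).
rewrite (flow0 HF) //; congr alpha.
by apply/funext => i; have [-> _ _] := HU i.
Qed.

End FlowPreserves.

Section RollingLinearized.
Variables (R : realType) (n : nat) (I : 'M[R]_n -> 'M[R]_n) (D eps : R).
Hypotheses (HI : inertia_tensor I) (D0 : 0 < D).

Lemma near_so_dot (k : R -> 'M[R]_n) dk : is_derive (0 : R) 1 k dk ->
  \forall s \near (0 : R), so_dot (k s) (k s) <= so_dot (k 0) (k 0) + 1.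
Proof.
move=> /is_derive_so_dot /is_derive_cont /cvgrPdist_le /(_ _ ltr01) /= Hn; near=> s.
have : `|so_dot (k 0) (k 0) - so_dot (k s) (k s)| <= 1 by near: s; exact: Hn.
by rewrite distrC => /(le_trans (ler_norm _)); rewrite lerBlDl.
Unshelve. all: by end_near. Qed.

Section Reduced.
Variable phi : R -> 'M[R]_n * 'cV[R]_n -> 'M[R]_n * 'cV[R]_n.
Hypothesis Hphi : is_flow (@reduced_phase R n) (reduced_field I D eps) phi.

Lemma reduced_flow_phase x t : reduced_phase x -> reduced_phase (phi t x).
Proof. by move=> /Hphi [_ /(_ t) []]. Qed.

Lemma reduced_flow_derive x (t : R) : reduced_phase x ->
  is_derive t 1 (phi ^~ x) (reduced_vec I D eps (phi t x)).
Proof.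
by move=> /Hphi [_ /(_ t) [_ [v Hv]]]; rewrite (reduced_fieldE HI D0 Hv).
Qed.

Lemma reduced_linearized B : exists L,
  linearized_flow (@reduced_coord R n) (reduced_level B) phi (reduced_secant I D eps) L.
Proof.
have [L [L0 HL1 HL2]] := reduced_secant_bounds eps HI D0 B.
exists L; split => //.
- move=> x t [Hx HB]; split; first exact: reduced_flow_phase.
  have [x0 _] := Hphi Hx.
  rewrite (@so_dot_conserved _ _ (fun t => (phi t x).1)
    (fun t => omega_of I D (phi t x).1 (phi t x).2) _ t 0) ?x0 // => r.
  by have /is_derive_pair [] := reduced_flow_derive r Hx.
- by move=> x [/Hphi []].
- move=> x t [Hx _]; exists (reduced_vec I D eps (phi t x)).
  exact: reduced_flow_derive.
- move=> x y t [Hx _] [Hy _].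
  rewrite -reduced_vecB //; last 2 first.
  + by case: (reduced_flow_phase t Hx).
  + by case: (reduced_flow_phase t Hy).
  by apply: is_deriveB; exact: reduced_flow_derive.
- by move=> *; exact: reduced_secant_linear.
- by move=> *; apply: HL2 => // i u' v'; exact: (coordB (reduced_coordinates R n)).
Qed.

Lemma reduced_local_lin x : reduced_phase x -> exists S L,
  [/\ linearized_flow (@reduced_coord R n) S phi (reduced_secant I D eps) L, S x &
    forall v c, curve_at (@reduced_phase R n) x v c -> \forall s \near (0 : R), S (c s)].
Proof.
move=> Hx; have [L HL] := reduced_linearized (so_dot x.1 x.1 + 1).
exists (reduced_level (so_dot x.1 x.1 + 1)), L; split => //.
  by split => //; rewrite lerDl.
move=> v c [Hc c0 /is_derive_pair [Hk _]].
have := near_so_dot Hk; rewrite c0; apply: filterS => s Hs.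
by split => //; exact: Hc.
Qed.

End Reduced.

Section Full.
Variable phi : R -> 'M[R]_n * 'M[R]_n * 'cV[R]_n -> 'M[R]_n * 'M[R]_n * 'cV[R]_n.
Hypothesis Hphi : is_flow (@phase R n) (rolling_field I D eps) phi.

Lemma rolling_flow_phase x t : phase x -> phase (phi t x).
Proof. by move=> /Hphi [_ /(_ t) []]. Qed.

Lemma rolling_flow_derive x (t : R) : phase x ->
  is_derive t 1 (phi ^~ x) (rolling_vec I D eps (phi t x)).
Proof.
by move=> /Hphi [_ /(_ t) [_ [v Hv]]]; rewrite (rolling_fieldE HI D0 Hv).
Qed.

Lemma rolling_linearized B : exists L,
  linearized_flow (@rolling_coord R n) (rolling_level B) phi (rolling_secant I D eps) L.
Proof.
have [L [L0 HL1 HL2]] := rolling_secant_bounds eps HI D0 B.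
exists L; split => //.
- move=> x t [Hx HB]; split; first exact: rolling_flow_phase.
  have [x0 _] := Hphi Hx.
  rewrite (@so_dot_conserved _ _ (fun t => (phi t x).1.1)
    (fun t => omega_of I D (phi t x).1.1 (phi t x).2) _ t 0) ?x0 // => r.
  by have /is_derive_pair [/is_derive_pair []] := rolling_flow_derive r Hx.
- by move=> x [/Hphi []].
- move=> x t [Hx _]; exists (rolling_vec I D eps (phi t x)).
  exact: rolling_flow_derive.
- move=> x y t [Hx _] [Hy _].
  rewrite -rolling_vecB //; last 2 first.
  + by case: (rolling_flow_phase t Hx).
  + by case: (rolling_flow_phase t Hy).
  by apply: is_deriveB; exact: rolling_flow_derive.
- by move=> *; exact: rolling_secant_linear.
- by move=> *; apply: HL2 => // i u' v'; exact: (coordB (rolling_coordinates R n)).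
Qed.

Lemma rolling_local_lin x : phase x -> exists S L,
  [/\ linearized_flow (@rolling_coord R n) S phi (rolling_secant I D eps) L, S x &
    forall v c, curve_at (@phase R n) x v c -> \forall s \near (0 : R), S (c s)].
Proof.
move=> Hx; have [L HL] := rolling_linearized (so_dot x.1.1 x.1.1 + 1).
exists (rolling_level (so_dot x.1.1 x.1.1 + 1)), L; split => //.
  by split => //; rewrite lerDl.
move=> v c [Hc c0 /is_derive_pair [/is_derive_pair [Hk _] _]].
have := near_so_dot Hk; rewrite c0; apply: filterS => s Hs.
by split => //; exact: Hc.
Qed.

End Full.
End RollingLinearized.

(** * Top forms *)

Section Multilinear.
Variables (R : realType) (V : lmodType R).

Definition upd k (v : 'I_k -> V) (i : 'I_k) (x : V) (j : 'I_k) : V :=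
  if j == i then x else v j.

Definition multilin k (f : ('I_k -> V) -> R) : Prop :=
  forall v i (a : R) x y, f (upd v i (a *: x + y)) = a * f (upd v i x) + f (upd v i y).

Definition antisym k (f : ('I_k -> V) -> R) : Prop :=
  forall v (s : 'S_k), f (v \o s) = (-1) ^+ s * f v.

Lemma upd_id k (v : 'I_k -> V) i : upd v i (v i) = v.
Proof. by apply/funext => j; rewrite /upd; case: eqP => // ->. Qed.

Lemma multilin_sum k (f : ('I_k -> V) -> R) (I : finType) v i (a : I -> R) (x : I -> V) :
  multilin f ->
  f (upd v i (\sum_l a l *: x l)) = \sum_l a l * f (upd v i (x l)).
Proof.
move=> Hf; have f0 : f (upd v i 0) = 0.
  have := Hf v i 1 0 0; rewrite scale1r addr0 mul1r => h.
  by apply: (addrI (f (upd v i 0))); rewrite -h addr0.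
elim: index_enum => [|l r IH]; first by rewrite !big_nil f0.
by rewrite !big_cons Hf IH.
Qed.

End Multilinear.

Section TopForm.
Variable R : realType.

Definition cols_mx m k (v : 'I_k -> 'cV[R]_m) : 'M[R]_(m, k) := \matrix_(i, j) v j i 0.

Lemma det_cols_multilin k : multilin (fun v : 'I_k -> 'cV[R]_k => \det (cols_mx v)).
Proof.
move=> v i a x y /=; rewrite -!(det_tr (cols_mx _)).
rewrite -[\det (cols_mx (upd v i y))^T]mul1r.
apply: (determinant_multilinear (i0 := i)).
- by apply/rowP => j; rewrite !mxE /upd eqxx !mxE mul1r.
- by apply/matrixP => k1 k2; rewrite !mxE /upd eq_sym (negbTE (neq_lift _ _)).
- by apply/matrixP => k1 k2; rewrite !mxE /upd eq_sym (negbTE (neq_lift _ _)).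
Qed.

Lemma det_cols_antisym k : antisym (fun v : 'I_k -> 'cV[R]_k => \det (cols_mx v)).
Proof.
move=> v s; have -> : cols_mx (v \o s) = col_perm s (cols_mx v).
  by apply/matrixP => i j; rewrite !mxE.
by rewrite col_permE det_mulmx det_perm odd_permV mulrC.
Qed.

(** A tuple of basis vectors either repeats an index, and a transposition kills its value, or
    permutes the standard one. General tuples follow by expanding one slot at a time: in [P m] the
    slots from [m] on already hold basis vectors. *)
Lemma multilin_antisym0 k (f : ('I_k -> 'cV[R]_k) -> R) :
  multilin f -> antisym f -> f (fun j => delta_mx j 0) = 0 -> forall v, f v = 0.
Proof.
move=> Hf Ha H0.
have basis (g : 'I_k -> 'I_k) : f (fun j => delta_mx (g j) 0) = 0.
  have [inj|/injectivePn [i [j ij gij]]] := altP (@injectiveP _ _ g).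
    have := Ha (fun j => delta_mx j 0) (perm inj); rewrite H0 mulr0 => <-.
    by congr f; apply/funext => j /=; rewrite permE.
  have := Ha (fun j => delta_mx (g j) 0) (tperm i j).
  rewrite odd_tperm ij expr1 mulN1r.
  rewrite (_ : _ \o _ = fun j => delta_mx (g j) 0); last first.
    by apply/funext => l /=; case: tpermP => // ->; rewrite ?gij.
  set z := f _ => h; lra.
suff P (m : nat) v : (forall j : 'I_k, (m <= j)%N -> exists i, v j = delta_mx i 0) -> f v = 0.
  by move=> v; apply: (P k) => j; rewrite leqNgt ltn_ord.
elim: m v => [|m IH] v Hv.
  have /choice [g Hg] : forall j, exists i, v j = delta_mx i 0 by move=> j; exact: Hv.
  by rewrite (_ : v = fun j => delta_mx (g j) 0) //; exact/funext.
have [mk|km] := ltnP m k; last first.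
  by apply: IH => j mj; apply: Hv; have := leq_trans km mj; rewrite leqNgt ltn_ord.
pose i := Ordinal mk; rewrite -(upd_id v i).
have -> : v i = \sum_l v i l 0 *: delta_mx l 0.
  by rewrite {1}[v i]matrix_sum_delta; apply: eq_bigr => l _; rewrite big_ord1.
rewrite multilin_sum // big1 // => l _; rewrite IH ?mulr0 // => j mj.
rewrite /upd; case: eqVneq => [_|ji]; first by exists l.
apply: Hv; rewrite ltn_neqAle mj andbT; apply: contra_neq ji => E; exact: val_inj.
Qed.

(** The equality [e] is an argument because the dimensions met below, such as [d * 2 + n] and
    [n + (d + d)], are equal but not convertible. *)
Lemma top_form_det k m (e : k = m) (f : ('I_k -> 'cV[R]_m) -> R) :
  multilin f -> antisym f -> forall v,
  f v = f (fun j => delta_mx (cast_ord e j) 0) *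
        \det (cols_mx (fun j => v (cast_ord (esym e) j))).
Proof.
case: m / e f => f Hf Ha v.
have E (w : 'I_k -> 'cV[R]_k) : (fun j => w (cast_ord (esym (erefl k)) j)) = w.
  by apply/funext => j; rewrite cast_ord_id.
rewrite E (_ : (fun j => _) = (fun j => delta_mx j 0)); last first.
  by apply/funext => j; rewrite cast_ord_id.
apply/eqP; rewrite -subr_eq0; apply/eqP.
set c := f (fun j => delta_mx j 0).
apply: (multilin_antisym0 (f := fun v => f v - c * \det (cols_mx v))).
- move=> w i a x y; rewrite Hf (det_cols_multilin w i a x y); ring.
- by move=> w s; rewrite Ha (det_cols_antisym w s) mulrBr mulrCA.
- have -> : cols_mx (fun j : 'I_k => delta_mx j 0) = 1%:M :> 'M[R]_k.
    by apply/matrixP => i j; rewrite !mxE eqxx andbT.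
  by rewrite det1 mulr1 /c subrr.
Qed.

End TopForm.

Section Wedge.
Variables (R : realType) (V : normedModType R).

Lemma wedge_multilin p q (alpha : dform V p) (beta : dform V q) x :
  multilin (alpha x) -> multilin (beta x) -> multilin (wedge alpha beta x).
Proof.
move=> Ha Hb v i a y z; rewrite /wedge (mulrCA a) -mulrDr; congr (_ * _).
rewrite mulr_sumr -big_split /=; apply: eq_bigr => s _.
rewrite (mulrCA a) -mulrDr; congr (_ * _).
have E : s ((s^-1)%g i) = i by rewrite permKV.
case: (split_ordP ((s^-1)%g i)) => j Hj.
  have El u : (fun k => upd v i u (s (lshift q k))) = upd (fun k => v (s (lshift q k))) j u.
    apply/funext => k; rewrite /upd -{1}E (inj_eq perm_inj) Hj.
    by rewrite (inj_eq (@lshift_inj _ _)).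
  have Er u : (fun k => upd v i u (s (rshift p k))) = (fun k => v (s (rshift p k))).
    by apply/funext => k; rewrite /upd -{1}E (inj_eq perm_inj) Hj eq_rlshift.
  by rewrite !El !Er Ha mulrDl mulrA.
have El u : (fun k => upd v i u (s (lshift q k))) = (fun k => v (s (lshift q k))).
  by apply/funext => k; rewrite /upd -{1}E (inj_eq perm_inj) Hj eq_lrshift.
have Er u : (fun k => upd v i u (s (rshift p k))) = upd (fun k => v (s (rshift p k))) j u.
  apply/funext => k; rewrite /upd -{1}E (inj_eq perm_inj) Hj.
  by rewrite (inj_eq (@rshift_inj _ _)).
by rewrite !El !Er Hb mulrDr mulrCA.
Qed.

Lemma wedge_antisym p q (alpha : dform V p) (beta : dform V q) x :
  antisym (wedge alpha beta x).
Proof.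
move=> v s; rewrite /wedge mulrCA; congr (_ * _).
rewrite mulr_sumr [RHS](reindex_inj (mulIg s)) /=; apply: eq_bigr => r _.
rewrite odd_permM signr_addb [RHS]mulrA (mulrCA ((-1) ^+ s)) -signr_addb addbb mulr1.
congr (_ * (alpha x _ * beta x _)); apply/funext => i /=; by rewrite permM.
Qed.

Lemma wedge_pow_multilin p (alpha : dform V p) x k :
  multilin (alpha x) -> multilin (wedge_pow alpha k x).
Proof.
move=> Ha; elim: k => [|k IH]; last exact: wedge_multilin.
by move=> v [].
Qed.

End Wedge.

(** Forms are meaningful on tangent vectors only, so agreement is asked on a set [T] and transported
    along [f] to a model space. *)
Lemma wedge_ext (R : realType) (V W : normedModType R) p q (alpha : dform V p)
    (beta : dform V q) (alpha' : dform W p) (beta' : dform W q) x x'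
    (f : V -> W) (T : set V) :
  (forall v, (forall i, T (v i)) -> alpha x v = alpha' x' (f \o v)) ->
  (forall v, (forall i, T (v i)) -> beta x v = beta' x' (f \o v)) ->
  forall v, (forall i, T (v i)) -> wedge alpha beta x v = wedge alpha' beta' x' (f \o v).
Proof.
move=> Ha Hb v Hv; rewrite /wedge; congr (_ * _); apply: eq_bigr => s _.
by rewrite Ha ?Hb.
Qed.

Lemma wedge_pow_ext (R : realType) (V W : normedModType R) p (alpha : dform V p)
    (alpha' : dform W p) x x' (f : V -> W) (T : set V) k :
  (forall v, (forall i, T (v i)) -> alpha x v = alpha' x' (f \o v)) ->
  forall v, (forall i, T (v i)) ->
  wedge_pow alpha k x v = wedge_pow alpha' k x' (f \o v).
Proof.
move=> H; elim: k => [//|k IH] v Hv /=.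
exact: (wedge_ext H IH Hv).
Qed.

(** * Wedge products with the sphere form as bordered determinants *)

Section SphereWedge.
Variables (R : realType) (n : nat).

Lemma vol_sphereE (gam : 'cV[R]_n.+1) (z : 'I_n -> 'cV[R]_n.+1) :
  vol_sphere gam z =
  \sum_i gam i 0 * ((-1) ^+ i * \det (cols_mx (fun j => row' i (z j)))).
Proof.
rewrite /vol_sphere (expand_det_col _ ord0); apply: eq_bigr => i _.
rewrite mxE /= /cofactor addn0; congr (_ * (_ * \det _)).
apply/matrixP => k j; rewrite !mxE /=.
rewrite (nth_map j) add0n ?size_enum_ord ?ltn_ord //.
by congr (fun_of_matrix (z _) _ _); exact: nth_ord_enum.
Qed.

Variables (m N : nat) (e : N = (n + m)%N).

(* The sphere form is completed to a top form of the ambient space by the radial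
   vector [gam], placed in column [0]. *)
Definition bordered (gam : 'cV[R]_n.+1) (w : 'I_N -> 'cV[R]_(n.+1 + m)) :
    'M[R]_((n + m).+1) :=
  \matrix_(i, j) (if unlift ord0 j is Some k then w (cast_ord (esym e) k)
                  else col_mx gam 0) i 0.

Definition drop_row (i : 'I_n.+1) (w : 'cV[R]_(n.+1 + m)) : 'cV[R]_(n + m) :=
  col_mx (row' i (usubmx w)) (dsubmx w).

(** Column 0 ends with [m] zeros, so its expansion removes rows of the sphere block only. *)
Lemma det_bordered gam w : \det (bordered gam w) =
  \sum_i gam i 0 * ((-1) ^+ i *
    \det (cols_mx (fun j => drop_row i (w (cast_ord (esym e) j))))).
Proof.
rewrite (expand_det_col _ ord0).
rewrite (@big_split_ord _ _ _ n.+1 m) /= [X in _ + X]big1 ?addr0; last first.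
  by move=> i _; rewrite mxE unlift_none col_mxEd mxE mul0r.
apply: eq_bigr => i _; rewrite mxE unlift_none col_mxEu.
rewrite /cofactor addn0; congr (_ * (_ * \det _)).
apply/matrixP => k j; rewrite !mxE liftK.
case: splitP => k' Hk; rewrite !mxE; congr (fun_of_matrix (w _) _ _); apply: val_inj => /=.
  by rewrite Hk.
by rewrite Hk /bump (leq_trans _ (leq_addr _ _)) //= -ltnS.
Qed.

End SphereWedge.

Section SphereWedge2.
Variables (R : realType) (n m p : nat) (e : (p + n)%N = (n + m)%N).
Variable (alpha0 : dform 'cV[R]_m p).
Hypothesis alpha0_multilin : multilin (alpha0 0).

Let alphaW : dform 'cV[R]_(n + m) p := fun _ v => alpha0 0 (fun i => dsubmx (v i)).
Let betaW : dform 'cV[R]_(n + m) n := fun _ v => \det (cols_mx (fun i => usubmx (v i))).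

(** The value of a constant model form on the standard basis. It is left unevaluated: what matters
    is its independence of the base point. *)
Definition sphere_const : R :=
  wedge alphaW betaW 0 (fun j => delta_mx (cast_ord e j) 0).

(** Expanding the sphere form along [gam] leaves, for each [i], a top form evaluated on vectors with
    row [i] dropped. It is the same form each time, so one constant factors out and the minors
    reassemble into [bordered]. *)
Lemma wedge_sphere_det (V : normedModType R) (alpha : dform V p) (x : V)
    (f : V -> 'cV[R]_m) (T : set V) (gam : 'cV[R]_n.+1)
    (v : 'I_(p + n) -> V * 'cV[R]_n.+1) :
  (forall u, (forall i, T (u i)) -> alpha x u = alpha0 0 (f \o u)) ->
  (forall i, T (v i).1) ->
  wedge (pull_linear fst alpha) (pull_linear snd (@vol_sphere R n.+1)) (x, gam) v =
  sphere_const * \det (bordered e gam (fun j => col_mx (v j).2 (f (v j).1))).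
Proof.
move=> Hf Tv; rewrite det_bordered /wedge.
have aW : multilin (alphaW 0).
  move=> w i a y z; rewrite /alphaW.
  have E u : (fun j => dsubmx (upd w i u j)) = upd (fun j => dsubmx (w j)) i (dsubmx u).
    by apply/funext => j; rewrite /upd; case: ifP.
  by rewrite !E linearP alpha0_multilin.
have bW : multilin (betaW 0).
  move=> w i a y z; rewrite /betaW.
  have E u : (fun j => usubmx (upd w i u j)) = upd (fun j => usubmx (w j)) i (usubmx u).
    by apply/funext => j; rewrite /upd; case: ifP.
  rewrite !E linearP; exact: det_cols_multilin.
have key := top_form_det e (wedge_multilin aW bW) (@wedge_antisym _ _ _ _ alphaW betaW 0).
transitivity (\sum_i gam i 0 * ((-1) ^+ i *
   wedge alphaW betaW 0 (fun j => drop_row i (col_mx (v j).2 (f (v j).1))))).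
  set C := (p`! * n`!)%:R^-1.
  transitivity (C * \sum_i \sum_(s : 'S_(p + n)) gam i 0 * ((-1) ^+ i *
     ((-1) ^+ s * (alpha0 0 (fun j => f (v (s (lshift n j))).1) *
      \det (cols_mx (fun j => row' i (v (s (rshift p j))).2)))))); last first.
    rewrite mulr_sumr; apply: eq_bigr => i _.
    rewrite /wedge (mulrCA _ C) (mulrCA _ C) -/C; congr (C * _).
    rewrite !mulr_sumr; apply: eq_bigr => s _.
    rewrite /alphaW /betaW /drop_row /=. congr (_ * (_ * (_ * (_ * _)))).
      by congr (alpha0 0); apply/funext => j; rewrite !col_mxKd.
    apply: (congr1 (fun h : 'I_n -> 'cV[R]_n => \det (cols_mx h))).
    by apply/funext => j; rewrite !col_mxKu.
  rewrite exchange_big /=; congr (C * _); apply: eq_bigr => s _.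
  rewrite /pull_linear /= vol_sphereE Hf //= !mulr_sumr; apply: eq_bigr => i _.
  set D := \det _; set a := alpha0 _ _; rewrite (mulrCA _ (gam i 0)) (mulrCA _ (gam i 0)).
  by congr (_ * _); rewrite (mulrCA a) mulrCA.
rewrite mulr_sumr; apply: eq_bigr => i _; rewrite key /sphere_const.
by rewrite [RHS]mulrCA; congr (_ * _); rewrite [RHS]mulrCA.
Qed.

End SphereWedge2.

(** * Invariance of the volume forms *)

Section Velocities.
Variables (R : realType) (n : nat).

Lemma is_derive_unique (V : normedModType R) (f : R -> V) (t : R) d1 d2 :
  is_derive t 1 f d1 -> is_derive t 1 f d2 -> d1 = d2.
Proof. by move=> [_ <-] [_ <-]. Qed.

Lemma so_velocity (k : R -> 'M[R]_n) (t : R) dk :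
  (forall s, so (k s)) -> is_derive t 1 k dk -> so dk.
Proof.
move=> Hk dk0; apply: (is_derive_unique (is_derive_trmx dk0)).
rewrite (_ : (fun s => _) = - k); first exact: is_deriveN.
by apply/funext => s; exact: Hk.
Qed.

Lemma sphere_velocity (gam : R -> 'cV[R]_n) (t : R) v :
  (forall s, sphere (gam s)) -> is_derive t 1 gam v -> dotv (gam t) v = 0.
Proof.
move=> Hg dg.
have /is_derive_mx /(_ 0 0) H := is_derive_mulmx (is_derive_trmx dg) dg.
have := is_derive_unique H (_ : is_derive t 1 _ 0).
rewrite (_ : (fun s => _) = cst 1); last by apply/funext => s; exact: Hg.
move=> /(_ (is_derive_cst _ _ _)); rewrite mxE -/(dotv _ _) -/(dotv _ _) (dotvC v).
by move=> h; lra.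
Qed.

Lemma SO_velocity (g : R -> 'M[R]_n) (t : R) v :
  (forall s, SO (g s)) -> is_derive t 1 g v -> so ((g t)^T *m v).
Proof.
move=> Hg dg; have H := is_derive_mulmx (is_derive_trmx dg) dg.
have := is_derive_unique H (_ : is_derive t 1 _ 0).
rewrite (_ : (fun s => _) = cst 1%:M); last by apply/funext => s; case: (Hg s).
move=> /(_ (is_derive_cst _ _ _)) /eqP.
by rewrite addr_eq0 => /eqP E; rewrite /so /= trmx_mul trmxK.
Qed.

Lemma tangent_reduced p v : tangent (@reduced_phase R n) p v ->
  so v.1 /\ dotv p.2 v.2 = 0.
Proof.
move=> [c [Hc <- /is_derive_pair [H1 H2]]]; split.
  by apply: so_velocity H1 => s; case: (Hc s).
by apply: (sphere_velocity (gam := fun s => (c s).2)) H2 => s; case: (Hc s).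
Qed.

Lemma tangent_phase p v : tangent (@phase R n) p v ->
  [/\ so v.1.1, so (p.1.2^T *m v.1.2) & dotv p.2 v.2 = 0].
Proof.
move=> [c [Hc <- /is_derive_pair [/is_derive_pair [H1 H2] H3]]]; split.
- by apply: so_velocity H1 => s; case: (Hc s).
- by apply: (SO_velocity (g := fun s => (c s).1.2)) H2 => s; case: (Hc s).
- by apply: (sphere_velocity (gam := fun s => (c s).2)) H3 => s; case: (Hc s).
Qed.

End Velocities.

Section SymplecticForm.
Variables (R : realType) (n : nat).
Local Notation d := (dim_so n).
Local Notation V := ('M[R]_n * 'M[R]_n)%type.

(** [liouville] is bilinear in [(k, g)], so its difference quotient is exactly affine in [h]. *)
Lemma derive_liouville (x v w : V) : 'D_v (fun q => liouville q w) x =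
  so_dot v.1 (x.2^T *m w.2) + so_dot x.1 (v.2^T *m w.2).
Proof.
set c := so_dot v.1 _ + _.
apply/cvg_lim => //.
pose g (h : R) := c + h * so_dot v.1 (v.2^T *m w.2).
have Hg : g h @[h --> (0 : R)^'] --> c.
  have H : g h @[h --> (0 : R)^'] --> (c + 0 * so_dot v.1 (v.2^T *m w.2) : R).
    apply: cvgD; first exact: cvg_cst.
    by apply: cvgM; [exact: cvg_within|exact: cvg_cst].
  by rewrite mul0r addr0 in H.
apply: cvg_trans Hg; apply: near_eq_cvg; near=> h.
have h0 : h != 0 by near: h; exact: nbhs_dnbhs_neq.
rewrite /g /= -[liouville (h *: v + x) w]/(so_dot (h *: v.1 + x.1)
  ((h *: v.2 + x.2)^T *m w.2)) /liouville.
have -> : (h *: v.2 + x.2)^T *m w.2 = h *: (v.2^T *m w.2) + x.2^T *m w.2.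
  by rewrite linearD linearZ /= mulmxDl -scalemxAl.
rewrite so_dotDl !so_dotDr !so_dotZl !so_dotZr /c -[_ *: _]/(_ * _).
by field.
Unshelve. all: by end_near. Qed.

(* [omega0] is the canonical form of a sum of two copies of so(n); the shear
   [shear k g] reduces [Omega] at [(k, g)] to it, and has determinant one. *)
Definition omega0 : dform 'cV[R]_(d + d) 2 := fun _ v =>
  dotv (usubmx (v ord0)) (dsubmx (v ord_max)) -
  dotv (usubmx (v ord_max)) (dsubmx (v ord0)).

Definition shear (k g : 'M[R]_n) (u : V) : 'cV[R]_(d + d) :=
  let eta := vecso (g^T *m u.2) in
  col_mx (vecso u.1 - (1 / 2) *: (opmx (brk k) *m eta)) eta.

Lemma omega0_multilin : multilin (omega0 0).
Proof.
move=> v i a x y; rewrite /omega0.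
have [->|->] : i = ord0 \/ i = ord_max.
  by case: i => -[|[|//]] Hi; [left|right]; exact: val_inj.
  rewrite /upd /= !linearP /= dotvDl dotvZl dotvDr dotvZr; ring.
rewrite /upd /= !linearP /= dotvDl dotvZl dotvDr dotvZr; ring.
Qed.

Lemma so_dotNr (X Y : 'M[R]_n) : so_dot X (- Y) = - so_dot X Y.
Proof. by rewrite -scaleN1r so_dotZr mulN1r. Qed.

(** In the left trivialization the form is [<x0, e1> - <x1, e0> - <k, [e0, e1]>]. The factor 1/2 in
    [shear] distributes the last term evenly over the two slots. *)
Lemma OmegaE (k g : 'M[R]_n) (v : 'I_2 -> V) : so k -> SO g ->
  (forall i, so (v i).1 /\ so (g^T *m (v i).2)) ->
  Omega (k, g) v = omega0 0 (shear k g \o v).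
Proof.
move=> Hk [Hg _] Hv; rewrite /Omega /ext_deriv1.
rewrite (derive_liouville (k, g) (v ord0) (v ord_max)).
rewrite (derive_liouville (k, g) (v ord_max) (v ord0)) /=.
rewrite /omega0 /= !col_mxKu !col_mxKd.
have [X0 E0] := Hv ord0; have [X1 E1] := Hv ord_max.
set x0 := (v ord0).1 in X0 *; set x1 := (v ord_max).1 in X1 *.
set e0 := g^T *m _ in E0; set e1 := g^T *m _ in E1.
have lin : so_linear (brk k) by move=> a X Y _ _; exact: brk_linear_r.
have gg : g *m g^T = 1%:M by exact: mulmx1C.
have G0 : (v ord0).2 = g *m e0 by rewrite mulmxA gg mul1mx.
have G1 : (v ord_max).2 = g *m e1 by rewrite mulmxA gg mul1mx.
have P01 : (v ord0).2^T *m (v ord_max).2 = - (e0 *m e1).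
  by rewrite G0 G1 trmx_mul E0 !mulNmx -mulmxA (mulmxA g^T) Hg mul1mx.
have P10 : (v ord_max).2^T *m (v ord0).2 = - (e1 *m e0).
  by rewrite G0 G1 trmx_mul E1 !mulNmx -mulmxA (mulmxA g^T) Hg mul1mx.
rewrite P01 P10 !dotvBl !dotvZl -!(opmxE lin) //.
have vE X Y : so X -> dotv (vecso X) (vecso Y) = so_dot X Y.
  by move=> HX; rewrite so_dot_vecso.
rewrite !vE //; try exact: so_brk.
rewrite !so_dot_brk /brk !(so_dotDr, so_dotNr) -/e0 -/e1.
by field.
Qed.

End SymplecticForm.

(** * Liouville's formula with a radial column *)

Section LiouvilleFormula.
Variable R : realType.

(** The radial column moves by [v], not by [A]. The defect [tau] has a sphere part orthogonal to
    [gam], like the other columns, so putting it in the radial column makes the matrix singular. *)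
Lemma is_derive_bordered n m N (e : N = (n + m)%N) (gam : R -> 'cV[R]_n.+1)
    (w : 'I_N -> R -> 'cV[R]_(n.+1 + m)) (A : 'M[R]_(n.+1 + m))
    (t : R) (v : 'cV[R]_n.+1) :
  is_derive t 1 gam v ->
  (forall j, is_derive t 1 (w j) (A *m w j t)) ->
  gam t != 0 ->
  (forall j, dotv (gam t) (usubmx (w j t)) = 0) ->
  dotv (gam t) (v - usubmx (A *m col_mx (gam t) 0)) = 0 ->
  is_derive t 1 (fun s => \det (bordered e (gam s) (w ^~ s)))
    (\tr A * \det (bordered e (gam t) (w ^~ t))).
Proof.
move=> dg dw g0 Hw Hv; set tau : 'cV[R]_(n.+1 + m) := col_mx v 0 - A *m col_mx (gam t) 0.
apply: (is_derive_det_transport (n := (n + m)%N) (A := A) (tau := tau)).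
  have dcol : is_derive t 1 (fun s => col_mx (gam s) (0 : 'cV[R]_m)) (col_mx v 0).
    exact: is_derive_col_mx.
  apply/is_derive_mx => i j.
  have colE k : (A *m bordered e (gam t) (w ^~ t)) i k =
      (A *m (if unlift ord0 k is Some k' then w (cast_ord (esym e) k') t
             else col_mx (gam t) 0)) i 0.
    rewrite !mxE; apply: eq_bigr => l _; congr (_ * _); rewrite mxE.
    by case: (unlift _ _).
  have -> : (A *m bordered e (gam t) (w ^~ t) + tau *m delta_mx 0 0) i j =
      (if unlift ord0 j is Some k then A *m w (cast_ord (esym e) k) t
       else col_mx v 0) i 0.
    rewrite mxE colE [(tau *m _) i j]mxE big_ord1 [delta_mx _ _ _ _]mxE eqxx /=.
    case: unliftP => [k|] ->.
      by rewrite (_ : (lift ord0 k == 0) = false) // mulr0 addr0.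
    by rewrite eqxx mulr1 /tau [X in _ + X]mxE [X in _ + (_ + X)]mxE addrC subrK.
  rewrite (_ : (fun s => _) = fun s => (if unlift ord0 j is Some k
    then w (cast_ord (esym e) k) s else col_mx (gam s) 0) i 0); last first.
    by apply/funext => s; rewrite mxE.
  case: (unlift _ _) => [k|]; last by have /is_derive_mx := dcol; apply.
  by have /is_derive_mx := dw (cast_ord (esym e) k); apply.
(* The row [(gam, 0)] annihilates every column once [tau] stands in column 0. *)
apply/eqP/det0P; exists (row_mx (gam t)^T 0).
  apply: contra_neq g0 => E; apply: trmx_inj.
  by rewrite -(row_mxKl (gam t)^T (0 : 'rV[R]_m)) E trmx0 linear0.
have Htau : dotv (gam t) (usubmx tau) = 0 by rewrite /tau linearB /= col_mxKu.
clearbody tau.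
apply/rowP => j; rewrite [RHS]mxE.
have -> : (row_mx (gam t)^T 0 *m col_set (bordered e (gam t) (w ^~ t)) 0 tau) 0 j =
  (row_mx (gam t)^T 0 *m (if unlift ord0 j is Some k
     then w (cast_ord (esym e) k) t else tau)) 0 0.
  rewrite !mxE; apply: eq_bigr => i _; congr (_ * _); rewrite !mxE.
  by case: unliftP => [k|] ->.
have E (x : 'cV[R]_(n.+1 + m)) : (row_mx (gam t)^T 0 *m x) 0 0 = dotv (gam t) (usubmx x).
  by rewrite -{1}(vsubmxK x) mul_row_col mul0mx addr0.
rewrite E; case: (unlift _ _) => [k|]; [exact: Hw|exact: Htau].
Qed.

End LiouvilleFormula.

Section InverseMu.
Variables (R : realType) (n : nat) (I : 'M[R]_n -> 'M[R]_n) (D : R).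
Hypotheses (HI : inertia_tensor I) (D0 : 0 < D).

Lemma is_derive_inv_mu (gam : R -> 'cV[R]_n) (t : R) v :
  is_derive t 1 gam v ->
  is_derive t 1 (fun s => (mu I D (gam s))^-1)
   (- (1 / 2 * \tr (kappa_deriv D (gam t) v *m kappa_inv I D (gam t)))
    * (mu I D (gam t))^-1).
Proof.
move=> dg; have /is_derive_det H1 := is_derive_kappa_mx I D dg.
have p0 := posdef_det_gt0 (posdef_kappa HI D0 (gam t)).
have H2 := is_derive1_comp (is_derive1_sqrt p0) H1.
have m0 := mu_gt0 HI D0 (gam t).
have m1 : mu I D (gam t) != 0 by rewrite gt_eqF.
have H3 := is_deriveV (f := fun s => mu I D (gam s)) m1 H2.
apply: (is_derive_eq H3).
(* The determinant is [mu^2]; this turns Jacobi's formula into a logarithmic derivative. *)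
have -> : \adj (kappa_mx I D (gam t)) = mu I D (gam t) ^+ 2 *: kappa_inv I D (gam t).
  rewrite /mu sqr_sqrtr ?(ltW p0) // /kappa_inv /invmx kappa_unit // scalerA.
  by rewrite divff ?scale1r // gt_eqF.
rewrite -scalemxAr mxtraceZ -![_ *: _]/(_ * _) -/(mu I D (gam t)).
set z := \tr _; field; exact: m1.
Qed.

End InverseMu.

Section Invariance.
Variables (R : realType) (n : nat) (I : 'M[R]_n.+1 -> 'M[R]_n.+1) (D eps : R).
Hypotheses (HI : inertia_tensor I) (D0 : 0 < D).
Local Notation d := (dim_so n.+1).

Lemma dotv_so (X : 'M[R]_n.+1) x : so X -> dotv x (X *m x) = 0.
Proof.
move=> HX; have := dotv_mx X x x; rewrite HX mulNmx (dotvC (X *m x)).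
by rewrite -scaleN1r dotvZr mulN1r; set z := dotv _ _ => h; lra.
Qed.

Lemma sphere_neq0 (gam : 'cV[R]_n.+1) : sphere gam -> gam != 0.
Proof.
move=> Hg; apply/eqP => E; move: Hg; rewrite /sphere /= E /dotv mulmx0 mxE.
by move/eqP; rewrite eq_sym oner_eq0.
Qed.

(** The two factors have opposite logarithmic derivatives. The condition on [A] at [(gam, 0)] gives
    it a tangent sphere part there, as skew matrices send [gam] to tangent vectors; hence the radial
    defect is tangent. *)
Lemma bordered_const m N (e : N = (n + m)%N) (gam : R -> 'cV[R]_n.+1)
    (om : R -> 'M[R]_n.+1) (w : 'I_N -> R -> 'cV[R]_(n.+1 + m))
    (A : R -> 'M[R]_(n.+1 + m)) :
  (forall t, so (om t)) -> (forall t, sphere (gam t)) ->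
  (forall t : R, is_derive t 1 gam (- eps *: (om t *m gam t))) ->
  (forall j (t : R), is_derive t 1 (w j) (A t *m w j t)) ->
  (forall j t, dotv (gam t) (usubmx (w j t)) = 0) ->
  (forall t, exists2 X, so X & usubmx (A t *m col_mx (gam t) 0) = X *m gam t) ->
  (forall t, \tr (A t) = 1 / 2 *
    \tr (kappa_deriv D (gam t) (- eps *: (om t *m gam t)) *m kappa_inv I D (gam t))) ->
  forall s t, (mu I D (gam s))^-1 * \det (bordered e (gam s) (w ^~ s)) =
    (mu I D (gam t))^-1 * \det (bordered e (gam t) (w ^~ t)).
Proof.
move=> Hom Hg dg dw Hw HA trA s t.
apply: (is_derive_0_is_cst
  (f := fun s => (mu I D (gam s))^-1 * \det (bordered e (gam s) (w ^~ s)))) => r.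
have H1 := is_derive_inv_mu HI D0 (dg r).
have Hv : dotv (gam r) (- eps *: (om r *m gam r) - usubmx (A r *m col_mx (gam r) 0)) = 0.
  have [X HX ->] := HA r.
  by rewrite dotvBr dotvZr !dotv_so // mulr0 subrr.
have H2 := is_derive_bordered e (dg r) (dw ^~ r) (sphere_neq0 (Hg r)) (Hw ^~ r) Hv.
apply: (is_derive_eq (is_deriveM H1 H2)); rewrite -![_ *: _]/(_ * _) trA; ring.
Qed.

(** Serves to discard the shear: a change of coordinates that fixes the radial vector acts on all
    columns at once. *)
Lemma bordered_mul m N (e : N = (n + m)%N) (gam : 'cV[R]_n.+1)
    (w : 'I_N -> 'cV[R]_(n.+1 + m)) (B : 'M[R]_(n.+1 + m)) :
  B *m col_mx gam 0 = col_mx gam 0 ->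
  \det (bordered e gam (fun j => B *m w j)) = \det B * \det (bordered e gam w).
Proof.
move=> HB; rewrite -(@det_mulmx _ (n + m).+1); congr (\det _).
apply/matrixP => i j; rewrite [LHS]mxE.
transitivity ((B *m (if unlift ord0 j is Some k then w (cast_ord (esym e) k)
   else col_mx gam 0)) i 0).
  by case: (unlift _ _) => [k//|]; rewrite HB.
rewrite !mxE; apply: eq_bigr => l _; congr (_ * _); rewrite mxE.
by case: (unlift _ _).
Qed.

Lemma reduced_invariant :
  invariant_volume (@reduced_phase R n.+1) (reduced_field I D eps) (reduced_volume I D).
Proof.
move=> phi Hphi.
apply: (flow_preserves_form (reduced_coordinates R n.+1) (A := reduced_secant I D eps)).
- by move=> x t; exact: (reduced_flow_phase Hphi).
- by move=> x; exact: (reduced_local_lin HI D0 Hphi).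
move=> x Mx U HU HT t.
have Mphi r : reduced_phase (phi r x) by exact: (reduced_flow_phase Hphi).
have e : (d + n)%N = (n + d)%N by exact: addnC.
pose al0 : dform 'cV[R]_d d := fun _ v => \det (cols_mx v).
pose w j r := col_mx (U j r).2 (vecso (U j r).1).
have volE r : reduced_volume I D (phi r x) (U ^~ r) =
    sphere_const e al0 * ((mu I D (phi r x).2)^-1 *
    \det (bordered e (phi r x).2 (w ^~ r))).
  rewrite /reduced_volume /scale_form [RHS]mulrCA; congr (_ * _).
  rewrite {1}[phi r x]surjective_pairing.
  rewrite (@wedge_sphere_det _ _ _ _ e al0 _ _ _ _ (@vecso R n.+1) setT) //.
    exact: det_cols_multilin.
  move=> u _; rewrite /vol_so /al0; congr (\det _).
  by apply/matrixP => a b; rewrite !mxE.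
rewrite !volE; congr (_ * _).
pose om r := omega_of I D (phi r x).1 (phi r x).2.
have Hom r : so (om r) by exact: so_omega_of.
apply: (@bordered_const _ _ e (fun r => (phi r x).2) om w
  (fun r => reduced_lin I D eps (phi r x).2 (phi r x).1 (om r))) => //.
- by move=> r; case: (Mphi r).
- by move=> r; have /is_derive_pair [] := reduced_flow_derive HI D0 Hphi r Mx.
- move=> j r; have [so_u _] := tangent_reduced (HT j r).
  have [so_k _] := Mphi r.
  rewrite reduced_linE //.
  have /is_derive_pair [H1 H2] := HU j r.
  exact: (is_derive_col_mx H2 (is_derive_linear (@vecso_linear R n.+1) H1)).
- by move=> j r; rewrite col_mxKu; have [] := tangent_reduced (HT j r).
- move=> r; have [so_k _] := Mphi r.
  have := @reduced_linE _ _ I D eps (phi r x).2 _ _ 0 (phi r x).2 so_k (Hom r) (so0 _ _).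
  rewrite vecso0 => ->; rewrite col_mxKu.
  set dom := lin_omega _ _ _ _ _ _ _.
  exists (- eps *: (om r + dom)); last by rewrite -scalemxAl mulmxDl.
  by apply: soZ; apply: soD => //; exact: so_matso.
- by move=> r; exact: mxtrace_reduced_lin.
Qed.

Lemma rolling_invariant :
  invariant_volume (@phase R n.+1) (rolling_field I D eps) (rolling_volume I D).
Proof.
move=> phi Hphi.
apply: (flow_preserves_form (rolling_coordinates R n.+1) (A := rolling_secant I D eps)).
- by move=> x t; exact: (rolling_flow_phase Hphi).
- by move=> x; exact: (rolling_local_lin HI D0 Hphi).
move=> x Mx U HU HT t.
have Mphi r : phase (phi r x) by exact: (rolling_flow_phase Hphi).
have e : (d * 2 + n)%N = (n + (d + d))%N by rewrite muln2 -addnn addnC.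
pose al0 : dform 'cV[R]_(d + d) (d * 2) := wedge_pow (@omega0 R n.+1) d.
(* The [g] component is read in the left trivialization moving with the flow, so that [g] disappears
   from the coefficients. *)
pose w j r : 'cV[R]_(n.+1 + (d + d)) := col_mx (U j r).2
  (col_mx (vecso (U j r).1.1) (vecso ((phi r x).1.2^T *m (U j r).1.2))).
have volE r : rolling_volume I D (phi r x) (U ^~ r) =
    sphere_const e al0 * ((mu I D (phi r x).2)^-1 *
    \det (bordered e (phi r x).2 (w ^~ r))).
  rewrite /rolling_volume /scale_form [RHS]mulrCA; congr (_ * _).
  rewrite {1}[phi r x]surjective_pairing.
  have [so_k SO_g _] := Mphi r.
  pose T := [set u : 'M[R]_n.+1 * 'M[R]_n.+1 | so u.1 /\ so ((phi r x).1.2^T *m u.2)].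
  rewrite (@wedge_sphere_det _ _ _ _ e al0 _ _ _ _
    (shear (phi r x).1.1 (phi r x).1.2) T).
  (* [S] is [shear] as a matrix on [(xi, eta)]: unipotent, hence of determinant 1 whatever [k]
     is. *)
  - pose S : 'M[R]_(d + d) :=
      block_mx 1%:M (- ((1 / 2) *: opmx (brk (phi r x).1.1))) 0 1%:M.
    pose B : 'M[R]_(n.+1 + (d + d)) := block_mx 1%:M 0 0 S.
    congr (_ * _).
    rewrite (_ : (fun j => _) = fun j => B *m w j r); last first.
      apply/funext => j; rewrite /B /w mul_block_col mul1mx !mul0mx addr0 add0r.
      rewrite /S mul_block_col !mul1mx mul0mx add0r /shear /=.
      by rewrite mulNmx -scalemxAl.
    rewrite bordered_mul; last by rewrite mul_block_col mul1mx !mul0mx mulmx0 !addr0.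
    by rewrite /B (@det_ublock _ n.+1 (d + d)) /S det_ublock !det1 !mul1r.
  - exact: (wedge_pow_multilin (@omega0_multilin R n.+1)).
  - apply: wedge_pow_ext => u Hu; rewrite [(phi r x).1]surjective_pairing.
    exact: OmegaE.
  - by move=> i; have [h1 h2 _] := tangent_phase (HT i r).
rewrite !volE; congr (_ * _).
pose om r := omega_of I D (phi r x).1.1 (phi r x).2.
have Hom r : so (om r) by exact: so_omega_of.
apply: (@bordered_const _ _ e (fun r => (phi r x).2) om w
  (fun r => rolling_lin I D eps (phi r x).2 (phi r x).1.1 (om r))) => //.
- by move=> r; case: (Mphi r).
- by move=> r; have /is_derive_pair [] := rolling_flow_derive HI D0 Hphi r Mx.
- move=> j r; have [so_u so_eta _] := tangent_phase (HT j r).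
  have [so_k [Hg _] _] := Mphi r.
  rewrite /w rolling_linE //.
  have /is_derive_pair [/is_derive_pair [H1 H2] H3] := HU j r.
  have /is_derive_pair [/is_derive_pair [_ Hg'] _] :=
    rolling_flow_derive HI D0 Hphi r Mx.
  (* From [g' = g om] and [g^T g = 1], the vector [eta = g^T dg] has derivative [[eta, om]] plus the
     variation of [om]. *)
  have H4 := is_derive_mulmx (is_derive_trmx Hg') H2.
  have H5 := is_derive_col_mx (is_derive_linear (@vecso_linear R n.+1) H1)
    (is_derive_linear (@vecso_linear R n.+1) H4).
  apply: (is_derive_eq (is_derive_col_mx H3 H5)).
  congr col_mx; congr col_mx; congr vecso => /=.
  rewrite trmx_mul (Hom r) !mulNmx mulmxDr !mulmxA Hg mul1mx /brk -!mulmxA.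
  by rewrite addrA [X in X + _]addrC.
- by move=> j r; rewrite col_mxKu; have [] := tangent_phase (HT j r).
- move=> r; have [so_k _ _] := Mphi r.
  have := @rolling_linE _ _ I D eps (phi r x).2 _ _ 0 (phi r x).2 0 so_k (Hom r)
    (so0 _ _) (so0 _ _).
  rewrite vecso0 col_mx0 => ->; rewrite col_mxKu.
  set dom := lin_omega _ _ _ _ _ _ _.
  exists (- eps *: (om r + dom)); last by rewrite -scalemxAl mulmxDl.
  by apply: soZ; apply: soD => //; exact: so_matso.
- by move=> r; exact: mxtrace_rolling_lin.
Qed.

End Invariance.

(** * The determinant for the special inertia operator *)

(** One block matrix is made triangular in two ways by unimodular factors. *)
Lemma det_sylvester (F : fieldType) m n (X : 'M[F]_(m, n)) (Y : 'M[F]_(n, m)) :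
  \det (1%:M + X *m Y) = \det (1%:M + Y *m X).
Proof.
pose M := block_mx 1%:M (- X) Y 1%:M : 'M[F]_(m + n).
have E1 : M *m block_mx 1%:M X 0 1%:M = block_mx 1%:M 0 Y (1%:M + Y *m X).
  by rewrite mulmx_block !(mulmx1, mul1mx, mulmx0, addr0, subrr, addrN) addrC.
have E2 : M *m block_mx 1%:M 0 (- Y) 1%:M = block_mx (1%:M + X *m Y) (- X) 0 1%:M.
  by rewrite mulmx_block !(mulmx1, mul1mx, mulmx0, addr0, add0r, addrN, mulNmx, mulmxN, opprK).
have := congr1 determinant E1; have := congr1 determinant E2.
by rewrite !det_mulmx !det_ublock !det_lblock !det1 !mulr1 !mul1r => <- <-.
Qed.

(** The perturbation factors through dimension 2, so Sylvester's identity leaves a 2 by 2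
    determinant. *)
Lemma det_rank2 (F : fieldType) n (lam : F) (u1 u2 : 'cV[F]_n) (v1 v2 : 'rV[F]_n) :
  lam != 0 ->
  \det (lam%:M + u1 *m v1 + u2 *m v2) =
  lam ^+ n / lam ^+ 2 *
  ((lam + (v1 *m u1) 0 0) * (lam + (v2 *m u2) 0 0) - (v1 *m u2) 0 0 * (v2 *m u1) 0 0).
Proof.
move=> l0; pose X := row_mx u1 u2; pose Y := lam^-1 *: col_mx v1 v2.
have -> : lam%:M + u1 *m v1 + u2 *m v2 = lam *: (1%:M + X *m Y).
  rewrite scalerDr -scalemxAr scalerA divff // scale1r scalemx1 mul_row_col.
  by rewrite addrA.
rewrite detZ det_sylvester -mulrA; congr (_ * _).
pose i0 : 'I_(1 + 1) := lshift 1 ord0; pose i1 : 'I_(1 + 1) := rshift 1 ord0.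
have det2 (M : 'M[F]_(1 + 1)) : \det M = M i0 i0 * M i1 i1 - M i0 i1 * M i1 i0.
  have -> : i0 = (ord0 : 'I_2) by exact: val_inj.
  have -> : i1 = (lift ord0 ord0 : 'I_2) by exact: val_inj.
  rewrite (expand_det_row _ ord0) !big_ord_recl big_ord0 /cofactor !det_mx11 !mxE /=.
  rewrite expr0 expr1 addr0 mul1r mulN1r mulrN.
  congr (_ * fun_of_matrix M _ _ - fun_of_matrix M _ _ * fun_of_matrix M _ _); exact: val_inj.
rewrite /Y /X -scalemxAl mul_col_row scalar_mx_block scale_block_mx add_block_mx det2.
rewrite /i0 /i1 !block_mxEul !block_mxEdr !block_mxEur !block_mxEdl !mxE eqxx mulr1n.
set x := (v1 *m u1) 0 0.
field; exact: l0.
Qed.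

Section ChaplyginInertia.
Variables (R : realType) (n : nat) (I : 'M[R]_n -> 'M[R]_n) (D : R) (a : 'rV[R]_n).
Hypotheses (HI : inertia_tensor I) (D0 : 0 < D).
Hypothesis Ha : forall i j, 0 < a 0 i * a 0 j < D.
Hypothesis HIa : forall i j : 'I_n, I (wedgev (stdv R i) (stdv R j)) =
  (D * a 0 i * a 0 j / (D - a 0 i * a 0 j)) *: wedgev (stdv R i) (stdv R j).

Let A : 'M[R]_n := diag_mx a.
Let B : 'M[R]_n := diag_mx (\row_i (a 0 i)^-1).

Let a_neq0 i : a 0 i != 0.
Proof.
by have /andP[] := Ha i i; case: eqVneq => // ->; rewrite mul0r ltxx.
Qed.

Let mulAB : A *m B = 1%:M.
Proof.
apply/matrixP => i j; rewrite mul_diag_mx !mxE.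
by case: eqVneq => [->|]; rewrite ?mulr0n ?mulr0 // mulr1n divff.
Qed.

Let mulBA : B *m A = 1%:M. Proof. exact: mulmx1C. Qed.

Lemma invmx_diag : invmx A = B.
Proof.
have [uA _] := mulmx1_unit mulAB.
by rewrite -[LHS]mulmx1 -mulAB mulmxA mulVmx // mul1mx.
Qed.

Let Da_neq0 i j : D - a 0 i * a 0 j != 0.
Proof. by have /andP[_ H] := Ha i j; rewrite gt_eqF // subr_gt0. Qed.

Lemma opmx_inertia_diag : opmx I = diag_mx (\row_(r < dim_so n)
  (let p := enum_val r in D * a 0 p.1 * a 0 p.2 / (D - a 0 p.1 * a 0 p.2))).
Proof.
apply/matrixP => r s; rewrite !mxE HIa so_dotZr -/(so_basis R s) /=.
have := congr1 (fun x : 'cV[R]_(dim_so n) => x r 0) (vecso_basis R s).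
rewrite !mxE andbT => ->; case: eqVneq => [->|_]; first by rewrite mulr1 mulr1n.
by rewrite mulr0 mulr0n.
Qed.

(** The eigenvalues satisfy [1 / lambda_ij = 1 / (a_i a_j) - 1 / D], so [D] times the inverse
    inertia operator sends [Y] to [D B Y B - Y] with [B = A^-1]. *)
Lemma opmx_inertia_inv Y : so Y ->
  opmx I *m vecso (D *: (B *m Y *m B) - Y) = D *: vecso Y.
Proof.
move=> HY.
have HZ : so (D *: (B *m Y *m B) - Y).
  apply: soD; last exact: soN.
  by apply: soZ; rewrite /so /= !trmx_mul tr_diag_mx HY mulNmx mulmxN mulmxA.
apply/colP => r; rewrite opmx_inertia_diag mul_diag_mx [LHS]mxE [RHS]mxE.
rewrite !vecsoE // mxE /=.
set i := (enum_val r).1; set j := (enum_val r).2.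
have -> : (D *: (B *m Y *m B) - Y) i j = D * ((a 0 i)^-1 * Y i j * (a 0 j)^-1) - Y i j.
  by rewrite mxE [X in _ + X]mxE [X in X + _]mxE mul_mx_diag mxE mul_diag_mx !mxE.
by field; rewrite Da_neq0 !a_neq0.
Qed.

Lemma wedgev_mul (x y z : 'cV[R]_n) : wedgev x y *m z = dotv y z *: x - dotv x z *: y.
Proof.
rewrite /wedgev mulmxBl -!mulmxA.
have E (u v w : 'cV[R]_n) : u *m (v^T *m w) = dotv v w *: u.
  by rewrite [v^T *m w]mx11_scalar mul_mx_scalar.
by rewrite !E.
Qed.

Lemma mulmx_inj_cV m (M N : 'M[R]_(m, n)) : (forall x : 'cV[R]_n, M *m x = N *m x) -> M = N.
Proof.
move=> H; apply/matrixP => i j; have /colP/(_ i) := H (delta_mx j 0).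
by rewrite -!colE !mxE.
Qed.

Lemma det_kappa_chaplygin gam : sphere gam ->
  let q := dotv gam (B *m gam) in q != 0 ->
  \det (kappa_mx I D gam) =
  \det (opmx I) * (D * (\det A)^-1) * ((D * q) ^+ n / (D * q) ^+ 2).
Proof.
move=> Hg q q0.
set W := wedge_mx gam; set J := opmx I.
have uJ : J \in unitmx by exact: posdef_unit (posdef_inertia HI).
have -> : kappa_mx I D gam = J *m (1%:M + (D *: invmx J *m W) *m W^T).
  by rewrite kappa_mxE mulmxDr mulmx1 -!scalemxAl -scalemxAr !mulmxA mulmxV // mul1mx.
rewrite det_mulmx det_sylvester -mulrA; congr (_ * _).
(* The factor [A] cancels a [B], and the terms [x] and [- x] cancel each other: a scalar matrix and
   two rank-one terms remain. *)
have E : A *m (1%:M + W^T *m (D *: invmx J *m W)) =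
    (D * q)%:M + (- D *: gam) *m (gam^T *m B) + (A *m gam) *m gam^T.
  apply: mulmx_inj_cV => x; set Y := wedgev x gam.
  have HY : so Y by exact: so_wedgev.
  have HZ : so (D *: (B *m Y *m B) - Y).
    apply: soD; last exact: soN.
    by apply: soZ; rewrite /so /= !trmx_mul tr_diag_mx HY mulNmx mulmxN mulmxA.
  have -> : A *m (1%:M + W^T *m (D *: invmx J *m W)) *m x =
      A *m (x + (D *: (B *m Y *m B) - Y) *m gam).
    rewrite -mulmxA mulmxDl mul1mx -!mulmxA mul_wedge_mx -/Y -scalemxAl scalemxAr.
    by rewrite -(opmx_inertia_inv HY) mulKmx // tr_wedge_mx // -!mulmxA.
  have dotvB : dotv x (B *m gam) = dotv gam (B *m x) by rewrite dotvC dotv_mx tr_diag_mx.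
  have -> : (D *: (B *m Y *m B) - Y) *m gam =
      D *: (B *m (q *: x - dotv gam (B *m x) *: gam)) - (x - dotv gam x *: gam).
    rewrite mulmxBl; congr (_ - _).
      by rewrite -scalemxAl -!mulmxA wedgev_mul -/q dotvB.
    by rewrite wedgev_mul (Hg : dotv gam gam = 1) scale1r (dotvC x).
  have mdot (u v w : 'cV[R]_n) : u *m (v^T *m w) = dotv v w *: u.
    by rewrite [v^T *m w]mx11_scalar mul_mx_scalar.
  have -> : ((D * q)%:M + (- D *: gam) *m (gam^T *m B) + (A *m gam) *m gam^T) *m x =
      (D * q) *: x + dotv gam (B *m x) *: (- D *: gam) + dotv gam x *: (A *m gam).
    rewrite !mulmxDl mul_scalar_mx; congr (_ + _ + _).
      by rewrite -!(mulmxA _ _ x) mdot.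
    by rewrite -mulmxA mdot.
  rewrite mulmxDr mulmxBr -scalemxAr mulmxA mulAB mul1mx mulmxBr -scalemxAr.
  by apply/colP => i; rewrite !mxE; ring.
have dA : \det A != 0.
  have /eqP := congr1 determinant mulAB; rewrite det_mulmx det1.
  by apply: contraTneq => ->; rewrite mul0r eq_sym oner_eq0.
apply: (mulfI dA); rewrite -det_mulmx E det_rank2; last by rewrite mulf_neq0 // gt_eqF.
(* This pairing cancels the scalar [D * q], so the diagonal product in [det_rank2] vanishes and the
   off-diagonal one leaves the factor [D]. *)
have e1 : (gam^T *m B *m (- D *: gam)) 0 0 = - (D * q).
  by rewrite -scalemxAr mxE -mulmxA mulNr.
have e2 : (gam^T *m B *m (A *m gam)) 0 0 = 1.
  by rewrite -mulmxA (mulmxA B) mulBA mul1mx; exact: Hg.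
have e3 : (gam^T *m (- D *: gam)) 0 0 = - D.
  by rewrite -scalemxAr mxE -/(dotv gam gam) Hg mulr1.
rewrite e1 e2 e3 subrr mul0r mul1r sub0r opprK.
by rewrite [RHS]mulrA (mulrCA (\det A)) divff // mulr1 mulrC.
Qed.

(** All [a_i] have the same sign; multiplying by one of them makes every term of the pairing
    nonnegative. *)
Lemma dotv_inv_neq0 gam : sphere gam -> dotv gam (B *m gam) != 0.
Proof.
move=> Hg; have [i0 gi0] : exists i, gam i 0 != 0.
  apply/existsP; apply: contraT; rewrite negb_exists => /forallP H.
  move: Hg; rewrite /sphere /= dotvE big1 => [/eqP|i _]; first by rewrite eq_sym oner_eq0.
  by have := H i; rewrite negbK => /eqP ->; rewrite mul0r.
suff : 0 < a 0 i0 * dotv gam (B *m gam) by move/gt_eqF; rewrite mulf_eq0 => /norP[].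
have term i : a 0 i0 * (gam i 0 * (B *m gam) i 0) =
    (a 0 i0 * a 0 i) * (gam i 0 / a 0 i) ^+ 2.
  by rewrite mul_diag_mx !mxE; field; exact: a_neq0.
rewrite dotvE mulr_sumr (bigD1 i0) //= ltr_pwDl //.
  rewrite term mulr_gt0 //; first by have /andP[] := Ha i0 i0.
  by rewrite exprn_even_gt0 //= mulf_neq0 ?invr_eq0.
apply: sumr_ge0 => i _; rewrite term mulr_ge0 ?sqr_ge0 //.
by have /andP[/ltW] := Ha i0 i.
Qed.

(** As only the products [a_i a_j] are assumed positive, all [a_i] may be negative; then the pairing
    is negative, and so is [c] for odd [n]. Hence the absolute values. *)
Lemma mu_chaplygin : exists2 C : R, 0 < C & forall gam : 'cV[R]_n, sphere gam ->
  mu I D gam = C * `| dotv gam (invmx (diag_mx a) *m gam) | `^ (1 / 2 * (n%:R - 2)).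
Proof.
pose c := \det (opmx I) * (D * (\det A)^-1) * (D ^+ n / D ^+ 2).
have dA : \det A != 0.
  have /eqP := congr1 determinant mulAB; rewrite det_mulmx det1.
  by apply: contraTneq => ->; rewrite mul0r eq_sym oner_eq0.
have c0 : c != 0.
  rewrite !mulf_neq0 ?invr_neq0 ?expf_neq0 ?(gt_eqF D0) //.
  by rewrite gt_eqF // (posdef_det_gt0 (posdef_inertia HI)).
exists (Num.sqrt `|c|); first by rewrite sqrtr_gt0 normr_gt0.
move=> gam Hg; rewrite -/A invmx_diag; set q := dotv gam (B *m gam).
have q0 : q != 0 by exact: dotv_inv_neq0.
have dk : \det (kappa_mx I D gam) = c * (q ^+ n / q ^+ 2).
  rewrite (det_kappa_chaplygin Hg) // -/q !exprMn /c.
  set P := D ^+ n; set S := q ^+ n.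
  by field; rewrite q0 dA gt_eqF.
have k0 := posdef_det_gt0 (posdef_kappa HI D0 gam).
rewrite /mu -[det_so _]/(\det (kappa_mx I D gam)) -(gtr0_norm k0) dk normrM sqrtrM //.
congr (_ * _); rewrite normrM normfV !normrX.
have nq0 : `|q| != 0 by rewrite normr_eq0.
have -> : `|q| ^+ n / `|q| ^+ 2 = (`|q| `^ (1 / 2 * (n%:R - 2))) ^+ 2.
  rewrite -[RHS]powR_mulrn ?powR_ge0 // -powRrM.
  have -> : 1 / 2 * (n%:R - 2) * 2%:R = n%:R + - 2%:R :> R by field.
  rewrite powRD; last by rewrite (negbTE nq0) implybT.
  by rewrite powRN !powR_mulrn.
by rewrite sqrtr_sqr ger0_norm // powR_ge0.
Qed.

End ChaplyginInertia.

Theorem theorem2 (R : realType) (n : nat) (I : 'M[R]_n -> 'M[R]_n)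
    (c : rolling_mode) (m rho sigma : R) :
  (0 < n)%N -> 0 < m -> 0 < rho -> 0 < sigma -> admissible c sigma rho ->
  inertia_tensor I ->
  let D := m * rho ^+ 2 in
  let eps := epsilon c sigma rho in
  (invariant_volume (@phase R n) (rolling_field I D eps) (rolling_volume I D)
   /\
   invariant_volume (@reduced_phase R n) (reduced_field I D eps)
     (reduced_volume I D))
  /\
  (forall a : 'rV[R]_n,
    (forall i j, 0 < a 0 i * a 0 j < D) ->
    (forall i j : 'I_n, I (wedgev (stdv R i) (stdv R j)) =
      (D * a 0 i * a 0 j / (D - a 0 i * a 0 j)) *:
        wedgev (stdv R i) (stdv R j)) ->
    let A := diag_mx a in
    exists2 C : R, 0 < C & forall gam : 'cV[R]_n, sphere gam ->
      mu I D gam =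
        C * `| dotv gam (invmx A *m gam) | `^ (1 / 2 * (n%:R - 2))).
Proof.
case: n I => [//|n'] I _ m0 rho0 sigma0 _ HI D eps.
have D0 : 0 < D by rewrite mulr_gt0 // exprn_gt0.
split; first by split; [exact: rolling_invariant|exact: reduced_invariant].
by move=> a Ha HIa; exact: mu_chaplygin HIa.
Qed.
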